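(* Let $Q$ be a finite quiver with vertex set $Q_0$. For every dimension vector $\mathbf{d}\in\mathbb{N}Q_0$ with $\mathbf{d}\neq 0$, the following identity holds in $\mathbb{M}$: $$\frac{[N_{\mathbf d}]}{[G_{\mathbf d}]}=-\sum_{\mathbf{e}\lneqq\mathbf{d}}\mathbb{L}^{-\langle\mathbf{e},\mathbf{d}-\mathbf{e}\rangle}\cdot(\mathbb{L})_{\mathbf{d}-\mathbf{e}}^{-1}\cdot\frac{[N_{\mathbf e}]}{[G_{\mathbf e}]},$$ and (together with $[N_0]=1$) this recursion determines $[N_{\mathbf d}]$ for all $\mathbf{d}\ne 0$. Here the sum is over all $\mathbf{e}\in\mathbb{N}Q_0$ with $\mathbf{e}\leq\mathbf{d}$ componentwise and $\mathbf{e}\neq\mathbf{d}$.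
   Context: $\mathbb{N}$ includes $0$. Arrows of $Q$ are written $\alpha:i\to j$. The Euler form is $\langle\mathbf{d},\mathbf{e}\rangle=\sum_{i\in Q_0}d_ie_i-\sum_{\alpha:i\to j}d_ie_j$. For $\mathbf{d}\in\mathbb{N}Q_0$ fix complex vector spaces $V_i$ with $\dim V_i=d_i$; $R_{\mathbf d}=\bigoplus_{\alpha:i\to j}\mathrm{Hom}_{\mathbb C}(V_i,V_j)$, with the base change action of $G_{\mathbf d}=\prod_{i\in Q_0}\mathrm{GL}(V_i)$, $(g_i)_i\cdot(V_\alpha)_\alpha=(g_jV_\alpha g_i^{-1})_{\alpha:i\to j}$. The nullcone $N_{\mathbf d}\subset R_{\mathbf d}$ is the closed subvariety (with reduced structure) of those $V$ such that $0$ lies in the closure of $G_{\mathbf d}\cdot V$; equivalently, such that $V_{\alpha_1}\circ\cdots\circ V_{\alpha_s}$ is nilpotent for every oriented cycle $\alpha_1\cdots\alpha_s$ in $Q$; equivalently, such that $V$ has a filtration by subrepresentations whose subquotients are among the one-dimensional representations $S_i$ ($i\in Q_0$) concentrated at vertex $i$ with all arrows acting as zero. $K_0(\mathrm{Var}_{\mathbb C})$ is the Grothendieck ring of complex varieties, $[X]$ the class of $X$, $\mathbb{L}=[\mathbb{A}^1]$, and $\mathbb{M}=K_0(\mathrm{Var}_{\mathbb C})[\mathbb{L}^{-1},(1-\mathbb{L}^i)^{-1}: i\ge 1]$. Put $(q)_n=(1-q)\cdots(1-q^n)$ and $(q)_{\mathbf d}=\prod_{i\in Q_0}(q)_{d_i}$.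 *)

(* Defs.v *)
From Stdlib Require Import Rdefinitions.
From HB Require Import structures.
From mathcomp Require Import all_boot all_order all_algebra.
From mathcomp Require Import generic_quotient.
From mathcomp Require Import boolp classical_sets.
From mathcomp Require Import mpoly complex Rstruct.

Set Implicit Arguments.
Unset Strict Implicit.
Unset Printing Implicit Defensive.

Import GRing.Theory.
Local Open Scope classical_set_scope.
Local Open Scope ring_scope.
Local Open Scope quotient_scope.

Notation CC := (R[i]).

(* Complex varieties, as Serre's spaces with functions: a variety is a set with
   a Zariski topology and a sheaf of C-valued regular functions, locally
   isomorphic to Zariski closed subsets of affine spaces.  Varieties are reduced
   and need not be irreducible; over C this is the category of reduced separated
   schemes of finite type.

   Underlying sets live in [Set], so that the varieties form a type on which
   MathComp ring structures can be built; every complex variety has an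
   isomorphic copy there, C being itself a [Set].  For the same reason a point
   of affine space is a sequence of given length: ['I_n -> C] and [n.-tuple C]
   are not in [Set]. *)

(* [reg U f]: U is open and the restriction of f to U is regular; the values
   of f outside U are irrelevant. *)
Record funspace := FunSpace {
  pt :> Set;
  opn : set (set pt);
  reg : set pt -> set (pt -> CC) }.

Definition zclosed (X : funspace) (A : set X) : Prop := opn (~` A).

Definition zclosure (X : funspace) (A : set X) : set X :=
  [set x | forall U : set X, opn U -> U x -> U `&` A !=set0].

Definition regular_map (X Y : funspace) (f : X -> Y) : Prop :=
  forall V : set Y, opn V ->
    opn (f @^-1` V) /\ forall g, reg V g -> reg (f @^-1` V) (g \o f).

Definition isomorphic (X Y : funspace) : Prop :=
  exists (f : X -> Y) (g : Y -> X),
    [/\ cancel f g, cancel g f, regular_map f & regular_map g].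

Definition induced_opn (X : funspace) (A : set X) : set (set {x : X | A x}) :=
  [set V | exists2 U : set X, opn U & V = (fun y => sval y) @^-1` U].

Definition induced (X : funspace) (A : set X) : funspace :=
  @FunSpace {x : X | A x} (@induced_opn X A)
    (fun V => [set f | induced_opn V /\
       forall y, V y -> exists (U : set X) (g : X -> CC),
         [/\ U (sval y), reg U g &
             forall z, V z -> U (sval z) -> f z = g (sval z)]]).

(* The functions sum_k a_k(x) b_k(y) on U x V, with a_k and b_k regular. *)
Definition bireg (X Y : funspace) (U : set X) (V : set Y) : set (X * Y -> CC) :=
  [set h | exists (m : nat) (a : 'I_m -> X -> CC) (b : 'I_m -> Y -> CC),
     [/\ forall k, reg U (a k), forall k, reg V (b k) &
         h = fun w => \sum_(k < m) a k w.1 * b k w.2]].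

Definition prod_opn (X Y : funspace) : set (set (X * Y)) :=
  [set W | forall w, W w -> exists (U : set X) (V : set Y) (h : X * Y -> CC),
     [/\ opn U, opn V, bireg U V h, (U `*` V) w /\ h w != 0 &
         forall v, (U `*` V) v -> h v != 0 -> W v]].

Definition prod_space (X Y : funspace) : funspace :=
  @FunSpace (X * Y) (@prod_opn X Y)
    (fun W => [set f | prod_opn W /\
       forall w, W w -> exists (U : set X) (V : set Y) (g h : X * Y -> CC),
         [/\ opn U /\ opn V, bireg U V g, bireg U V h, (U `*` V) w /\ h w != 0 &
             forall v, W v -> (U `*` V) v -> h v != 0 -> f v = g v / h v]]).

Definition evalp (n : nat) (p : {mpoly CC[n]}) (x : seq CC) : CC :=
  p.@[fun i : 'I_n => x`_i].

Definition affine_opn (n : nat) : set (set {x : seq CC | size x == n}) :=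
  [set U | exists S : set {mpoly CC[n]},
     U = [set x | exists2 p, S p & evalp p (sval x) != 0]].

Definition affine_space (n : nat) : funspace :=
  @FunSpace {x : seq CC | size x == n} (@affine_opn n)
    (fun U => [set f | affine_opn U /\
       forall x, U x -> exists p q : {mpoly CC[n]}, evalp q (sval x) != 0 /\
         forall y, U y -> evalp q (sval y) != 0 ->
           f y = evalp p (sval y) / evalp q (sval y)]).

Definition is_affine (X : funspace) : Prop :=
  exists (n : nat) (Z : set (affine_space n)),
    zclosed Z /\ isomorphic X (induced Z).

Definition sheaf_space (X : funspace) : Prop :=
  [/\ opn [set: X],
      forall U V : set X, opn U -> opn V -> opn (U `&` V),
      forall F : set (set X), F `<=` @opn X -> opn (\bigcup_(U in F) U)
      (* restriction and gluing of regular functions *)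
    & forall (U : set X) (f : X -> CC), reg U f <->
        opn U /\ forall x, U x -> exists (V : set X) (g : X -> CC),
          [/\ V x, reg V g & forall y, U y -> V y -> f y = g y]].

Record is_variety (X : funspace) : Prop := IsVariety {
  variety_sheaf : sheaf_space X;
  affine_cover : exists (m : nat) (U : 'I_m -> set X),
    (forall k, opn (U k) /\ is_affine (induced (U k))) /\
    (forall x, exists k, U k x);
  separated : zclosed (X := prod_space X X) [set w | w.1 = w.2] }.

Record variety := Variety { var_space :> funspace; varietyP : is_variety var_space }.

Lemma affine_opnP n (U : set (affine_space n)) : opn U <->
  forall x, U x -> exists p : {mpoly CC[n]}, evalp p (sval x) != 0 /\
    forall y : affine_space n, evalp p (sval y) != 0 -> U y.
Proof.
split=> [[S ->] x [p Sp px]|H]; first by exists p; split=> // y py; exists p.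
exists [set p | forall y : affine_space n, evalp p (sval y) != 0 -> U y].
apply/seteqP; split=> [x /H [p [px pU]]|x [p pU px]]; last exact: pU.
by exists p.
Qed.

Lemma affine_sheaf n : sheaf_space (affine_space n).
Proof.
split.
- apply/affine_opnP => x _; exists 1; split=> //.
  by rewrite /evalp mevalC oner_neq0.
- move=> U V /affine_opnP oU /affine_opnP oV; apply/affine_opnP => x [Ux Vx].
  have [p [px pU]] := oU x Ux; have [q [qx qV]] := oV x Vx.
  exists (p * q); rewrite /evalp mevalM mulf_neq0 //; split=> // y.
  rewrite mevalM mulf_eq0 negb_or => /andP[py qy].
  by split; [apply: pU|apply: qV].
- move=> F oF; apply/affine_opnP => x [U FU Ux].
  have /affine_opnP := oF U FU => /(_ x Ux) [p [px pU]].
  by exists p; split=> // y py; exists U => //; apply: pU.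
- move=> U f; split.
    move=> rf; split; first by case: rf.
    by move=> x Ux; exists U, f; split.
  move=> [oU H]; split=> // x Ux.
  have [V [g [Vx [oV rg] fg]]] := H x Ux.
  have [p [q [qx E]]] := rg x Vx.
  have /affine_opnP oV' := oV; have [h [hx hV]] := oV' x Vx.
  exists (p * h), (q * h); rewrite /evalp mevalM mulf_neq0 //; split=> // y Uy.
  rewrite !mevalM mulf_eq0 negb_or => /andP[qy hy].
  have Vy := hV _ hy.
  by rewrite (fg y Uy Vy) (E y Vy qy) /evalp -mulf_div divff // mulr1.
Qed.

Lemma induced_sheaf (X : funspace) (A : set X) :
  sheaf_space X -> sheaf_space (induced A).
Proof.
move=> [XT XI XB XR]; split.
- by exists setT.
- move=> _ _ [U oU ->] [V oV ->]; exists (U `&` V) => //; exact: XI.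
- move=> F oF.
  exists (\bigcup_(U in [set U : set X | opn U /\ F ((fun y => sval y) @^-1` U)]) U).
    by apply: XB => // U [].
  apply/seteqP; split=> x.
    move=> [V FV Vx]; have [U oU UE] := oF V FV.
    by exists U; [split=> //; rewrite -UE|rewrite UE in Vx].
  by move=> [U [oU FU] Ux]; exists ((fun y => sval y) @^-1` U).
- move=> U f; split.
    move=> rf; split; first by case: rf.
    by move=> x Ux; exists U, f.
  move=> [oU H]; split=> // x Ux.
  have [V [g [Vx [oV rg] fg]]] := H x Ux.
  have [W [k [Wx rk E]]] := rg x Vx.
  case: oV => V' oV' VE.
  exists (V' `&` W), k; split.
  + by split=> //; rewrite VE in Vx.
  + apply/XR; split; first by apply: XI => //; case/XR: rk.
    by move=> y [V'y Wy]; exists W, k; split.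
  + move=> z Uz [V'z Wz]; rewrite (fg z Uz) ?VE //; apply: E => //.
    by rewrite VE.
Qed.

Lemma induced_setT (X : funspace) :
  sheaf_space X -> isomorphic (induced [set: X]) X.
Proof.
move=> [_ _ _ XR]; exists (fun x => sval x), (fun x => exist _ x I); split=> //.
- by move=> [x []].
- move=> V oV; split; first by exists V.
  move=> g rg; split; first by exists V.
  by move=> y Vy; exists V, g; split.
- move=> _ [U oU ->]; split=> // g [_ rg].
  apply/XR; split=> // x Ux.
  have [W [h [Wx rh E]]] := rg (exist _ x I) Ux.
  exists W, h; split=> // y Uy Wy; exact: E.
Qed.

Lemma coordinates_separated (X : funspace) n (c : X -> affine_space n) :
  opn [set: X] -> injective c ->
  (forall p : {mpoly CC[n]}, reg [set: X] (fun x => evalp p (sval (c x)))) ->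
  zclosed (X := prod_space X X) [set w | w.1 = w.2].
Proof.
move=> oT c_inj c_reg [x y] /= xy.
have [i xyi] : exists i : 'I_n, (sval (c x))`_i <> (sval (c y))`_i.
  apply: contrapT => /forallNP H; apply/xy/c_inj/val_inj.
  case: (c x) H => s ss; case: (c y) => t tt /= H.
  apply: (@eq_from_nth _ 0); first by rewrite (eqP ss) (eqP tt).
  by move=> j; rewrite (eqP ss) => jn; have := H (Ordinal jn) => /contrapT.
pose a (k : 'I_2) x := evalp (if k == 0 then 'X_i else 1 : {mpoly CC[n]}) (sval (c x)).
pose b (k : 'I_2) x := evalp (if k == 0 then 1 else - 'X_i : {mpoly CC[n]}) (sval (c x)).
exists setT, setT, (fun w => \sum_(k < 2) a k w.1 * b k w.2).
have E w : \sum_(k < 2) a k w.1 * b k w.2 = (sval (c w.1))`_i - (sval (c w.2))`_i.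
  by rewrite big_ord_recl big_ord1 /a /b /= /evalp mevalN !mevalC !mevalXU mulr1 mul1r.
split=> //.
- by exists 2%N, a, b; split=> // k; apply: c_reg.
- by split=> //; rewrite E subr_eq0; apply/eqP.
- by move=> v _; rewrite E subr_eq0 => /eqP H /= vE; apply: H; rewrite vE.
Qed.

Lemma polynomial_regular n (p : {mpoly CC[n]}) :
  reg [set: affine_space n] (fun x => evalp p (sval x)).
Proof.
have [oT _ _ _] := affine_sheaf n; split=> // x _.
exists p, 1; rewrite /evalp mevalC oner_neq0; split=> // z _ _.
by rewrite mevalC divr1.
Qed.

Lemma closed_is_variety n (Z : set (affine_space n)) :
  zclosed Z -> is_variety (induced Z).
Proof.
move=> cZ; have sZ := induced_sheaf Z (affine_sheaf n).
case: (sZ) => ZT _ _ _; split=> //.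
- exists 1%N, (fun _ => setT); split; last by move=> x; exists 0.
  by move=> _; split=> //; exists n, Z; split=> //; exact: induced_setT.
- apply: (@coordinates_separated (induced Z) n (fun x => sval x)) => //.
    by move=> [x Zx] [y Zy] /= xy; apply: eq_exist.
  move=> p; split=> // y _; exists setT, (fun x => evalp p (sval x)).
  by split=> //; exact: polynomial_regular.
Qed.

Lemma affine_space_is_variety n : is_variety (affine_space n).
Proof.
have sA := affine_sheaf n; case: (sA) => AT _ AB _; split=> //.
- exists 1%N, (fun _ => setT); split; last by move=> x; exists 0.
  move=> _; split=> //; exists n, setT; split.
    rewrite /zclosed setCT -(bigcup_set0 (fun U : set (affine_space n) => U)).
    exact: AB.
  by exists id, id; split=> // V oV; split.
- apply: (@coordinates_separated (affine_space n) n id) => // p; exact: polynomial_regular.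
Qed.

Inductive term (G : Type) :=
  | Gen of G | Zero | One
  | Opp of term G | Add of term G & term G | Mul of term G & term G.
Arguments Zero {G}.
Arguments One {G}.

Inductive ring_eq (G : Type) (rel : term G -> term G -> Prop) :
    term G -> term G -> Prop :=
  | Rrel a b : rel a b -> ring_eq rel a b
  | Rrefl a : ring_eq rel a a
  | Rsym a b : ring_eq rel a b -> ring_eq rel b a
  | Rtrans b a c : ring_eq rel a b -> ring_eq rel b c -> ring_eq rel a c
  | Ropp a a' : ring_eq rel a a' -> ring_eq rel (Opp a) (Opp a')
  | Radd a a' b b' : ring_eq rel a a' -> ring_eq rel b b' ->
      ring_eq rel (Add a b) (Add a' b')
  | Rmul a a' b b' : ring_eq rel a a' -> ring_eq rel b b' ->
      ring_eq rel (Mul a b) (Mul a' b')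
  | RaddA a b c : ring_eq rel (Add a (Add b c)) (Add (Add a b) c)
  | RaddC a b : ring_eq rel (Add a b) (Add b a)
  | Radd0 a : ring_eq rel (Add Zero a) a
  | RaddN a : ring_eq rel (Add (Opp a) a) Zero
  | RmulA a b c : ring_eq rel (Mul a (Mul b c)) (Mul (Mul a b) c)
  | RmulC a b : ring_eq rel (Mul a b) (Mul b a)
  | Rmul1 a : ring_eq rel (Mul One a) a
  | RmulDl a b c : ring_eq rel (Mul (Add a b) c) (Add (Mul a c) (Mul b c)).

HB.instance Definition _ (G : Type) := gen_eqMixin (term G).
HB.instance Definition _ (G : Type) := gen_choiceMixin (term G).

Section Presented.
Variables (G : Type) (rel : term G -> term G -> Prop).

Definition ring_eqb (a b : term G) : bool := `[< ring_eq rel a b >].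

Lemma ring_eqb_refl : reflexive ring_eqb.
Proof. by move=> a; apply/asboolP; apply: Rrefl. Qed.

Lemma ring_eqb_sym : ssrbool.symmetric ring_eqb.
Proof. by move=> a b; apply/asboolP/asboolP; apply: Rsym. Qed.

Lemma ring_eqb_trans : transitive ring_eqb.
Proof. by move=> b a c /asboolP ab /asboolP bc; apply/asboolP; apply: Rtrans bc. Qed.

Canonical ring_eqb_equiv :=
  EquivRel ring_eqb ring_eqb_refl ring_eqb_sym ring_eqb_trans.

Definition presented := {eq_quot ring_eqb_equiv}.
HB.instance Definition _ := Choice.on presented.
HB.instance Definition _ := Quotient.on presented.

Definition pclass (a : term G) : presented := \pi_presented a.

Lemma pclass_eqP a b : pclass a = pclass b <-> ring_eq rel a b.
Proof. by split=> [/eqmodP/asboolP|ab] //; apply/eqmodP/asboolP. Qed.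

Lemma repr_pclass a : ring_eq rel (repr (pclass a)) a.
Proof. by apply/pclass_eqP; rewrite /pclass reprK. Qed.

Lemma presented_ind (P : presented -> Prop) : (forall a, P (pclass a)) -> forall x, P x.
Proof. by move=> H x; rewrite -[x]reprK; apply: H. Qed.

Definition padd (x y : presented) := pclass (Add (repr x) (repr y)).
Definition pmul (x y : presented) := pclass (Mul (repr x) (repr y)).
Definition popp (x : presented) := pclass (Opp (repr x)).

Lemma pclass_add a b : padd (pclass a) (pclass b) = pclass (Add a b).
Proof. by apply/pclass_eqP; apply: Radd; apply: repr_pclass. Qed.

Lemma pclass_mul a b : pmul (pclass a) (pclass b) = pclass (Mul a b).
Proof. by apply/pclass_eqP; apply: Rmul; apply: repr_pclass. Qed.

Lemma pclass_opp a : popp (pclass a) = pclass (Opp a).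
Proof. by apply/pclass_eqP; apply: Ropp; apply: repr_pclass. Qed.

Lemma paddA : associative padd.
Proof.
elim/presented_ind=> a; elim/presented_ind=> b; elim/presented_ind=> c.
by rewrite !pclass_add; apply/pclass_eqP; apply: RaddA.
Qed.

Lemma paddC : commutative padd.
Proof.
elim/presented_ind=> a; elim/presented_ind=> b.
by rewrite !pclass_add; apply/pclass_eqP; apply: RaddC.
Qed.

Lemma padd0 : left_id (pclass Zero) padd.
Proof. by elim/presented_ind=> a; rewrite pclass_add; apply/pclass_eqP; apply: Radd0. Qed.

Lemma paddN : left_inverse (pclass Zero) popp padd.
Proof.
by elim/presented_ind=> a; rewrite pclass_opp pclass_add; apply/pclass_eqP; apply: RaddN.
Qed.

HB.instance Definition _ := GRing.isZmodule.Build presented paddA paddC padd0 paddN.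

Lemma pmulA : associative pmul.
Proof.
elim/presented_ind=> a; elim/presented_ind=> b; elim/presented_ind=> c.
by rewrite !pclass_mul; apply/pclass_eqP; apply: RmulA.
Qed.

Lemma pmulC : commutative pmul.
Proof.
elim/presented_ind=> a; elim/presented_ind=> b.
by rewrite !pclass_mul; apply/pclass_eqP; apply: RmulC.
Qed.

Lemma pmul1 : left_id (pclass One) pmul.
Proof. by elim/presented_ind=> a; rewrite pclass_mul; apply/pclass_eqP; apply: Rmul1. Qed.

Lemma pmulDl : left_distributive pmul +%R.
Proof.
elim/presented_ind=> a; elim/presented_ind=> b; elim/presented_ind=> c.
rewrite -[_ + _]/(padd (pclass a) (pclass b)) -[RHS]/(padd _ _) !(pclass_add, pclass_mul).
by apply/pclass_eqP; apply: RmulDl.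
Qed.

HB.instance Definition _ :=
  GRing.Zmodule_isComPzRing.Build presented pmulA pmulC pmul1 pmulDl.

End Presented.

(* Closed and open subsets of varieties and products of varieties are again
   varieties; they enter the relations up to isomorphism. *)
Inductive K0_rel : term variety -> term variety -> Prop :=
  | K0_iso (X Y : variety) : isomorphic X Y -> K0_rel (Gen X) (Gen Y)
  | K0_scissor (X Z U : variety) (A : set X) : zclosed A ->
      isomorphic Z (induced A) -> isomorphic U (induced (~` A)) ->
      K0_rel (Gen X) (Add (Gen Z) (Gen U))
  | K0_product (X Y P : variety) : isomorphic P (prod_space X Y) ->
      K0_rel (Gen P) (Mul (Gen X) (Gen Y))
  | K0_point (P : variety) : isomorphic P (affine_space 0) ->
      K0_rel (Gen P) One.

Definition K0 : comPzRingType := presented K0_rel.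

(* The class of X, with the dummy value 0 if X is not a variety. *)
Definition K0_class (X : funspace) : K0 :=
  match pselect (is_variety X) with
  | left vX => pclass K0_rel (Gen (Variety vX))
  | right _ => 0
  end.

(* A[S^-1]: the elements of A and formal inverses of those of S, with the
   relations making A -> A[S^-1] a ring morphism. *)
Inductive loc_rel (A : comPzRingType) (S : set A) :
    term (A + {s : A | S s}) -> term (A + {s : A | S s}) -> Prop :=
  | loc_add a b :
      loc_rel (Gen (inl (a + b))) (Add (Gen (inl a)) (Gen (inl b)))
  | loc_mul a b :
      loc_rel (Gen (inl (a * b))) (Mul (Gen (inl a)) (Gen (inl b)))
  | loc_one : loc_rel (Gen (inl 1)) One
  | loc_inv (s : {s : A | S s}) :
      loc_rel (Mul (Gen (inl (sval s))) (Gen (inr s))) One.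

Definition localization (A : comPzRingType) (S : set A) : comPzRingType :=
  presented (@loc_rel A S).

Definition K0_denominators : set K0 :=
  [set s | s = K0_class (affine_space 1) \/
           exists2 i : nat, (1 <= i)%N & s = 1 - K0_class (affine_space 1) ^+ i].

Definition MM : comPzRingType := localization K0_denominators.

Definition motive (X : funspace) : MM :=
  pclass (@loc_rel K0 K0_denominators) (Gen (inl (K0_class X))).

Definition LL : MM := motive (affine_space 1).

(* MathComp's unit rings are required to be nontrivial, hence these local
   versions of inverses and of integer powers of units. *)
Definition invertible (x : MM) : Prop := exists y : MM, x * y = 1.

Definition inv (x : MM) : MM := xget 0 [set y : MM | x * y = 1].

Definition zpow (x : MM) (k : int) : MM :=
  match k with Posz n => x ^+ n | Negz n => inv x ^+ n.+1 end.

Record quiver := Quiver {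
  vertex : finType;
  arrow : finType;
  src : arrow -> vertex;
  tgt : arrow -> vertex }.

Section Representations.
Variable Q : quiver.

Definition dimvec := {ffun vertex Q -> nat}.

Implicit Types d e : dimvec.

Definition subdim d e : dimvec := [ffun i => (d i - e i)%N].

(* The e with e <= d componentwise. *)
Definition below d := {dffun forall i : vertex Q, 'I_(d i).+1}.

Definition dim_of d (e : below d) : dimvec := [ffun i => nat_of_ord (e i)].

Definition euler d e : int :=
  \sum_(i : vertex Q) (d i * e i)%N%:Z -
  \sum_(a : arrow Q) (d (src a) * e (tgt a))%N%:Z.

(* R_d is the affine space whose coordinates are the matrix entries of the
   linear maps C^(d i) -> C^(d j), acting on column vectors. *)
Definition rep_entry d : finType :=
  {a : arrow Q & ('I_(d (tgt a)) * 'I_(d (src a)))%type}.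

Definition rep_space d : funspace := affine_space #|rep_entry d|.

Definition rep_mx d (x : rep_space d) (a : arrow Q) :
    'M[CC]_(d (tgt a), d (src a)) :=
  \matrix_(r, c) (sval x)`_(enum_rank (Tagged _ (r, c) : rep_entry d)).

Definition gl_entry d : finType := {i : vertex Q & ('I_(d i) * 'I_(d i))%type}.

Definition gl_mx d (g : affine_space #|gl_entry d|) (i : vertex Q) : 'M[CC]_(d i) :=
  \matrix_(r, c) (sval g)`_(enum_rank (Tagged _ (r, c) : gl_entry d)).

Definition gl_group d : funspace :=
  induced [set g : affine_space #|gl_entry d| |
           forall i, gl_mx g i \in unitmx].

Definition gl_orbit d (x : rep_space d) : set (rep_space d) :=
  [set y | exists g : gl_group d, forall a : arrow Q,
     rep_mx y a =
     gl_mx (sval g) (tgt a) *m rep_mx x a *m invmx (gl_mx (sval g) (src a))].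

Definition nullcone_set d : set (rep_space d) :=
  [set x | exists2 z : rep_space d,
     forall a, rep_mx z a = 0 & zclosure (gl_orbit x) z].

Definition nullcone d : funspace := induced (@nullcone_set d).

Definition qfact (q : MM) (n : nat) : MM := \prod_(1 <= k < n.+1) (1 - q ^+ k).

Definition qfactd (q : MM) d : MM := \prod_(i : vertex Q) qfact q (d i).

(* The identity at d, with the classes [N_e] replaced by x e. *)
Definition nullcone_recursion (x : dimvec -> MM) d : Prop :=
  x d * inv (motive (gl_group d)) =
  - \sum_(e : below d | dim_of e != d)
      zpow LL (- euler (dim_of e) (subdim d (dim_of e))) *
      inv (qfactd LL (subdim d (dim_of e))) *
      (x (dim_of e) * inv (motive (gl_group (dim_of e)))).

End Representations.

(* Main.v *)
Require Import Defs.
From Stdlib Require Import Rdefinitions.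
From HB Require Import structures.
From mathcomp Require Import all_boot all_order all_algebra.
From mathcomp Require Import perm ring.
From mathcomp Require Import boolp classical_sets.
From mathcomp Require Import mpoly complex Rstruct.

(* For V nilpotent of dimension vector d and f <= d, count the pairs of V and a family
   of linearly independent f_i-tuples of vectors of the socle of V, the common kernel
   of the arrows.  Moving the tuples to the first coordinates gives
     [Inj(f, d)] [N_(d - f)] L^(sum_(a : i -> j) (d - f)_i f_j),
   while stratifying by the dimension s of the socle gives
     sum_s [N_d^s] prod_i prod_(k < f_i) (L^(s_i) - L^k).
   Dividing by (L)_f and summing over f, the terms of the first form become those of
   the recursion times [G_d], and the second form vanishes by the q-binomial theorem,
   because the socle of a nonzero nilpotent representation is not zero.

   The class in K_0 is extended to a finitely additive measure on sets decided by
   finitely many polynomial equations.  It is invariant under bijections which, together with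
   their inverses, are piecewise rational, so no local triviality has to be glued:
   Gaussian elimination, being piecewise rational, trivializes all the fibrations.

   That 0 is in the closure of the orbit of V iff all long paths act as zero:
   traces of closed paths are invariant, hence vanish, and a matrix algebra with
   vanishing traces is nilpotent; conversely the filtration by the kernels of the
   paths of length k, split, yields a one-parameter subgroup contracting V to 0. *)

Set Implicit Arguments.
Unset Strict Implicit.
Unset Printing Implicit Defensive.

Import Order.TTheory GRing.Theory Num.Theory.
Local Open Scope classical_set_scope.
Local Open Scope ring_scope.

Local Notation inv := Defs.inv.
Local Notation ell := (K0_class (affine_space 1)).

(** * Rational maps between basic sets *)

(** The recursion says that the sum over all e <= d, the term e = d included, is zero. The division
    by (L)_f rather than by the class of GL_f is what makes the strata cancel: at a vertex with
    socle dimension s, prod_(k < f) (L^s - L^k) / (L)_f equals (-1)^f L^(f choose 2) times the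
    Gaussian binomial of s and f. This is the class of the Grassmannian of f-dimensional subspaces
    weighted by the Moebius function of the subspace lattice, and such alternating sums vanish for s
    > 0.

    The relations of K_0 know only isomorphisms, products and one closed cut at a time, whereas
    bases adapted to a kernel or a span exist only piecewise. Sets are therefore presented by
    decision trees testing polynomials for zero: a node is one scissor relation, and two trees are
    compared by recutting one along the other. Functions are generated from the coordinates by ring
    operations and the total inverse; with 0^-1 = 0, f f^-1 is the indicator of f != 0, so that case
    distinctions, ranks and eliminations are reached by closure properties alone. *)

Definition pcoord n (x : affine_space n) (i : nat) : CC := (sval x)`_i.

(** Coordinates are numbered by naturals and read with default 0, so that points of different affine
    spaces are compared without casts. *)
Definition mkpoint n (f : nat -> CC) : affine_space n :=
  exist _ (mkseq f n) (introT eqP (size_mkseq f n)).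

Lemma pcoord_mkpoint n f i : (i < n)%N -> pcoord (mkpoint n f) i = f i.
Proof. by move=> lin; rewrite /pcoord /= nth_mkseq. Qed.

Lemma pcoordP n (x y : affine_space n) :
  (forall i, (i < n)%N -> pcoord x i = pcoord y i) -> x = y.
Proof.
move=> H; apply: val_inj; case: x y H => s ss [t tt] H /=.
apply: (@eq_from_nth _ 0); first by rewrite (eqP ss) (eqP tt).
by move=> i; rewrite (eqP ss) => /H.
Qed.

Definition pev n (p : {mpoly CC[n]}) (x : affine_space n) : CC := evalp p (sval x).

Lemma pevE n (p : {mpoly CC[n]}) x : pev p x = p.@[fun i : 'I_n => pcoord x i].
Proof. by []. Qed.
Lemma pev0 n x : pev (0 : {mpoly CC[n]}) x = 0. Proof. exact: meval0. Qed.
Lemma pev1 n x : pev (1 : {mpoly CC[n]}) x = 1. Proof. exact: meval1. Qed.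
Lemma pevC n c x : pev (c%:MP : {mpoly CC[n]}) x = c. Proof. exact: mevalC. Qed.
Lemma pevD n (p q : {mpoly CC[n]}) x : pev (p + q) x = pev p x + pev q x.
Proof. exact: mevalD. Qed.
Lemma pevN n (p : {mpoly CC[n]}) x : pev (- p) x = - pev p x.
Proof. exact: mevalN. Qed.
Lemma pevM n (p q : {mpoly CC[n]}) x : pev (p * q) x = pev p x * pev q x.
Proof. exact: mevalM. Qed.
Lemma pevX n (i : 'I_n) x : pev ('X_i : {mpoly CC[n]}) x = pcoord x i.
Proof. exact: mevalXU. Qed.

Lemma induced_opnP n (S : set (affine_space n)) (V : set (induced S)) : opn V <->
  forall y, V y -> exists p, pev p (sval y) != 0 /\
    forall z : induced S, pev p (sval z) != 0 -> V z.
Proof.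
split.
  move=> [U /affine_opnP oU ->] y Uy; have [p [py pU]] := oU _ Uy.
  by exists p; split=> // z pz; apply: pU.
move=> H; exists [set x : affine_space n | exists2 p, pev p x != 0 &
   forall z : induced S, pev p (sval z) != 0 -> V z].
  apply/affine_opnP => x [p px pV]; exists p; split=> // y py; by exists p.
apply/seteqP; split=> y.
  by move=> /H [p [py pV]]; exists p.
by move=> [p py pV]; apply: pV.
Qed.

Lemma induced_regP n (S : set (affine_space n)) (V : set (induced S)) f :
  reg V f <-> opn V /\ forall y, V y -> exists p q, pev q (sval y) != 0 /\
    forall z, V z -> pev q (sval z) != 0 -> f z = pev p (sval z) / pev q (sval z).
Proof.
split=> [[oV H]|[oV H]]; split=> // y Vy.
  have [U [g [Uy [oU rg] fg]]] := H y Vy.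
  have [p [q [qy E]]] := rg _ Uy.
  have /affine_opnP := oU => /(_ _ Uy) [h [hy hU]].
  (* The factor [h] leaves the fraction unchanged and confines the nonvanishing locus of the
     denominator to [U], where [g] is known to be regular. *)
  exists (p * h), (q * h); rewrite pevM mulf_neq0 //; split=> // z Vz.
  rewrite !pevM mulf_eq0 negb_or => /andP[qz hz].
  have Uz := hU _ hz.
  by rewrite (fg z Vz Uz) (E _ Uz qz) -mulf_div divff // mulr1.
have [p [q [qy E]]] := H y Vy.
exists [set x | pev q x != 0], (fun x => pev p x / pev q x); split=> //.
split; first by apply/affine_opnP => x qx; exists q.
by move=> x qx; exists p, q; split.
Qed.

Lemma induced_setT_opn n (S : set (affine_space n)) : opn [set: induced S].
Proof. by have [] := induced_sheaf S (affine_sheaf n). Qed.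

(** The predicate [R] stands in turn for regular, biregular, rational, piecewise rational and
    polynomial functions: each class is a ring containing the constants, hence stable under
    substitution into polynomials. *)
Lemma function_ring_sum (X : Type) (R : (X -> CC) -> Prop) :
  (forall c, R (fun=> c)) ->
  (forall f g, R f -> R g -> R (fun x => f x + g x)) ->
  forall I (r : seq I) (P : pred I) (g : I -> X -> CC), (forall i, R (g i)) ->
  R (fun x => \sum_(i <- r | P i) g i x).
Proof.
move=> RC RA I r P g Rg; elim: r => [|i r IH].
  by rewrite (_ : (fun _ => _) = fun=> 0) //; apply/funext => x; rewrite big_nil.
rewrite (_ : (fun _ => _) = fun x => (if P i then g i x else 0) +
    \sum_(i <- r | P i) g i x); first by apply: RA => //; case: (P i).
by apply/funext => x; rewrite big_cons; case: (P i); rewrite ?add0r.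
Qed.

Lemma function_ring_prod (X : Type) (R : (X -> CC) -> Prop) :
  (forall c, R (fun=> c)) ->
  (forall f g, R f -> R g -> R (fun x => f x * g x)) ->
  forall I (r : seq I) (P : pred I) (g : I -> X -> CC), (forall i, R (g i)) ->
  R (fun x => \prod_(i <- r | P i) g i x).
Proof.
move=> RC RM I r P g Rg; elim: r => [|i r IH].
  by rewrite (_ : (fun _ => _) = fun=> 1) //; apply/funext => x; rewrite big_nil.
rewrite (_ : (fun _ => _) = fun x => (if P i then g i x else 1) *
    \prod_(i <- r | P i) g i x); first by apply: RM => //; case: (P i).
by apply/funext => x; rewrite big_cons; case: (P i); rewrite ?mul1r.
Qed.

Lemma function_ring_meval (X : Type) (R : (X -> CC) -> Prop) :
  (forall c, R (fun=> c)) ->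
  (forall f g, R f -> R g -> R (fun x => f x + g x)) ->
  (forall f g, R f -> R g -> R (fun x => f x * g x)) ->
  forall m (P : {mpoly CC[m]}) (f : 'I_m -> X -> CC),
  (forall i, R (f i)) -> R (fun x => P.@[fun i => f i x]).
Proof.
move=> RC RA RM m P f Rf.
have RX g k : R g -> R (fun x => g x ^+ k).
  move=> Rg; elim: k => [|k IH]; first exact: RC.
  rewrite (_ : (fun _ => _) = fun x => g x * g x ^+ k); first exact: RM.
  by apply/funext => x; rewrite exprS.
rewrite (_ : (fun _ => _) =
   (fun x => \sum_(k <- msupp P) P@_k * \prod_i f i x ^+ k i)); last first.
  by apply/funext => x; rewrite mevalE.
apply: (function_ring_sum RC RA) => k; apply: (RM); first exact: RC.
by apply: (function_ring_prod RC RM) => i; apply: RX.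
Qed.

Section RegularClosure.
Variables (n : nat) (S : set (affine_space n)) (V : set (induced S)).
Hypothesis oV : opn V.

Lemma regular_const c : reg V (fun _ => c).
Proof.
apply/induced_regP; split=> // y _; exists c%:MP, 1; rewrite pev1 oner_neq0.
by split=> // z _ _; rewrite pevC pev1 divr1.
Qed.

Lemma regular_add f g : reg V f -> reg V g -> reg V (fun x => f x + g x).
Proof.
move=> /induced_regP[_ rf] /induced_regP[_ rg]; apply/induced_regP; split=> // y Vy.
have [p [q [qy E]]] := rf y Vy; have [p' [q' [qy' E']]] := rg y Vy.
exists (p * q' + p' * q), (q * q'); rewrite pevM mulf_neq0 //; split=> // z Vz.
rewrite pevD !pevM mulf_eq0 negb_or => /andP[qz qz'].
by rewrite (E _ Vz qz) (E' _ Vz qz') addf_div.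
Qed.

Lemma regular_mul f g : reg V f -> reg V g -> reg V (fun x => f x * g x).
Proof.
move=> /induced_regP[_ rf] /induced_regP[_ rg]; apply/induced_regP; split=> // y Vy.
have [p [q [qy E]]] := rf y Vy; have [p' [q' [qy' E']]] := rg y Vy.
exists (p * p'), (q * q'); rewrite pevM mulf_neq0 //; split=> // z Vz.
rewrite !pevM mulf_eq0 negb_or => /andP[qz qz'].
by rewrite (E _ Vz qz) (E' _ Vz qz') mulf_div.
Qed.

Lemma regular_meval m (P : {mpoly CC[m]}) (f : 'I_m -> induced S -> CC) :
  (forall i, reg V (f i)) -> reg V (fun x => P.@[fun i => f i x]).
Proof.
exact: (function_ring_meval regular_const regular_add regular_mul P).
Qed.

End RegularClosure.

(** Regular coordinates suffice, since a regular function on the target is locally a fraction of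
    polynomials in them. *)
Lemma regular_coordinates n m (S : set (affine_space n)) (T : set (affine_space m))
    (f : induced S -> induced T) :
  (forall i : 'I_m, reg setT (fun x => pcoord (sval (f x)) i)) -> regular_map f.
Proof.
move=> rf.
have rP (P : {mpoly CC[m]}) : reg setT (fun x => pev P (sval (f x))).
  exact: (regular_meval (induced_setT_opn S) P rf).
move=> V oV; have oV' : opn (f @^-1` V).
  apply/induced_opnP => y Vy.
  have /induced_opnP/(_ _ Vy)[P [Py PV]] := oV.
  have /induced_regP[_ /(_ y I) [p [q [qy E]]]] := rP P.
  exists (p * q); rewrite pevM mulf_neq0 //; last first.
    by apply: contraNneq Py => py; rewrite (E y I qy) py mul0r.
  split=> // z; rewrite pevM mulf_eq0 negb_or => /andP[pz qz].
  by apply: PV; rewrite (E z I qz) mulf_neq0 // invr_neq0.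
split=> // g /induced_regP[_ rg]; apply/induced_regP; split=> // y Vy.
have [P [Q [Qy E]]] := rg _ Vy.
have /induced_regP[_ /(_ y I) [p1 [q1 [q1y E1]]]] := rP P.
have /induced_regP[_ /(_ y I) [p2 [q2 [q2y E2]]]] := rP Q.
(* The fraction P / Q pulls back to p1 q2 / (q1 p2). The further factor [q2] makes a nonzero
   denominator imply that the local expression of Q is valid. *)
exists (p1 * q2 * q2), (q1 * p2 * q2); rewrite !pevM.
have p2y : pev p2 (sval y) != 0.
  by apply: contraNneq Qy => py; rewrite (E2 y I q2y) py mul0r.
rewrite !mulf_neq0 //; split=> // z Vz; rewrite !pevM.
rewrite !mulf_eq0 !negb_or => /andP[/andP[q1z p2z] q2z].
have Qz : pev Q (sval (f z)) != 0 by rewrite (E2 z I q2z) mulf_neq0 // invr_neq0.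
rewrite /= (E _ Vz Qz) (E1 z I q1z) (E2 z I q2z) invf_div mulf_div.
by rewrite -[RHS]mulf_div divff // mulr1.
Qed.

(** One fraction valid on the whole of [S], where regularity asks for fractions only locally.
    Decision trees cut any piecewise rational function down to such sets. *)
Definition rational n (S : set (affine_space n)) (f : affine_space n -> CC) : Prop :=
  exists p q, forall x, S x -> pev q x != 0 /\ f x = pev p x / pev q x.

Lemma rational_regular n (S : set (affine_space n)) f :
  rational S f -> reg setT (fun x : induced S => f (sval x)).
Proof.
move=> [p [q E]]; apply/induced_regP; split; first exact: induced_setT_opn.
move=> [y Sy] _; exists p, q; split; first by have [] := E y Sy.
by move=> [z Sz] _ _; have [] := E z Sz.
Qed.

Lemma rational_poly n (S : set (affine_space n)) p : rational S (pev p).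
Proof. by exists p, 1 => x _; rewrite pev1 divr1 oner_neq0. Qed.

Lemma rational_isomorphic n m (S : set (affine_space n)) (T : set (affine_space m))
    (f : affine_space n -> affine_space m) (g : affine_space m -> affine_space n) :
  (forall x, S x -> T (f x)) -> (forall y, T y -> S (g y)) ->
  (forall x, S x -> g (f x) = x) -> (forall y, T y -> f (g y) = y) ->
  (forall i : 'I_m, rational S (fun x => pcoord (f x) i)) ->
  (forall i : 'I_n, rational T (fun x => pcoord (g x) i)) ->
  isomorphic (induced S) (induced T).
Proof.
move=> ST TS fK gK rf rg.
exists (fun x => exist _ (f (sval x)) (ST _ (svalP x))),
  (fun y => exist _ (g (sval y)) (TS _ (svalP y))); split.
- by move=> [x Sx]; apply: eq_exist => /=; exact: fK.
- by move=> [x Sx]; apply: eq_exist => /=; exact: gK.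
- by apply: regular_coordinates => i /=; exact: rational_regular (rf i).
- by apply: regular_coordinates => i /=; exact: rational_regular (rg i).
Qed.

Definition zeros n (P : set {mpoly CC[n]}) : set (affine_space n) :=
  [set x | forall p, P p -> pev p x = 0].

Lemma zeros_closed n (P : set {mpoly CC[n]}) : zclosed (zeros P).
Proof.
apply/affine_opnP => x /existsNP[p /not_implyP[Pp /eqP px]].
by exists p; split=> // y py yP; case/eqP: py; apply: yP.
Qed.

(** A closed set minus a hypersurface. Unlike a general locally closed set it is always affine, and
    the family is stable under intersection and under cutting along a polynomial, in both
    directions. *)
Definition basic n (S : set (affine_space n)) : Prop :=
  exists P h, S = [set x | zeros P x /\ pev h x != 0].

Definition pzero n (g : {mpoly CC[n]}) : set (affine_space n) := [set x | pev g x = 0].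

Lemma basicT n : basic [set: affine_space n].
Proof.
exists set0, 1; apply/seteqP; split=> x //= _; split; first by move=> p [].
by rewrite pev1 oner_neq0.
Qed.

Lemma basicI n (S T : set (affine_space n)) : basic S -> basic T -> basic (S `&` T).
Proof.
move=> [P [h ->]] [P' [h' ->]]; exists (P `|` P'), (h * h').
apply/seteqP; split=> x /=; rewrite pevM mulf_eq0 negb_or.
  by move=> [[zP ->] [zP' ->]]; split=> // p [/zP|/zP'].
move=> [zP /andP[-> ->]]; split; split=> // p Pp; apply: zP; by [left|right].
Qed.

Lemma basic_zeros n (P : set {mpoly CC[n]}) : basic (zeros P).
Proof.
exists P, 1; apply/seteqP; split=> x /=; last by case.
by move=> ?; rewrite pev1 oner_neq0.
Qed.

Lemma basic_pzero n (g : {mpoly CC[n]}) : basic (pzero g).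
Proof.
rewrite (_ : pzero g = zeros [set g]); first exact: basic_zeros.
by apply/seteqP; split=> x /= H; [move=> p ->|apply: H].
Qed.

Lemma basic_nonzero n (g : {mpoly CC[n]}) : basic (~` pzero g).
Proof.
exists set0, g; apply/seteqP; split=> x /=; first by move=> /eqP H; split=> // p [].
by move=> [_ H]; apply/eqP.
Qed.


Definition reindex n m (s : 'I_n -> 'I_m) (p : {mpoly CC[n]}) : {mpoly CC[m]} :=
  p \mPo [tuple 'X_(s i) | i < n].

Lemma pev_reindex n m (s : 'I_n -> 'I_m) (p : {mpoly CC[n]})
    (x : affine_space n) (y : affine_space m) :
  (forall i : 'I_n, pcoord x i = pcoord y (s i)) -> pev (reindex s p) y = pev p x.
Proof.
move=> xy; rewrite !pevE comp_mpoly_meval; apply: meval_eq => i.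
by rewrite tnth_mktuple mevalXU xy.
Qed.

(* Rabinowitsch: x |-> (x, 1 / h x) identifies Z \ V(h) with a closed subset of A^(n+1). *)
Lemma basic_closed_iso n (S : set (affine_space n)) : basic S ->
  exists Z : set (affine_space n.+1), zclosed Z /\ isomorphic (induced S) (induced Z).
Proof.
move=> [P [h ->]].
pose up := reindex (widen_ord (leqnSn n)).
pose dn (y : affine_space n.+1) : affine_space n := mkpoint n (pcoord y).
have upE p y : pev (up p) y = pev p (dn y).
  by apply: pev_reindex => i; rewrite pcoord_mkpoint.
pose t : {mpoly CC[n.+1]} := 'X_ord_max.
exists (zeros (up @` P `|` [set t * up h - 1])); split; first exact: zeros_closed.
pose lift x : affine_space n.+1 :=
  mkpoint n.+1 (fun i => if (i < n)%N then pcoord x i else (pev h x)^-1).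
have dnK x : dn (lift x) = x.
  apply: pcoordP => i lin; rewrite pcoord_mkpoint // pcoord_mkpoint ?lin //.
  exact: ltnW.
have tE x : pev t (lift x) = (pev h x)^-1.
  by rewrite pevX pcoord_mkpoint //= ltnn.
have zE y : zeros (up @` P `|` [set t * up h - 1]) y ->
    zeros P (dn y) /\ pev t y * pev h (dn y) = 1.
  move=> zy; split; first by move=> p Pp; rewrite -upE; apply: zy; left; exists p.
  have /eqP := zy _ (or_intror erefl).
  by rewrite pevD pevN pev1 pevM upE subr_eq0 => /eqP.
apply: (@rational_isomorphic _ _ _ _ lift dn).
- move=> x [zx hx] p [[q Pq <-]|->]; first by rewrite upE dnK; exact: zx.
  by rewrite pevD pevN pev1 pevM upE dnK tE mulVf // subrr.
- move=> y /zE[zy ty]; split=> //.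
  by apply/eqP => h0; move: ty; rewrite h0 mulr0 => /eqP; rewrite eq_sym oner_eq0.
- by move=> x _; apply: dnK.
- move=> y /zE[_ ty]; apply: pcoordP => i; rewrite ltnS leq_eqVlt.
  case/orP => [/eqP->|lin].
    rewrite pcoord_mkpoint // ltnn -[RHS]mulr1 -[X in _ = _ * X](@mulfV _ (pev h (dn y))).
      by rewrite mulrA -[pcoord y n](pevX ord_max) ty mul1r.
    by apply/eqP => h0; move: ty; rewrite h0 mulr0 => /eqP; rewrite eq_sym oner_eq0.
  by rewrite pcoord_mkpoint ?lin ?pcoord_mkpoint // ltnW.
- move=> i; case: (ltnP i n) => lin.
    exists 'X_(Ordinal lin), 1 => x _; rewrite pev1 oner_neq0 divr1 pevX.
    by rewrite pcoord_mkpoint //= lin.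
  exists 1, h => x [_ hx]; rewrite hx pcoord_mkpoint // ltnNge lin /=.
  by rewrite pev1 mul1r.
- by move=> i; exists 'X_(widen_ord (leqnSn n) i), 1 => x _;
    rewrite pev1 oner_neq0 divr1 pevX pcoord_mkpoint.
Qed.

Lemma regular_comp (X Y Z : funspace) (f : X -> Y) (g : Y -> Z) :
  regular_map f -> regular_map g -> regular_map (g \o f).
Proof.
move=> rf rg V oV; have [oV' rV] := rg V oV; have [oV'' rV'] := rf _ oV'.
by split=> // h /rV /rV'.
Qed.

Lemma isomorphic_trans (X Y Z : funspace) :
  isomorphic X Y -> isomorphic Y Z -> isomorphic X Z.
Proof.
move=> [f [f' [fK fK' rf rf']]] [g [g' [gK gK' rg rg']]].
exists (g \o f), (f' \o g'); split.
- by move=> x /=; rewrite gK fK.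
- by move=> x /=; rewrite fK' gK'.
- exact: regular_comp.
- exact: regular_comp.
Qed.

Lemma isomorphic_refl (X : funspace) : isomorphic X X.
Proof. by exists id, id; split. Qed.

Lemma basic_is_variety n (S : set (affine_space n)) : basic S -> is_variety (induced S).
Proof.
move=> bS; have sS := induced_sheaf S (affine_sheaf n).
have oT := @induced_setT_opn n S; split=> //.
- exists 1%N, (fun _ => setT); split; last by move=> x; exists 0.
  move=> _; split=> //; have [Z [cZ iZ]] := basic_closed_iso bS.
  by exists n.+1, Z; split=> //; exact: isomorphic_trans (induced_setT sS) iZ.
- apply: (@coordinates_separated (induced S) n (fun x => sval x)) => //.
    by move=> [x Sx] [y Sy] /= xy; apply: eq_exist.
  by move=> p; apply: (rational_regular (rational_poly S p)).
Qed.

Lemma rational_pullback n m (S : set (affine_space n))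
    (f : affine_space n -> affine_space m) (P : {mpoly CC[m]}) :
  (forall i : 'I_m, rational S (fun x => pcoord (f x) i)) ->
  rational S (fun x => pev P (f x)).
Proof.
move=> rf.
have rC c : rational S (fun=> c).
  by exists c%:MP, 1 => x _; rewrite pev1 pevC divr1 oner_neq0.
have rA g h : rational S g -> rational S h -> rational S (fun x => g x + h x).
  move=> [p [q E]] [p' [q' E']]; exists (p * q' + p' * q), (q * q') => x Sx.
  have [qx ->] := E x Sx; have [qx' ->] := E' x Sx.
  by rewrite pevD !pevM mulf_neq0 // addf_div.
have rM g h : rational S g -> rational S h -> rational S (fun x => g x * h x).
  move=> [p [q E]] [p' [q' E']]; exists (p * p'), (q * q') => x Sx.
  have [qx ->] := E x Sx; have [qx' ->] := E' x Sx.
  by rewrite !pevM mulf_neq0 // mulf_div.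
exact: (function_ring_meval rC rA rM P rf).
Qed.

Lemma basic_preimage n m (S : set (affine_space n)) (T : set (affine_space m))
    (f : affine_space n -> affine_space m) :
  basic S -> basic T -> (forall i : 'I_m, rational S (fun x => pcoord (f x) i)) ->
  basic (S `&` f @^-1` T).
Proof.
move=> bS [P [h ->]] rf.
have [ph [qh Eh]] := rational_pullback h rf.
have nz p q x P0 : pev q x != 0 /\ pev P0 (f x) = pev p x / pev q x ->
   (pev P0 (f x) == 0) = (pev p x == 0).
  by move=> [qx ->]; rewrite mulf_eq0 invr_eq0 (negPf qx) orbF.
rewrite (_ : _ `&` _ = S `&` ((zeros [set p | exists P0 q, P P0 /\ forall x, S x ->
   pev q x != 0 /\ pev P0 (f x) = pev p x / pev q x]) `&` ~` pzero ph)).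
  by apply: basicI => //; apply: basicI; [exact: basic_zeros|exact: basic_nonzero].
apply/seteqP; split=> x [Sx].
- move=> [zx hx]; split=> //; split; last first.
    by apply/eqP; rewrite -(nz _ _ _ _ (Eh x Sx)).
  move=> p [P0 [q [PP0 E]]]; apply/eqP; rewrite -(nz _ _ _ _ (E x Sx)); apply/eqP.
  exact: zx.
- move=> [zx /eqP hx]; split=> //; split; last by rewrite (nz _ _ _ _ (Eh x Sx)).
  move=> P0 PP0; have [p [q E]] := rational_pullback P0 rf.
  apply/eqP; rewrite (nz _ _ _ _ (E x Sx)); apply/eqP; apply: zx.
  by exists P0, q.
Qed.

Definition pjoin n m (x : affine_space n) (y : affine_space m) : affine_space (n + m) :=
  mkpoint (n + m) (fun i => if (i < n)%N then pcoord x i else pcoord y (i - n)).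
Definition pfst n m (z : affine_space (n + m)) : affine_space n := mkpoint n (pcoord z).
Definition psnd n m (z : affine_space (n + m)) : affine_space m :=
  mkpoint m (fun i => pcoord z (n + i)).

Lemma pjoinK1 n m (x : affine_space n) (y : affine_space m) : pfst (pjoin x y) = x.
Proof.
by apply: pcoordP => i lin; rewrite !pcoord_mkpoint ?lin // ltn_addr.
Qed.

Lemma pjoinK2 n m (x : affine_space n) (y : affine_space m) : psnd (pjoin x y) = y.
Proof.
apply: pcoordP => i lin; rewrite !pcoord_mkpoint ?ltn_add2l //.
by rewrite ltnNge leq_addr /= addKn.
Qed.

Lemma pjoin_split n m (z : affine_space (n + m)) : pjoin (pfst z) (psnd z) = z.
Proof.
apply: pcoordP => i lin; rewrite pcoord_mkpoint //; case: ltnP => h.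
  by rewrite pcoord_mkpoint.
by rewrite pcoord_mkpoint ?subnKC // ltn_subLR.
Qed.

Definition pprod n m (S : set (affine_space n)) (T : set (affine_space m)) :
  set (affine_space (n + m)) := [set z | S (pfst z) /\ T (psnd z)].

Lemma basic_pprod n m (S : set (affine_space n)) (T : set (affine_space m)) :
  basic S -> basic T -> basic (pprod S T).
Proof.
move=> bS bT.
rewrite (_ : pprod S T = (setT `&` (@pfst n m) @^-1` S) `&` (setT `&` (@psnd n m) @^-1` T)).
  apply: basicI; apply: basic_preimage; rewrite //; try exact: basicT.
    by move=> i; exists 'X_(lshift m i), 1 => x _;
      rewrite pev1 oner_neq0 divr1 pevX pcoord_mkpoint.
  by move=> i; exists 'X_(rshift n i), 1 => x _;
    rewrite pev1 oner_neq0 divr1 pevX pcoord_mkpoint.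
by apply/seteqP; split=> z; [move=> []|move=> [[_ ?] [_ ?]]].
Qed.

(** * Products and classes in K_0 *)

Lemma regular_nonzero_open n (S : set (affine_space n)) (V : set (induced S)) f :
  reg V f -> opn [set x | V x /\ f x != 0].
Proof.
move=> /induced_regP[oV rf]; apply/induced_opnP => y [Vy fy].
have [p [q [qy E]]] := rf y Vy.
have /induced_opnP/(_ y Vy)[h [hy hV]] := oV.
have py : pev p (sval y) != 0.
  by apply: contraNneq fy => py; rewrite (E y Vy qy) py mul0r.
exists (h * p * q); rewrite !pevM !mulf_neq0 //; split=> // z.
rewrite !pevM !mulf_eq0 !negb_or => /andP[/andP[hz pz] qz].
have Vz := hV z hz; split=> //.
by rewrite (E z Vz qz) mulf_neq0 // invr_neq0.
Qed.

Lemma regular_inv n (S : set (affine_space n)) (V : set (induced S)) f :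
  reg V f -> (forall x, V x -> f x != 0) -> reg V (fun x => (f x)^-1).
Proof.
move=> /induced_regP[oV rf] f0; apply/induced_regP; split=> // y Vy.
have [p [q [qy E]]] := rf y Vy.
have py : pev p (sval y) != 0.
  by apply: contraNneq (f0 y Vy) => py; rewrite (E y Vy qy) py mul0r.
exists (q * q), (p * q); rewrite !pevM mulf_neq0 //; split=> // z Vz.
rewrite !pevM !mulf_eq0 !negb_or => /andP[pz qz].
by rewrite (E z Vz qz) invf_div -mulf_div divff // mulr1.
Qed.

Lemma regular_restrict n (S : set (affine_space n)) (V W : set (induced S)) f :
  reg V f -> opn W -> W `<=` V -> reg W f.
Proof.
move=> /induced_regP[oV rf] oW WV; apply/induced_regP; split=> // y Wy.
have [p [q [qy E]]] := rf y (WV _ Wy).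
by exists p, q; split=> // z Wz; apply: E; apply: WV.
Qed.

Section Bireg.
Variables (X Y : funspace) (U : set X) (V : set Y).

Lemma bireg_fin (K : finType) (a : K -> X -> CC) (b : K -> Y -> CC) :
  (forall k, reg U (a k)) -> (forall k, reg V (b k)) ->
  bireg U V (fun w => \sum_k a k w.1 * b k w.2).
Proof.
move=> ra rb; exists #|K|, (fun i => a (enum_val i)), (fun i => b (enum_val i)).
split=> //; apply/funext => w.
rewrite (reindex_onto (fun i : 'I_#|K| => enum_val i) enum_rank) /=; last first.
  by move=> k _; rewrite enum_rankK.
by apply: eq_bigl => i; rewrite enum_valK eqxx.
Qed.

Lemma bireg_add g h : bireg U V g -> bireg U V h -> bireg U V (fun w => g w + h w).
Proof.
move=> [m [a [b [ra rb ->]]]] [m' [a' [b' [ra' rb' ->]]]].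
have := @bireg_fin ('I_m + 'I_m')%type
  (fun k => match k with inl i => a i | inr i => a' i end)
  (fun k => match k with inl i => b i | inr i => b' i end).
rewrite (_ : (fun w => \sum_k _) = (fun w => \sum_(k < m) a k w.1 * b k w.2 +
   \sum_(k < m') a' k w.1 * b' k w.2)); last by apply/funext => w; rewrite big_sumType.
by apply; case.
Qed.

Lemma bireg_mul g h :
  (forall f f', reg U f -> reg U f' -> reg U (fun x => f x * f' x)) ->
  (forall f f', reg V f -> reg V f' -> reg V (fun x => f x * f' x)) ->
  bireg U V g -> bireg U V h -> bireg U V (fun w => g w * h w).
Proof.
move=> UM VM [m [a [b [ra rb ->]]]] [m' [a' [b' [ra' rb' ->]]]].
have := @bireg_fin ('I_m * 'I_m')%type
  (fun k x => a k.1 x * a' k.2 x) (fun k x => b k.1 x * b' k.2 x).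
rewrite (_ : (fun w => \sum_k _) = (fun w => (\sum_(k < m) a k w.1 * b k w.2) *
   \sum_(k < m') a' k w.1 * b' k w.2)); last first.
  apply/funext => w; rewrite big_distrlr pair_big /=.
  by apply: eq_bigr => k _; rewrite mulrACA.
by apply=> k; [apply: UM|apply: VM].
Qed.

End Bireg.

Section Product.
Variables (n m : nat) (S : set (affine_space n)) (T : set (affine_space m)).

(** A polynomial in two groups of variables is a sum of products of polynomials in each group, which
    is the form used to define opens and regular functions on [prod_space]. *)
Lemma bireg_pjoin (P : {mpoly CC[n + m]}) :
  bireg (X := induced S) (Y := induced T) setT setT
    (fun w => pev P (pjoin (sval w.1) (sval w.2))).
Proof.
have oS := induced_setT_opn S; have oT := induced_setT_opn T.
have B1 f g : reg setT f -> reg setT g ->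
  bireg (X := induced S) (Y := induced T) setT setT (fun w => f w.1 * g w.2).
  move=> rf rg.
  have := @bireg_fin (induced S) (induced T) setT setT unit (fun=> f) (fun=> g).
  rewrite (_ : (fun w => \sum_k _) = (fun w => f w.1 * g w.2)); first by apply.
  by apply/funext => w; rewrite big_const /= cardE enumT unlock /= addr0.
apply: (@function_ring_meval _ (bireg (X := induced S) (Y := induced T) setT setT)).
- move=> c; rewrite (_ : (fun _ => _) = (fun w => c * 1)); last first.
    by apply/funext => w; rewrite mulr1.
  by apply: (B1 (fun=> c) (fun=> 1)); apply: regular_const.
- exact: bireg_add.
- by move=> f g; apply: bireg_mul => ? ?; apply: regular_mul.
- move=> i; case: (ltnP i n) => lin.
    rewrite (_ : (fun _ => _) = (fun w : induced S * induced T => pcoord (sval w.1) i * 1)); last first.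
      by apply/funext => w; rewrite mulr1 -[LHS]/(pcoord (pjoin _ _) i) pcoord_mkpoint ?lin.
    apply: (B1 (fun x => pcoord (sval x) i) (fun=> 1)); last exact: regular_const.
    apply: (@rational_regular _ _ (fun x => pcoord x i)).
    by exists 'X_(Ordinal lin), 1 => x _; rewrite pev1 oner_neq0 divr1 pevX.
  have lim : (i - n < m)%N by rewrite ltn_subLR.
  rewrite (_ : (fun _ => _) = (fun w : induced S * induced T => 1 * pcoord (sval w.2) (i - n))); last first.
    apply/funext => w; rewrite mul1r -[LHS]/(pcoord (pjoin _ _) i) pcoord_mkpoint //.
    by rewrite ltnNge lin.
  apply: (B1 (fun=> 1) (fun x => pcoord (sval x) (i - n))); first exact: regular_const.
  apply: (@rational_regular _ _ (fun x => pcoord x (i - n))).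
  by exists 'X_(Ordinal lim), 1 => x _; rewrite pev1 oner_neq0 divr1 pevX.
Qed.

(** The topology of [prod_space] is generated by nonvanishing loci of sums of products, not by boxes
    alone. Such sums pull back to regular functions, and conversely polynomials in the joined
    coordinates are such sums by [bireg_pjoin]. *)
Lemma pprod_isomorphic :
  isomorphic (induced (pprod S T)) (prod_space (induced S) (induced T)).
Proof.
pose f1 (z : induced (pprod S T)) : induced S := exist _ (pfst (sval z)) (svalP z).1.
pose f2 (z : induced (pprod S T)) : induced T := exist _ (psnd (sval z)) (svalP z).2.
have ST (w : prod_space (induced S) (induced T)) : pprod S T (pjoin (sval w.1) (sval w.2)).
  by split; rewrite ?pjoinK1 ?pjoinK2; apply: svalP.
pose g (w : prod_space (induced S) (induced T)) : induced (pprod S T) := exist _ _ (ST w).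
have rf1 : regular_map f1.
  apply: regular_coordinates => i.
  apply: (@rational_regular _ _ (fun x => pcoord (pfst x) i)).
  by exists 'X_(lshift m i), 1 => x _; rewrite pev1 oner_neq0 divr1 pevX pcoord_mkpoint.
have rf2 : regular_map f2.
  apply: regular_coordinates => i.
  apply: (@rational_regular _ _ (fun x => pcoord (psnd x) i)).
  by exists 'X_(rshift n i), 1 => x _; rewrite pev1 oner_neq0 divr1 pevX pcoord_mkpoint.
have [_ OI OU GL] := induced_sheaf (pprod S T) (affine_sheaf (n + m)).
have rb U V h : opn U -> opn V -> bireg U V h ->
    reg (f1 @^-1` U `&` f2 @^-1` V) (fun z => h (f1 z, f2 z)).
  move=> oU oV [k [a [b [ra rb ->]]]] /=.
  have [oU' rU] := rf1 U oU; have [oV' rV] := rf2 V oV.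
  have oW := OI _ _ oU' oV'.
  apply: (function_ring_sum (regular_const oW) (regular_add oW)) => j.
  apply: regular_mul => //.
    by apply: (regular_restrict (rU _ (ra j))) => // x [].
  by apply: (regular_restrict (rV _ (rb j))) => // x [].
have oF (W : set (prod_space (induced S) (induced T))) : opn W -> opn ((fun z => (f1 z, f2 z)) @^-1` W).
  move=> oW; rewrite (_ : _ @^-1` _ = \bigcup_(O in [set O | opn O /\
     forall z, O z -> W (f1 z, f2 z)]) O); first by apply: OU => O [].
  apply/seteqP; split=> [z Wz|z [O [_ OW] Oz]]; last exact: OW.
  have [U [V [h [oU oV bh [UVz hz] hW]]]] := oW _ Wz.
  exists [set z | (f1 @^-1` U `&` f2 @^-1` V) z /\ h (f1 z, f2 z) != 0].
    split; first exact: (regular_nonzero_open (rb _ _ _ oU oV bh)).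
    by move=> y [UVy hy]; apply: hW.
  by split.
exists (fun z => (f1 z, f2 z)), g; split.
- by move=> [z STz]; apply: eq_exist => /=; rewrite pjoin_split.
- by move=> [[x Sx] [y Ty]]; congr (_, _); apply: eq_exist; rewrite /= ?pjoinK1 ?pjoinK2.
- move=> W oW; split; first exact: oF.
  move=> F [_ rF]; apply/GL; split; first exact: oF.
  move=> z Wz; have [U [V [a [b [[oU oV] ba bb [UVz bz] E]]]]] := rF _ Wz.
  have rab := rb _ _ _ oU oV ba; have rbb := rb _ _ _ oU oV bb.
  have oO := regular_nonzero_open rbb.
  exists [set z | (f1 @^-1` U `&` f2 @^-1` V) z /\ b (f1 z, f2 z) != 0],
     (fun z => a (f1 z, f2 z) / b (f1 z, f2 z)); split=> //.
    apply: regular_mul => //; first by apply: (regular_restrict rab) => // x [].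
    by apply: regular_inv => [|x []//]; apply: (regular_restrict rbb) => // x [].
  by move=> y Wy [UVy byn]; apply: E.
- have oS := induced_setT_opn S; have oT := induced_setT_opn T.
  move=> W oW; have oG : opn (g @^-1` W).
    move=> w Ww; have /induced_opnP/(_ _ Ww)[P [Pw PW]] := oW.
    exists setT, setT, (fun w => pev P (pjoin (sval w.1) (sval w.2))); split=> //.
    - exact: bireg_pjoin.
    - by move=> v _ Pv; apply: PW.
  split=> // F /induced_regP[_ rF]; split=> // w Ww.
  have [p [q [qw E]]] := rF _ Ww.
  exists setT, setT, (fun w => pev p (pjoin (sval w.1) (sval w.2))),
    (fun w => pev q (pjoin (sval w.1) (sval w.2))); split=> //.
  - exact: bireg_pjoin.
  - exact: bireg_pjoin.
  - by move=> v Wv _ qv; apply: E.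
Qed.

End Product.

Lemma variety_iso_class (X Y : funspace) : is_variety X -> is_variety Y ->
  isomorphic X Y -> K0_class X = K0_class Y.
Proof.
move=> vX vY iXY; rewrite /K0_class; case: pselect => // vX'; case: pselect => // vY'.
by apply/pclass_eqP; apply: Rrel; exact: (@K0_iso (Variety vX') (Variety vY')).
Qed.

Definition bclass n (S : set (affine_space n)) : K0 := K0_class (induced S).

Lemma bclassE n (S : set (affine_space n)) (v : is_variety (induced S)) :
  bclass S = pclass K0_rel (Gen (Variety v)).
Proof.
rewrite /bclass /K0_class; case: pselect => // v'.
by congr (pclass _ (Gen (Variety _))); apply: Prop_irrelevance.
Qed.

Lemma bclass_iso n m (S : set (affine_space n)) (T : set (affine_space m)) :
  basic S -> basic T -> isomorphic (induced S) (induced T) -> bclass S = bclass T.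
Proof. by move=> bS bT; apply: variety_iso_class; apply: basic_is_variety. Qed.

(** [K0_scissor] cuts subsets of the subtype [induced S], whereas the pieces are kept as subsets of
    affine space; this identifies the two structures. *)
Lemma induced_induced n (S T : set (affine_space n)) (A : set (induced S)) :
  (forall x, T x <-> exists Sx : S x, A (exist _ x Sx)) ->
  isomorphic (induced T) (induced A).
Proof.
move=> TA.
have AT (y : induced A) : T (sval (sval y)).
  by case: y => [[x Sx] Ax]; apply/TA; exists Sx.
have TS (x : induced T) : S (sval x) by have /TA[] := svalP x.
have TA' (x : induced T) : A (exist _ (sval x) (TS x)).
  have /TA[Sx] := svalP x; by rewrite (Prop_irrelevance Sx (TS x)).
exists (fun x => exist _ (exist _ (sval x) (TS x)) (TA' x)),
  (fun y => exist _ (sval (sval y)) (AT y)); split.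
- by move=> [x Tx]; apply: eq_exist.
- by move=> [[x Sx] Ax]; apply: eq_exist; apply: eq_exist.
- move=> V [U [U' oU' ->] ->]; split; first by exists U'.
  move=> g [_ rg]; split; first by exists U'.
  move=> x U'x; have [W [h [Wx [[W' oW' WE] rh] E]]] := rg (exist _ (exist _ (sval x) (TS x)) (TA' x)) U'x.
  have /= [O [k [Ox rk Ek]]] := rh _ Wx.
  have [_ OI OU GL] := affine_sheaf n.
  have [oO _] := (GL O k).1 rk.
  exists (O `&` W'), k; split.
  - by split=> //; rewrite WE in Wx.
  - apply/GL; split; first exact: OI.
    by move=> y [Oy _]; exists O, k; split.
  - move=> z U'z [Oz W'z] /=.
    rewrite (E (exist _ (exist _ (sval z) (TS z)) (TA' z))) //; last by rewrite WE.
    by apply: Ek => //; rewrite WE.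
- move=> V [U' oU' ->]; have oV : opn ((fun y : induced A => exist T (sval (sval y)) (AT y)) @^-1`
      ((fun y => sval y) @^-1` U')).
    by exists ((fun y : induced S => sval y) @^-1` U') => //; exists U'.
  split=> // g [_ rg]; split=> // y U'y.
  have [W [h [Wx rh E]]] := rg _ U'y.
  have [_ OI OU GL] := affine_sheaf n.
  exists ((fun y : induced S => sval y) @^-1` W), (fun y => h (sval y)); split=> //.
    have [oW _] := (GL W h).1 rh.
    split; first by exists W.
    by move=> z Wz; exists W, h; split.
  by move=> z U'z Wz; apply: E.
Qed.

Lemma bclass_scissor n (S : set (affine_space n)) (g : {mpoly CC[n]}) : basic S ->
  bclass S = bclass (S `&` pzero g) + bclass (S `&` ~` pzero g).
Proof.
move=> bS.
have vS := basic_is_variety bS.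
have vZ := basic_is_variety (basicI bS (basic_pzero g)).
have vU := basic_is_variety (basicI bS (basic_nonzero g)).
rewrite (bclassE vS) (bclassE vZ) (bclassE vU).
rewrite -[RHS]/(padd (pclass _ _) (pclass _ _)) pclass_add.
apply/pclass_eqP/Rrel.
apply: (@K0_scissor (Variety vS) (Variety vZ) (Variety vU) [set x : induced S | pzero g (sval x)]).
- exists (~` pzero g) => //; apply/affine_opnP => x /eqP gx.
  by exists g; split=> // y gy; apply/eqP.
- by apply: induced_induced => x; split=> [[Sx gx]|[Sx gx]]; [exists Sx|split].
- by apply: induced_induced => x; split=> [[Sx gx]|[Sx gx]]; [exists Sx|split].
Qed.

Lemma bclass_prod n m (S : set (affine_space n)) (T : set (affine_space m)) :
  basic S -> basic T -> bclass (pprod S T) = bclass S * bclass T.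
Proof.
move=> bS bT.
have vS := basic_is_variety bS; have vT := basic_is_variety bT.
have vP := basic_is_variety (basic_pprod bS bT).
rewrite (bclassE vS) (bclassE vT) (bclassE vP).
rewrite -[RHS]/(pmul (pclass _ _) (pclass _ _)) pclass_mul.
by apply/pclass_eqP/Rrel/K0_product; exact: pprod_isomorphic.
Qed.

Lemma basic0 n : basic (set0 : set (affine_space n)).
Proof.
by exists set0, 0; apply/seteqP; split=> x //= [_]; rewrite pev0 eqxx.
Qed.

(** Cutting the empty set gives two copies of it, so its class is twice itself. *)
Lemma bclass0 n : bclass (set0 : set (affine_space n)) = 0.
Proof.
have /eqP := @bclass_scissor n set0 0 (@basic0 n).
by rewrite !set0I -subr_eq0 opprD addrA subrr add0r oppr_eq0 => /eqP.
Qed.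

Lemma bclassT n : bclass [set: affine_space n] = K0_class (affine_space n).
Proof.
apply: variety_iso_class; first exact: basic_is_variety (basicT n).
  exact: affine_space_is_variety.
exact: induced_setT (affine_sheaf n).
Qed.

Lemma affine_space0_class : K0_class (affine_space 0) = 1.
Proof.
rewrite /K0_class; case: pselect => [v|]; last by case; exact: affine_space_is_variety.
by apply/pclass_eqP/Rrel/K0_point; exact: isomorphic_refl.
Qed.

(** * Definable sets and their measure *)

Section Trees.
Variable n : nat.
Implicit Types (C D S T : set (affine_space n)) (R : set (affine_space n) -> Prop).

(** A decision tree: every node asks whether one polynomial vanishes, so it matches one use of
    [bclass_scissor], and [R] is what is known at the leaves. *)
Inductive splits R : set (affine_space n) -> Prop :=
  | Leaf C : R C -> splits R C
  | Node C g : splits R (C `&` pzero g) -> splits R (C `&` ~` pzero g) -> splits R C.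

Definition hereditary R := forall C D, R C -> D `<=` C -> R D.

Lemma splits_sub R C D : hereditary R -> splits R C -> D `<=` C -> splits R D.
Proof.
move=> hR spC; elim: spC D => {C} [C RC D DC|C g _ IH1 _ IH2 D DC].
  by apply: Leaf; apply: hR DC.
by apply: (@Node _ _ g); [apply: IH1|apply: IH2]; apply: setSI.
Qed.

(** Grafting: a new tree is planted on every leaf of the given one. *)
Lemma splits_refine R R' C : splits R C -> (forall D, D `<=` C -> R D -> splits R' D) ->
  splits R' C.
Proof.
elim=> {C} [C RC H|C g _ IH1 _ IH2 H]; first exact: H.
apply: (@Node _ _ g); [apply: IH1|apply: IH2] => D DC;
  by apply: H => x /DC[].
Qed.

Lemma splits_and R R' C : hereditary R -> hereditary R' ->
  splits R C -> splits R' C -> splits (fun D => R D /\ R' D) C.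
Proof.
move=> hR hR' sR sR'; apply: (splits_refine sR) => D DC RD.
apply: (splits_refine (splits_sub hR' sR' DC)) => E ED R'E.
by apply: Leaf; split=> //; apply: hR ED.
Qed.

Lemma splits_all (I : finType) (R : I -> set (affine_space n) -> Prop) C :
  (forall i, hereditary (R i)) -> (forall i, splits (R i) C) ->
  splits (fun D => forall i, R i D) C.
Proof.
move=> hR sR.
suff : splits (fun D => forall i, i \in enum I -> R i D) C.
  by move=> /splits_refine; apply=> D _ H; apply: Leaf => i; apply: H; rewrite mem_enum.
elim: (enum I) => [|i s IH]; first exact: Leaf.
have hs : hereditary (fun D => forall i, i \in s -> R i D).
  by move=> D E RD ED j js; apply: hR ED; apply: RD.
apply: (splits_refine (splits_and (hR i) hs (sR i) IH)) => D _ [RiD RD].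
by apply: Leaf => j; rewrite inE => /predU1P[->|/RD].
Qed.

Definition decides S C := C `<=` S \/ C `<=` ~` S.

Lemma decides_hereditary S : hereditary (decides S).
Proof. by move=> C D [CS|CS] DC; [left|right] => x /DC /CS. Qed.

Definition definable S := splits (decides S) setT.

Lemma definableC S : definable S -> definable (~` S).
Proof.
move=> dS; apply: (splits_refine dS) => D _ [DS|DS]; apply: Leaf.
  by right; rewrite setCK.
by left.
Qed.

Lemma definableI S T : definable S -> definable T -> definable (S `&` T).
Proof.
move=> dS dT; have H := splits_and (@decides_hereditary S) (@decides_hereditary T) dS dT.
apply: (splits_refine H) => D _ [[DS|DS] [DT|DT]]; apply: Leaf.
- by left=> x Dx; split; [apply: DS|apply: DT].
- by right=> x Dx [_ Tx]; apply: DT Tx.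
- by right=> x Dx [Sx _]; apply: DS Sx.
- by right=> x Dx [Sx _]; apply: DS Sx.
Qed.

Lemma definableU S T : definable S -> definable T -> definable (S `|` T).
Proof.
move=> dS dT; rewrite -[_ `|` _]setCK setCU.
by apply/definableC/definableI; apply: definableC.
Qed.

Lemma definable_pzero g : definable (pzero g).
Proof.
by apply: (@Node _ _ g); apply: Leaf; [left|right]; rewrite setTI.
Qed.

Lemma definableT : definable setT.
Proof. by apply: Leaf; left. Qed.

Lemma definable_set0 : definable set0.
Proof. by apply: Leaf; right; rewrite setC0. Qed.

(** The sum of the classes of the cells inside [S]. It is a relation because [splits] is a
    proposition and because different trees might a priori give different values. *)
Inductive meas S : set (affine_space n) -> K0 -> Prop :=
  | MeasIn C : C `<=` S -> meas S C (bclass C)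
  | MeasOut C : C `<=` ~` S -> meas S C 0
  | MeasNode C g a b : meas S (C `&` pzero g) a -> meas S (C `&` ~` pzero g) b ->
      meas S C (a + b).

Lemma definable_meas S C : splits (decides S) C -> exists v, meas S C v.
Proof.
elim=> {C} [C [CS|CS]|C g _ [a Ha] _ [b Hb]].
- by exists (bclass C); apply: MeasIn.
- by exists 0; apply: MeasOut.
- by exists (a + b); apply: MeasNode Ha Hb.
Qed.

Lemma meas_in S C v : basic C -> meas S C v -> C `<=` S -> v = bclass C.
Proof.
move=> bC m; elim: m bC => {C v} [//|C CS bC CS'|C g a b _ IH1 _ IH2 bC CS].
  suff -> : C = set0 by rewrite bclass0.
  by apply/seteqP; split=> // x Cx; case: (CS x Cx); apply: CS'.
rewrite (bclass_scissor g bC) IH1 ?IH2 //; try by move=> x [/CS].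
  by apply: basicI => //; apply: basic_nonzero.
by apply: basicI => //; apply: basic_pzero.
Qed.

Lemma meas_out S C v : basic C -> meas S C v -> C `<=` ~` S -> v = 0.
Proof.
move=> bC m; elim: m bC => {C v} [C CS bC CS'|//|C g a b _ IH1 _ IH2 bC CS].
  suff -> : C = set0 by rewrite bclass0.
  by apply/seteqP; split=> // x Cx; case: (CS' x Cx); apply: CS.
rewrite IH1 ?IH2 ?addr0 //; try by move=> x [/CS].
  by apply: basicI => //; apply: basic_nonzero.
by apply: basicI => //; apply: basic_pzero.
Qed.

(** A cut along [g] moves from the root to the leaves, where it is a scissor relation, because two
    successive cuts commute. Independence of the tree rests on this. *)
Lemma meas_split S C v g : basic C -> meas S C v -> exists a b,
  [/\ v = a + b, meas S (C `&` pzero g) a & meas S (C `&` ~` pzero g) b].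
Proof.
move=> bC m; elim: m bC => {C v} [C CS bC|C CS bC|C h a b _ IH1 _ IH2 bC].
- exists (bclass (C `&` pzero g)), (bclass (C `&` ~` pzero g)); split.
  + exact: bclass_scissor.
  + by apply: MeasIn => x [/CS].
  + by apply: MeasIn => x [/CS].
- by exists 0, 0; split; rewrite ?addr0 //; apply: MeasOut => x [/CS].
- have [|a1 [a2 [-> m1 m2]]] := IH1; first by apply: basicI => //; apply: basic_pzero.
  have [|b1 [b2 [-> k1 k2]]] := IH2; first by apply: basicI => //; apply: basic_nonzero.
  exists (a1 + b1), (a2 + b2); split; first by rewrite addrACA.
    by apply: (@MeasNode _ _ h); rewrite setIAC.
  by apply: (@MeasNode _ _ h); rewrite setIAC.
Qed.

(** The second tree is recut along the root of the first, and the two halves are compared by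
    induction. *)
Lemma meas_uniq S C v w : basic C -> meas S C v -> meas S C w -> v = w.
Proof.
move=> bC m; elim: m w bC => {C v} [C CS w bC mw|C CS w bC mw|C g a b m1 IH1 m2 IH2 w bC mw].
- by rewrite (meas_in bC mw).
- by rewrite (meas_out bC mw).
- have [a' [b' [-> m1' m2']]] := meas_split g bC mw.
  congr (_ + _); [apply: IH1|apply: IH2] => //; apply: basicI => //.
    exact: basic_pzero.
  exact: basic_nonzero.
Qed.

Lemma meas_ext S S' C v : S `&` C = S' `&` C -> meas S C v -> meas S' C v.
Proof.
move=> E m; elim: m E => {C v} [C CS E|C CS E|C g a b _ IH1 _ IH2 E].
- by apply: MeasIn => x Cx; have [] : (S' `&` C) x by rewrite -E; split=> //; apply: CS.
- apply: MeasOut => x Cx S'x; have [Sx _] : (S `&` C) x by rewrite E.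
  exact: (CS x Cx).
- by apply: (@MeasNode _ _ g); [apply: IH1|apply: IH2]; rewrite !setIA E.
Qed.

Lemma meas_add S T C v w : basic C -> S `&` T = set0 ->
  meas S C v -> meas T C w -> meas (S `|` T) C (v + w).
Proof.
move=> bC ST0 m; elim: m w bC => {C v} [C CS w bC mw|C CS w bC mw|C g a b m1 IH1 m2 IH2 w bC mw].
- rewrite (meas_out bC mw) ?addr0; first by apply: MeasIn => x /CS; left.
  by move=> x /CS Sx Tx; have : (S `&` T) x by []; rewrite ST0.
- rewrite add0r; apply: meas_ext mw; apply/seteqP; split=> x [].
    by move=> Tx Cx; split=> //; right.
  by case=> // Sx /CS.
- have [a' [b' [-> m1' m2']]] := meas_split g bC mw.
  rewrite addrACA; apply: (@MeasNode _ _ g); [apply: IH1|apply: IH2] => //.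
    by apply: basicI => //; apply: basic_pzero.
  by apply: basicI => //; apply: basic_nonzero.
Qed.

Definition mes S : K0 := xget 0 [set v | meas S setT v].

Lemma mesP S v : meas S setT v -> mes S = v.
Proof.
move=> m; rewrite /mes; case: xgetP => [w _ mw|/(_ v)//].
exact: meas_uniq (basicT n) mw m.
Qed.

Lemma mes_meas S : definable S -> meas S setT (mes S).
Proof. by move=> /definable_meas[v m]; rewrite (mesP m). Qed.

Lemma mesU S T : definable S -> definable T -> S `&` T = set0 ->
  mes (S `|` T) = mes S + mes T.
Proof.
move=> dS dT ST0; apply: mesP; apply: meas_add => //; first exact: basicT.
  exact: mes_meas.
exact: mes_meas.
Qed.

Lemma mes0 : mes set0 = 0.
Proof. by apply: mesP; apply: MeasOut; rewrite setC0. Qed.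

Lemma mes_basic S : definable S -> basic S -> mes S = bclass S.
Proof.
move=> dS bS; apply: mesP.
suff H C : basic C -> splits (decides S) C -> meas S C (bclass (C `&` S)).
  by rewrite -[S in bclass S]setTI; apply: H => //; apply: basicT.
move=> bC sp; elim: sp bC => {C} [C [CS|CS] bC|C g _ IH1 _ IH2 bC].
- by rewrite setIidl //; apply: MeasIn.
- rewrite (_ : C `&` S = set0) ?bclass0; first exact: MeasOut.
  by apply/seteqP; split=> // x [/CS].
- rewrite (bclass_scissor g); last exact: basicI.
  rewrite ![C `&` S `&` _]setIAC; apply: (@MeasNode _ _ g); [apply: IH1|apply: IH2].
    by apply: basicI => //; apply: basic_pzero.
  by apply: basicI => //; apply: basic_nonzero.
Qed.

(* A definable set is a finite disjoint union of basic cells, which may be taken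
   inside the cells of any given decision tree. *)
Lemma definable_ind R (P : set (affine_space n) -> Prop) :
  hereditary R -> splits R setT ->
  (forall C, basic C -> definable C -> R C -> P C) ->
  (forall A B, definable A -> definable B -> A `&` B = set0 -> P A -> P B -> P (A `|` B)) ->
  forall S, definable S -> P S.
Proof.
move=> hR sR PC PU S dS.
have sp := splits_and hR (@decides_hereditary S) sR dS.
suff H C : basic C -> definable C -> splits (fun D => R D /\ decides S D) C -> P (S `&` C).
  by rewrite -[S]setIT; apply: H => //; [apply: basicT|apply: definableT].
move=> bC dC spC; elim: spC bC dC => {C} [C [RC [CS|CS]] bC dC|C g _ IH1 _ IH2 bC dC].
- by rewrite setIidr //; apply: PC.
- rewrite (_ : S `&` C = set0).
    by apply: PC; [exact: basic0|exact: definable_set0|exact: hR RC _].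
  by apply/seteqP; split=> // x [Sx /CS].
- have dZ := definable_pzero g; have dZ' := definableC dZ.
  rewrite -[S `&` C](setUIDK _ (pzero g)) setDE -!setIA.
  apply: PU.
  + by apply: definableI => //; apply: definableI.
  + by apply: definableI => //; apply: definableI.
  + by apply/seteqP; split=> // x [[_ [_ ?]] [_ [_ ?]]].
  + apply: IH1; last exact: definableI.
    by apply: basicI => //; apply: basic_pzero.
  + apply: IH2; last exact: definableI.
    by apply: basicI => //; apply: basic_nonzero.
Qed.

End Trees.

(** * Piecewise rational maps and invariance of the measure *)

Record cspace := CSpace {
  carrier :> Type;
  dimension : nat;
  enc : carrier -> affine_space dimension;
  dec : affine_space dimension -> carrier;
  encK : cancel enc dec;
  decK : cancel dec enc }.

Definition aff n : cspace := @CSpace (affine_space n) n id id (fun=> erefl) (fun=> erefl).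

(* Piecewise rational functions, generated with the total inverse (0^-1 = 0). *)
Inductive dfun (T : cspace) : (T -> CC) -> Prop :=
  | DCoord (i : 'I_(dimension T)) : dfun (fun x => pcoord (enc x) i)
  | DConst c : dfun (fun=> c)
  | DAdd f g : dfun f -> dfun g -> dfun (fun x => f x + g x)
  | DMul f g : dfun f -> dfun g -> dfun (fun x => f x * g x)
  | DInv f : dfun f -> dfun (fun x => (f x)^-1).

Definition dmap (T U : cspace) (h : T -> U) :=
  forall i : 'I_(dimension U), dfun (fun x => pcoord (enc (h x)) i).

Lemma dfun_comp (T U : cspace) (h : T -> U) f : dmap h -> dfun f -> dfun (fun x => f (h x)).
Proof.
move=> dh; elim=> {f} [i|c|f g _ df _ dg|f g _ df _ dg|f _ df]; first exact: dh.
- exact: DConst.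
- exact: DAdd.
- exact: DMul.
- exact: DInv.
Qed.

Lemma dmap_dec (T : cspace) : dmap (T := aff _) (@dec T).
Proof.
move=> i; rewrite (_ : (fun x => _) = (fun x : aff _ => pcoord x i)).
  exact: (@DCoord (aff (dimension T))).
by apply/funext => x; rewrite decK.
Qed.

(** Deciding the zeros of [f] is what lets the induction pass through the inverse: on a leaf where
    [f] vanishes its total inverse is 0, and on a leaf where it never vanishes the fraction can be
    turned over. *)
Definition nice n (f : affine_space n -> CC) C :=
  rational C f /\ decides [set x | f x = 0] C.

Lemma rational_hereditary n (f : affine_space n -> CC) : hereditary (fun C => rational C f).
Proof. by move=> C D [p [q E]] DC; exists p, q => x /DC /E. Qed.

Lemma nice_hereditary n (f : affine_space n -> CC) : hereditary (nice f).
Proof.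
move=> C D [rf df] DC; split; first exact: (rational_hereditary rf DC).
exact: decides_hereditary df DC.
Qed.

Lemma rational_nice n (f : affine_space n -> CC) C : rational C f -> splits (nice f) C.
Proof.
move=> rf; have [p [q E]] := rf.
apply: (@Node _ _ _ p); apply: Leaf; split.
- by apply: (rational_hereditary rf) => x [].
- by left=> x [/E[qx fx] px] /=; rewrite fx px mul0r.
- by apply: (rational_hereditary rf) => x [].
- right=> x [/E[qx fx] /eqP px]; rewrite /= fx; apply/eqP.
  by rewrite mulf_neq0 // invr_neq0.
Qed.

Lemma dfun_nice n (f : aff n -> CC) : dfun f -> splits (nice f) setT.
Proof.
have rC c : rational (setT : set (affine_space n)) (fun=> c).
  by exists c%:MP, 1 => x _; rewrite pev1 pevC divr1 oner_neq0.
elim=> {f} [i|c|f g _ df _ dg|f g _ df _ dg|f _ df].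
- apply: rational_nice; exists 'X_i, 1 => x _.
  by rewrite pev1 oner_neq0 divr1 pevX.
- exact: rational_nice.
- have H := splits_and (@nice_hereditary _ f) (@nice_hereditary _ g) df dg.
  apply: (splits_refine H) => D _ [[[p [q E]] _] [[p' [q' E']] _]].
  apply: rational_nice; exists (p * q' + p' * q), (q * q') => x Dx.
  have [qx ->] := E x Dx; have [qx' ->] := E' x Dx.
  by rewrite pevD !pevM mulf_neq0 // addf_div.
- have H := splits_and (@nice_hereditary _ f) (@nice_hereditary _ g) df dg.
  apply: (splits_refine H) => D _ [[[p [q E]] _] [[p' [q' E']] _]].
  apply: rational_nice; exists (p * p'), (q * q') => x Dx.
  have [qx ->] := E x Dx; have [qx' ->] := E' x Dx.
  by rewrite !pevM mulf_neq0 // mulf_div.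
- apply: (splits_refine df) => D _ [[p [q E]] [D0|D0]]; apply: rational_nice.
    by exists 0, 1 => x /D0 /= ->; rewrite pev1 pev0 oner_neq0 mul0r invr0.
  exists q, p => x Dx; have [qx fx] := E x Dx; rewrite fx invf_div; split=> //.
  by have /eqP := D0 x Dx; rewrite fx; apply: contraNneq => ->; rewrite mul0r.
Qed.

Definition ddef (T : cspace) (S : set T) := definable (@dec T @^-1` S).
Definition mu (T : cspace) (S : set T) : K0 := mes (@dec T @^-1` S).

Lemma dfun_zero (T : cspace) (f : T -> CC) : dfun f -> ddef [set x | f x = 0].
Proof.
move=> df.
have /splits_refine := dfun_nice (dfun_comp (@dmap_dec T) df).
by apply=> D _ [_ dD]; apply: Leaf.
Qed.

(** The tree of [S] is pulled back node by node: a test [g] becomes the piecewise rational function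
    g o k, and the tree deciding the vanishing of that function is grafted in its place. *)
Lemma ddef_preimage (T U : cspace) (h : T -> U) (S : set U) :
  dmap h -> ddef S -> ddef (h @^-1` S).
Proof.
move=> dh dS.
pose k (x : aff (dimension T)) : aff (dimension U) := enc (h (dec x)).
have dk : dmap k by move=> i; apply: (dfun_comp (@dmap_dec T) (dh i)).
suff H C D : splits (decides (@dec U @^-1` S)) D -> C `<=` k @^-1` D ->
    splits (decides (@dec T @^-1` (h @^-1` S))) C.
  exact: H dS _.
move=> spD; elim: spD C => {D} [D [DS|DS] C CD|D g _ IH1 _ IH2 C CD].
- by apply: Leaf; left=> x /CD /DS; rewrite /k /= encK.
- by apply: Leaf; right=> x /CD /DS; rewrite /k /= encK.
have dg : dfun (T := aff _) (fun x => pev g (k x)).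
  have : dfun (T := aff _) (pev g).
    apply: (@function_ring_meval _ (@dfun (aff (dimension U)))).
    + exact: DConst.
    + exact: DAdd.
    + exact: DMul.
    + by move=> i; apply: (@DCoord (aff (dimension U))).
  exact: dfun_comp.
have sp := splits_sub (@nice_hereditary _ _) (dfun_nice dg) (@subsetT _ C).
apply: (splits_refine sp) => E EC [_ [E0|E0]]; [apply: IH1|apply: IH2] => x Ex.
  by split; [apply: CD; apply: EC|apply: E0].
by split; [apply: CD; apply: EC|apply: E0].
Qed.

Definition inverse_on (X Y : Type) (f : X -> Y) (g : Y -> X) (S : set X) (T : set Y) :=
  [/\ forall x, S x -> T (f x), forall y, T y -> S (g y),
      forall x, S x -> g (f x) = x & forall y, T y -> f (g y) = y].

(** Two nested inductions: the source is cut into cells where [f] is rational, then the target into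
    cells where [g] is. On a pair of matching cells the maps are mutually inverse and rational,
    hence give an isomorphism, and both sides are additive. That the measure is additive over cells
    replaces any gluing of the pieces. *)
Lemma mes_bijection n m (S : set (affine_space n)) (T : set (affine_space m))
    (f : affine_space n -> affine_space m) (g : affine_space m -> affine_space n) :
  dmap (T := aff n) (U := aff m) f -> dmap (T := aff m) (U := aff n) g ->
  definable S -> definable T -> inverse_on f g S T -> mes S = mes T.
Proof.
move=> df dg dS.
pose rf (C : set (affine_space n)) := forall i : 'I_m, rational C (fun x => pcoord (f x) i).
pose rg (D : set (affine_space m)) := forall i : 'I_n, rational D (fun x => pcoord (g x) i).
have hf : hereditary rf by move=> C D rC DC i; apply: rational_hereditary (rC i) DC.
have hg : hereditary rg by move=> C D rC DC i; apply: rational_hereditary (rC i) DC.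
have sf : splits rf setT.
  apply: splits_all => [i|i]; first exact: rational_hereditary.
  by apply: (splits_refine (dfun_nice (df i))) => D _ [rD _]; apply: Leaf.
have sg : splits rg setT.
  apply: splits_all => [i|i]; first exact: rational_hereditary.
  by apply: (splits_refine (dfun_nice (dg i))) => D _ [rD _]; apply: Leaf.
have pref A : definable A -> definable (f @^-1` A).
  exact: (@ddef_preimage (aff n) (aff m) f A df).
have preg A : definable A -> definable (g @^-1` A).
  exact: (@ddef_preimage (aff m) (aff n) g A dg).
pose P (S : set (affine_space n)) := forall T, definable T -> inverse_on f g S T -> mes S = mes T.
move: T; suff : P S by []; apply: (definable_ind (P := P) hf sf _ _ dS) => {S dS}.
  move=> C bC dC rC T dT [CT TC fK gK].
  (* The source is rewritten as a function of [T], so that it shrinks along with [T] in the second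
     induction. *)
  rewrite [in LHS](_ : C = C `&` f @^-1` T); last first.
    by apply/seteqP; split=> x; [move=> Cx; split=> //; apply: CT|case].
  have H : inverse_on f g (C `&` f @^-1` T) T.
    split=> [x []//|y Ty|x [Cx _]|//]; last exact: fK.
    by split; [apply: TC|rewrite /preimage /= gK].
  pose Q (T : set (affine_space m)) := inverse_on f g (C `&` f @^-1` T) T -> mes (C `&` f @^-1` T) = mes T.
  suff : Q T by apply.
  move=> {CT TC fK gK H}; apply: (definable_ind (P := Q) hg sg _ _ dT) => {T dT}.
    move=> D bD dD rD [CD DC fK gK].
    have bS := basic_preimage bC bD rC.
    rewrite mes_basic ?mes_basic //; last by apply: definableI => //; apply: pref.
    apply: bclass_iso => //; apply: (rational_isomorphic CD DC fK gK) => // i.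
    by apply: rational_hereditary (rC i) _ => x [].
  move=> A B dA dB AB0 IHA IHB [CT TC fK gK].
  rewrite preimage_setU setIUr !mesU //; first congr (_ + _).
  - apply: IHA; split=> [x []//|y Ay|x [Cx fx]|y Ay].
    + have [Cy _] := TC y (or_introl Ay); split=> //.
      by rewrite /preimage /= gK //; left.
    + by apply: fK; split=> //; left.
    + by apply: gK; left.
  - apply: IHB; split=> [x []//|y Ay|x [Cx fx]|y Ay].
    + have [Cy _] := TC y (or_intror Ay); split=> //.
      by rewrite /preimage /= gK //; right.
    + by apply: fK; split=> //; right.
    + by apply: gK; right.
  - by apply: definableI => //; apply: pref.
  - by apply: definableI => //; apply: pref.
  - apply/seteqP; split=> // x [[_ Ax] [_ Bx]].
    by have : (A `&` B) (f x) by []; rewrite AB0.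
move=> A B dA dB AB0 IHA IHB T dT [ST TS fK gK].
rewrite mesU // (_ : T = (T `&` g @^-1` A) `|` (T `&` g @^-1` B)); last first.
  rewrite -setIUr -preimage_setU; apply/seteqP; split=> [y Ty|y []//].
  by split=> //; apply: TS.
rewrite mesU; first congr (_ + _).
- apply: IHA; first by apply: definableI => //; apply: preg.
  split=> [x Ax|y []//|x Ax|y [Ty _]]; last exact: gK.
    split; first by apply: ST; left.
    by rewrite /preimage /= fK //; left.
  by apply: fK; left.
- apply: IHB; first by apply: definableI => //; apply: preg.
  split=> [x Ax|y []//|x Ax|y [Ty _]]; last exact: gK.
    split; first by apply: ST; right.
    by rewrite /preimage /= fK //; right.
  by apply: fK; right.
- by apply: definableI => //; apply: preg.
- by apply: definableI => //; apply: preg.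
- apply/seteqP; split=> // x [[_ Ax] [_ Bx]].
  by have : (A `&` B) (g x) by []; rewrite AB0.
Qed.

Lemma dmap_pfst n m : dmap (T := aff (n + m)) (U := aff n) (@pfst n m).
Proof.
move=> i; rewrite (_ : (fun _ => _) = (fun x => pcoord (x : aff (n + m)) (lshift m i))).
  exact: (@DCoord (aff (n + m))).
by apply/funext => x; rewrite /= pcoord_mkpoint.
Qed.

Lemma dmap_psnd n m : dmap (T := aff (n + m)) (U := aff m) (@psnd n m).
Proof.
move=> i; rewrite (_ : (fun _ => _) = (fun x => pcoord (x : aff (n + m)) (rshift n i))).
  exact: (@DCoord (aff (n + m))).
by apply/funext => x; rewrite /= pcoord_mkpoint.
Qed.

Lemma definable_pprod n m (S : set (affine_space n)) (T : set (affine_space m)) :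
  definable S -> definable T -> definable (pprod S T).
Proof.
move=> dS dT; apply: (@definableI _ ((@pfst n m) @^-1` S) ((@psnd n m) @^-1` T)).
  exact: (@ddef_preimage (aff (n + m)) (aff n) _ _ (@dmap_pfst n m) dS).
exact: (@ddef_preimage (aff (n + m)) (aff m) _ _ (@dmap_psnd n m) dT).
Qed.

(** Both sides are additive in each factor, which reduces the claim to basic cells, where it is a
    relation of K_0. *)
Lemma mes_pprod n m (S : set (affine_space n)) (T : set (affine_space m)) :
  definable S -> definable T -> mes (pprod S T) = mes S * mes T.
Proof.
have hT k : hereditary (fun _ : set (affine_space k) => True) by [].
have sT k : splits (fun _ : set (affine_space k) => True) setT by apply: Leaf.
move=> dS dT.
pose P (S : set (affine_space n)) := mes (pprod S T) = mes S * mes T.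
suff : P S by []; apply: (definable_ind (P := P) (@hT n) (sT n) _ _ dS) => {S dS}; last first.
  move=> A B dA dB AB0 IHA IHB.
  rewrite /P (_ : pprod _ T = pprod A T `|` pprod B T); last first.
    apply/seteqP; split=> z; first by move=> [[Az|Bz] Tz]; [left|right].
    by move=> [[Az Tz]|[Bz Tz]]; split=> //; [left|right].
  rewrite !mesU ?IHA ?IHB ?mulrDl //; try exact: definable_pprod.
  apply/seteqP; split=> // z [[Az _] [Bz _]].
  by have : (A `&` B) (pfst z) by []; rewrite AB0.
move=> C bC dC _.
pose Q (T : set (affine_space m)) := mes (pprod C T) = mes C * mes T.
suff : Q T by []; apply: (definable_ind (P := Q) (@hT m) (sT m) _ _ dT) => {T dT P}; last first.
  move=> A B dA dB AB0 IHA IHB.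
  rewrite /Q (_ : pprod C _ = pprod C A `|` pprod C B); last first.
    apply/seteqP; split=> z; first by move=> [Tz [Az|Bz]]; [left|right].
    by move=> [[Tz Az]|[Tz Bz]]; split=> //; [left|right].
  rewrite !mesU ?IHA ?IHB ?mulrDr //; try exact: definable_pprod.
  apply/seteqP; split=> // z [[_ Az] [_ Bz]].
  by have : (A `&` B) (psnd z) by []; rewrite AB0.
move=> D bD dD _.
rewrite /Q (mes_basic (definable_pprod dC dD) (basic_pprod bC bD)) (mes_basic dC bC).
by rewrite (mes_basic dD bD) bclass_prod.
Qed.

Lemma affine_class n : K0_class (affine_space n) = K0_class (affine_space 1) ^+ n.
Proof.
elim: n => [|n IH]; first by rewrite affine_space0_class.
rewrite exprSr -IH -!bclassT -!mes_basic; try exact: definableT; try exact: basicT.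
rewrite -mes_pprod; try exact: definableT.
rewrite -addn1 (_ : pprod setT setT = setT) //.
by apply/seteqP; split.
Qed.

Section MuTheory.
Variables T U : cspace.
Implicit Types (S : set T).

Lemma mu_bijection S (S' : set U) (f : T -> U) (g : U -> T) :
  dmap f -> dmap g -> ddef S -> ddef S' -> inverse_on f g S S' -> mu S = mu S'.
Proof.
move=> df dg dS dS' [ST TS fK gK].
apply: (@mes_bijection _ _ _ _ (fun x => enc (f (dec x))) (fun y => enc (g (dec y)))) => //.
- by move=> i; apply: (dfun_comp (@dmap_dec T) (df i)).
- by move=> i; apply: (dfun_comp (@dmap_dec U) (dg i)).
- split=> x Sx; rewrite ?/preimage /= ?encK; [exact: ST|exact: TS| |].
    by rewrite fK // decK.
  by rewrite gK // decK.
Qed.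

Lemma ddefI S S' : ddef S -> ddef S' -> ddef (S `&` S').
Proof. exact: definableI. Qed.
Lemma ddefU S S' : ddef S -> ddef S' -> ddef (S `|` S').
Proof. exact: definableU. Qed.
Lemma ddefC S : ddef S -> ddef (~` S).
Proof. exact: definableC. Qed.
Lemma ddefT : ddef [set: T]. Proof. exact: definableT. Qed.
Lemma ddef0 : ddef (set0 : set T). Proof. exact: definable_set0. Qed.

Lemma muU S S' : ddef S -> ddef S' -> S `&` S' = set0 -> mu (S `|` S') = mu S + mu S'.
Proof.
move=> dS dS' SS'; apply: mesU => //; rewrite -preimage_setI SS'.
by rewrite preimage_set0.
Qed.

Lemma mu0 : mu (set0 : set T) = 0. Proof. exact: mes0. Qed.

Lemma muT : mu [set: T] = K0_class (affine_space 1) ^+ dimension T.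
Proof.
rewrite -affine_class -bclassT -mes_basic //; first exact: definableT.
exact: basicT.
Qed.

Definition prodsp_enc (z : T * U) := pjoin (enc z.1) (enc z.2).
Definition prodsp_dec (z : affine_space (dimension T + dimension U)) : T * U :=
  (dec (pfst z), dec (psnd z)).
Lemma prodsp_encK : cancel prodsp_enc prodsp_dec.
Proof. by move=> [x y]; rewrite /prodsp_dec /prodsp_enc pjoinK1 pjoinK2 !encK. Qed.
Lemma prodsp_decK : cancel prodsp_dec prodsp_enc.
Proof. by move=> z; rewrite /prodsp_dec /prodsp_enc !decK pjoin_split. Qed.
Definition prodsp : cspace := CSpace prodsp_encK prodsp_decK.

Lemma ddef_prod S (S' : set U) : ddef S -> ddef S' -> ddef (S `*` S' : set prodsp).
Proof. exact: definable_pprod. Qed.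

Lemma mu_prod S (S' : set U) : ddef S -> ddef S' ->
  mu (S `*` S' : set prodsp) = mu S * mu S'.
Proof. exact: mes_pprod. Qed.

Lemma dmap_fst : dmap (T := prodsp) fst.
Proof.
move=> i; rewrite (_ : (fun _ => _) = fun x : prodsp => pcoord (enc x) (lshift (dimension U) i)).
  exact: DCoord.
by apply/funext => x; rewrite /= pcoord_mkpoint ?ltn_ord //= ltn_addr.
Qed.

Lemma dmap_snd : dmap (T := prodsp) snd.
Proof.
move=> i; rewrite (_ : (fun _ => _) = fun x : prodsp => pcoord (enc x) (rshift (dimension T) i)).
  exact: DCoord.
apply/funext => x; rewrite /= pcoord_mkpoint ?ltn_add2l //.
by rewrite ltnNge leq_addr /= addKn.
Qed.

End MuTheory.

Lemma dmap_pair (T U V : cspace) (f : V -> T) (g : V -> U) :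
  dmap f -> dmap g -> dmap (U := prodsp T U) (fun x => (f x, g x)).
Proof.
move=> df dg i; case: (ltnP i (dimension T)) => lin.
  rewrite (_ : (fun _ => _) = fun x => pcoord (enc (f x)) (Ordinal lin)) //.
  by apply/funext => x; rewrite /= pcoord_mkpoint // lin.
have lim : (i - dimension T < dimension U)%N by rewrite ltn_subLR.
rewrite (_ : (fun _ => _) = fun x => pcoord (enc (g x)) (Ordinal lim)) //.
by apply/funext => x; rewrite /= pcoord_mkpoint // ltnNge lin.
Qed.

(** * Definability of Gaussian elimination *)

Section Definability.
Variable T : cspace.
Implicit Types (f g : T -> CC) (b : T -> bool).

Lemma dfun_ext f g : f =1 g -> dfun f -> dfun g.
Proof. by move=> /funext ->. Qed.

Lemma dfun_opp f : dfun f -> dfun (fun x => - f x).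
Proof.
move=> df; apply: (@dfun_ext (fun x => -1 * f x)); first by move=> x; rewrite mulN1r.
by apply: DMul => //; apply: DConst.
Qed.

Lemma dfun_sum I (r : seq I) (P : pred I) (F : I -> T -> CC) : (forall i, dfun (F i)) ->
  dfun (fun x => \sum_(i <- r | P i) F i x).
Proof. exact: (function_ring_sum (@DConst T) (@DAdd T)). Qed.

Lemma dfun_prod I (r : seq I) (P : pred I) (F : I -> T -> CC) : (forall i, dfun (F i)) ->
  dfun (fun x => \prod_(i <- r | P i) F i x).
Proof. exact: (function_ring_prod (@DConst T) (@DMul T)). Qed.

Definition dbool b := dfun (fun x => (b x)%:R).

Lemma dbool_ext b b' : b =1 b' -> dbool b -> dbool b'.
Proof. by move=> E; apply: dfun_ext => x; rewrite E. Qed.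

Lemma dbool_const c : dbool (fun=> c). Proof. exact: DConst. Qed.

Lemma dbool_neg b : dbool b -> dbool (fun x => ~~ b x).
Proof.
move=> db; apply: (@dfun_ext (fun x => 1 + - (b x)%:R)).
  by move=> x; case: (b x); rewrite ?subrr ?subr0.
by apply: DAdd; [apply: DConst|apply: dfun_opp].
Qed.

(** The product f f^-1 with the total inverse is the indicator of f != 0; all branching comes from
    it. *)
Lemma dbool_eq0 f : dfun f -> dbool (fun x => f x == 0).
Proof.
move=> df; apply: (@dbool_ext (fun x => ~~ (f x != 0))).
  by move=> x; rewrite negbK.
apply: dbool_neg; apply: (@dfun_ext (fun x => f x * (f x)^-1)).
  by move=> x; case: eqP => [->|/eqP fx]; rewrite ?mul0r ?divff.
by apply: DMul => //; apply: DInv.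
Qed.

Lemma dbool_eq f g : dfun f -> dfun g -> dbool (fun x => f x == g x).
Proof.
move=> df dg; apply: (@dbool_ext (fun x => f x + - g x == 0)).
  by move=> x; rewrite subr_eq0.
by apply: dbool_eq0; apply: DAdd => //; apply: dfun_opp.
Qed.

Lemma dbool_and b b' : dbool b -> dbool b' -> dbool (fun x => b x && b' x).
Proof.
move=> db db'; apply: (@dfun_ext (fun x => (b x)%:R * (b' x)%:R)).
  by move=> x; case: (b x); case: (b' x); rewrite ?mulr0 ?mul0r ?mulr1.
exact: DMul.
Qed.

Lemma dbool_forall (I : finType) (b : I -> T -> bool) : (forall i, dbool (b i)) ->
  dbool (fun x => [forall i, b i x]).
Proof.
move=> db; apply: (@dfun_ext (fun x => \prod_i (b i x)%:R)); last exact: dfun_prod.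
move=> x; case: forallP => [H|/forallP/forallPn[i /negPf H]].
  by rewrite big1 // => i _; rewrite H.
by rewrite (bigD1 i) //= H mul0r.
Qed.

Lemma dfun_if b f g : dbool b -> dfun f -> dfun g -> dfun (fun x => if b x then f x else g x).
Proof.
move=> db df dg; apply: (@dfun_ext (fun x => (b x)%:R * f x + (~~ b x)%:R * g x)).
  by move=> x; case: (b x); rewrite /= ?mul1r ?mul0r ?addr0 ?add0r.
by apply: DAdd; apply: DMul => //; exact: dbool_neg.
Qed.

Lemma dfun_case (D : finType) (c : T -> D) (F : D -> T -> CC) :
  (forall v, dbool (fun x => c x == v)) -> (forall v, dfun (F v)) ->
  dfun (fun x => F (c x) x).
Proof.
move=> dc dF; apply: (@dfun_ext (fun x => \sum_v (c x == v)%:R * F v x)).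
  move=> x; rewrite (bigD1 (c x)) //= eqxx mul1r big1 ?addr0 // => v.
  by rewrite eq_sym => /negPf ->; rewrite mul0r.
by apply: dfun_sum => v; apply: DMul; [exact: dc|exact: dF].
Qed.

Lemma dbool_case (D : finType) (c : T -> D) (F : D -> T -> bool) :
  (forall v, dbool (fun x => c x == v)) -> (forall v, dbool (F v)) ->
  dbool (fun x => F (c x) x).
Proof. by move=> dc dF; apply: (dfun_case (F := fun v x => (F v x)%:R)). Qed.

Lemma ddef_bool b : dbool b -> ddef [set x | b x].
Proof.
move=> /dbool_neg/dfun_zero; congr ddef; apply/seteqP; split=> x /=.
  by case: (b x) => //= /eqP; rewrite oner_eq0.
by move=> ->.
Qed.

Definition dmx m n (A : T -> 'M[CC]_(m, n)) := forall i j, dfun (fun x => A x i j).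

Lemma dmx_ext m n (A B : T -> 'M[CC]_(m, n)) : A =1 B -> dmx A -> dmx B.
Proof. by move=> /funext ->. Qed.

Lemma dmx_const m n (A : 'M[CC]_(m, n)) : dmx (fun=> A).
Proof. by move=> i j; apply: DConst. Qed.

Lemma dmx_mul m n p (A : T -> 'M[CC]_(m, n)) (B : T -> 'M[CC]_(n, p)) :
  dmx A -> dmx B -> dmx (fun x => A x *m B x).
Proof.
move=> dA dB i j; apply: (@dfun_ext (fun x => \sum_k A x i k * B x k j)).
  by move=> x; rewrite mxE.
by apply: dfun_sum => k; apply: DMul.
Qed.

Lemma dmx_add m n (A B : T -> 'M[CC]_(m, n)) :
  dmx A -> dmx B -> dmx (fun x => A x + B x).
Proof.
by move=> dA dB i j; apply: (@dfun_ext (fun x => A x i j + B x i j));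
  [move=> x; rewrite mxE|apply: DAdd].
Qed.

Lemma dmx_sub m n (A B : T -> 'M[CC]_(m, n)) :
  dmx A -> dmx B -> dmx (fun x => A x - B x).
Proof.
move=> dA dB; apply: dmx_add => // i j.
by apply: (@dfun_ext (fun x => - B x i j));
  [move=> x; rewrite mxE|apply: dfun_opp].
Qed.

Lemma dmx_scale m n f (A : T -> 'M[CC]_(m, n)) :
  dfun f -> dmx A -> dmx (fun x => f x *: A x).
Proof.
by move=> df dA i j; apply: (@dfun_ext (fun x => f x * A x i j));
  [move=> x; rewrite mxE|apply: DMul].
Qed.

Lemma dmx_if m n b (A B : T -> 'M[CC]_(m, n)) : dbool b ->
  dmx A -> dmx B -> dmx (fun x => if b x then A x else B x).
Proof.
move=> db dA dB i j; apply: (@dfun_ext (fun x => if b x then A x i j else B x i j)).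
  by move=> x; case: (b x).
exact: dfun_if.
Qed.

Lemma dbool_mx_eq m n (A B : T -> 'M[CC]_(m, n)) :
  dmx A -> dmx B -> dbool (fun x => A x == B x).
Proof.
move=> dA dB; apply: (@dbool_ext (fun x => [forall ij, A x ij.1 ij.2 == B x ij.1 ij.2])).
  move=> x; apply/forallP/eqP => [H|-> //]; apply/matrixP => i j.
  exact: (eqP (H (i, j))).
by apply: dbool_forall => ij; apply: dbool_eq.
Qed.

Lemma dfun_det n (A : T -> 'M[CC]_n) : dmx A -> dfun (fun x => \det (A x)).
Proof.
move=> dA; apply: dfun_sum => s; apply: DMul; first exact: DConst.
by apply: dfun_prod => i.
Qed.

Lemma dmx_invmx n (A : T -> 'M[CC]_n) : dmx A -> dmx (fun x => invmx (A x)).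
Proof.
move=> dA; have dD := dfun_det dA.
rewrite /invmx; apply: dmx_if => //.
  apply: (@dbool_ext (fun x => \det (A x) != 0)); first by move=> x; rewrite unitmxE unitfE.
  by apply/dbool_neg/dbool_eq0.
apply: dmx_scale; first exact: DInv.
move=> i j; apply: (@dfun_ext (fun x => cofactor (A x) j i)); first by move=> x; rewrite mxE.
apply: DMul; first exact: DConst.
apply: dfun_det => k l; apply: (@dfun_ext (fun x => A x (lift j k) (lift i l))) => //.
by move=> x; rewrite !mxE.
Qed.

Lemma dmx_block m1 m2 n1 n2 (A : T -> 'M[CC]_(m1, n1)) (B : T -> 'M[CC]_(m1, n2))
    (C : T -> 'M[CC]_(m2, n1)) (D : T -> 'M[CC]_(m2, n2)) :
  dmx A -> dmx B -> dmx C -> dmx D -> dmx (fun x => block_mx (A x) (B x) (C x) (D x)).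
Proof.
move=> dA dB dC dD i j; case Ei: (split i) => [i'|i']; case Ej: (split j) => [j'|j'].
- by apply: (@dfun_ext (fun x => A x i' j')) => // x; rewrite mxE Ei mxE Ej.
- by apply: (@dfun_ext (fun x => B x i' j')) => // x; rewrite mxE Ei mxE Ej.
- by apply: (@dfun_ext (fun x => C x i' j')) => // x; rewrite mxE Ei mxE Ej.
- by apply: (@dfun_ext (fun x => D x i' j')) => // x; rewrite mxE Ei mxE Ej.
Qed.

Lemma dmx_entries m n m' n' (s : 'I_m' -> 'I_m) (t : 'I_n' -> 'I_n)
    (A : T -> 'M[CC]_(m, n)) (B : T -> 'M[CC]_(m', n')) :
  dmx A -> (forall x i j, B x i j = A x (s i) (t j)) -> dmx B.
Proof. by move=> dA E i j; apply: (@dfun_ext (fun x => A x (s i) (t j))). Qed.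

Let GE m n (A : 'M[CC]_(m, n)) := Gaussian_elimination_ A.

Let GEdef m n (A : T -> 'M[CC]_(m, n)) :=
  [/\ dmx (fun x => (GE (A x)).1.1), dmx (fun x => (GE (A x)).1.2) &
     forall r, dbool (fun x => (GE (A x)).2 == r)].

(** Follows the recursion of the algorithm: once the position of the pivot is fixed, one elimination
    step is a permutation of rows and columns and a rational Schur complement. *)
Lemma definable_Gaussian m n (A : T -> 'M[CC]_(m, n)) : dmx A -> GEdef A.
Proof.
have triv m' n' (B : T -> 'M[CC]_(m', n')) : (forall x, GE (B x) = (1%:M, 1%:M, 0%N)) -> GEdef B.
  move=> E; split=> [||r].
  - by apply: (@dmx_ext _ _ (fun=> 1%:M)) => [x|]; [rewrite E|apply: dmx_const].
  - by apply: (@dmx_ext _ _ (fun=> 1%:M)) => [x|]; [rewrite E|apply: dmx_const].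
  - by apply: (@dbool_ext (fun=> 0%N == r)) => [x|]; [rewrite E|apply: dbool_const].
elim: m n A => [|m IH] [|n] A dA; try exact: triv.
(* The pivot depends on [x] only through the pattern of nonzero entries, a value in a finite type,
   so that [dfun_case] can branch on it. *)
pose c x := [ffun ij : 'I_m.+1 * 'I_n.+1 => A x ij.1 ij.2 != 0].
have dc v : dbool (fun x => c x == v).
  apply: (@dbool_ext (fun x => [forall ij, (A x ij.1 ij.2 != 0) == v ij])).
    move=> x; apply/forallP/eqP => [H|<- ij]; last by rewrite ffunE.
    by apply/ffunP => ij; rewrite ffunE; exact: (eqP (H ij)).
  apply: dbool_forall => ij; have d0 := dbool_eq0 (dA ij.1 ij.2).
  case: (v ij); last by apply: (@dbool_ext (fun x => A x ij.1 ij.2 == 0)) => // x; case: eqP.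
  by apply: (dbool_ext _ (dbool_neg d0)) => x; case: eqP.
pose A1 ij x : 'M[CC]_(1 + m, 1 + n) := xrow ij.1 0 (xcol ij.2 0 (A x)).
have dA1 ij : dmx (A1 ij).
  apply: (dmx_entries (s := tperm ij.1 0) (t := tperm ij.2 0) dA) => x i j.
  by rewrite !mxE.
pose a (ij : 'I_m.+1 * 'I_n.+1) x := A x ij.1 ij.2.
have da ij : dfun (a ij) by apply: dA.
pose u ij x := ursubmx (A1 ij x).
have du ij : dmx (u ij).
  by apply: (dmx_entries (s := @lshift 1 m) (t := @rshift 1 n) (dA1 ij)) => x i j; rewrite !mxE.
pose v ij x := (a ij x)^-1 *: dlsubmx (A1 ij x).
have dv ij : dmx (v ij).
  apply: dmx_scale; first exact: DInv.
  by apply: (dmx_entries (s := @rshift 1 m) (t := @lshift 1 n) (dA1 ij)) => x i j; rewrite !mxE.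
pose S ij x := drsubmx (A1 ij x) - v ij x *m u ij x.
have dS ij : dmx (S ij).
  apply: dmx_sub; last exact: dmx_mul.
  by apply: (dmx_entries (s := @rshift 1 m) (t := @rshift 1 n) (dA1 ij)) => x i j; rewrite !mxE.
pose L o x : 'M[CC]_(1 + m) := if o is Some ij then
  xrow ij.1 0 (block_mx 1 0 (v ij x) (GE (S ij x)).1.1) else 1%:M.
pose U o x : 'M[CC]_(1 + n) := if o is Some ij then
  xcol ij.2 0 (block_mx (a ij x)%:M (u ij x) 0 (GE (S ij x)).1.2) else 1%:M.
pose r o x : nat := if o is Some ij then (GE (S ij x)).2.+1 else 0%N.
pose o (w : {ffun 'I_m.+1 * 'I_n.+1 -> bool}) := [pick ij | w ij].
have E x : GE (A x) = (L (o (c x)) x, U (o (c x)) x, r (o (c x)) x).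
  have Eo : [pick ij | A x ij.1 ij.2 != 0] = o (c x).
    by apply: eq_pick => ij; rewrite ffunE.
  rewrite /GE /= Eo; case: (o (c x)) => [[i j]|//].
  transitivity (let: (L', U', r') := GE (S (i, j) x) in
    (xrow i 0 (block_mx 1 0 (v (i, j) x) L'),
     xcol j 0 (block_mx (a (i, j) x)%:M (u (i, j) x) 0 U'), r'.+1)); first by [].
  have aux (t : 'M[CC]_m * 'M[CC]_n * nat) : (let: (L', U', r') := t in
    (xrow i 0 (block_mx 1 0 (v (i, j) x) L'),
     xcol j 0 (block_mx (a (i, j) x)%:M (u (i, j) x) 0 U'), r'.+1)) =
    (xrow i 0 (block_mx 1 0 (v (i, j) x) t.1.1),
     xcol j 0 (block_mx (a (i, j) x)%:M (u (i, j) x) 0 t.1.2), t.2.+1).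
    by case: t => [[]].
  by rewrite aux.
have dL w : dmx (L w).
  case: w => [ij|]; last exact: dmx_const.
  have [dL _ _] := IH _ _ (dS ij).
  have dB := dmx_block (dmx_const 1) (dmx_const 0) (dv ij) dL.
  by apply: (dmx_entries (s := tperm ij.1 0) (t := id) dB) => x i j; rewrite mxE.
have dU w : dmx (U w).
  case: w => [ij|]; last exact: dmx_const.
  have [_ dU _] := IH _ _ (dS ij).
  have da1 : dmx (fun x => (a ij x)%:M : 'M_1).
    by move=> i j; rewrite !ord1; apply: (dfun_ext _ (da ij)) => x; rewrite mxE eqxx.
  have dB := dmx_block da1 (du ij) (dmx_const 0) dU.
  by apply: (dmx_entries (s := id) (t := tperm ij.2 0) dB) => x i j; rewrite mxE.
have dr w k : dbool (fun x => r w x == k).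
  case: w => [ij|]; last exact: dbool_const.
  have [_ _ dr] := IH _ _ (dS ij).
  by case: k => [|k]; [exact: dbool_const|apply: dr].
split=> [i j|i j|k].
- apply: (@dfun_ext (fun x => L (o (c x)) x i j)); first by move=> x; rewrite E.
  by apply: (dfun_case (F := fun w x => L (o w) x i j)) => // w; apply: dL.
- apply: (@dfun_ext (fun x => U (o (c x)) x i j)); first by move=> x; rewrite E.
  by apply: (dfun_case (F := fun w x => U (o w) x i j)) => // w; apply: dU.
- apply: (@dbool_ext (fun x => r (o (c x)) x == k)); first by move=> x; rewrite E.
  by apply: (dbool_case (F := fun w x => r (o w) x == k)) => // w; apply: dr.
Qed.

Lemma dmx_col_ebase m n (A : T -> 'M[CC]_(m, n)) : dmx A -> dmx (fun x => col_ebase (A x)).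
Proof. by move=> /definable_Gaussian[H _ _]; rewrite /col_ebase unlock. Qed.

Lemma dmx_row_ebase m n (A : T -> 'M[CC]_(m, n)) : dmx A -> dmx (fun x => row_ebase (A x)).
Proof. by move=> /definable_Gaussian[_ H _]; rewrite /row_ebase unlock. Qed.

Lemma dbool_rank m n (A : T -> 'M[CC]_(m, n)) r : dmx A -> dbool (fun x => \rank (A x) == r).
Proof.
move=> /definable_Gaussian[_ _ H].
apply: (@dbool_ext (fun x => (if [|| m == 0 | n == 0]%N then 0%N
  else (Gaussian_elimination_ (A x)).2) == r)) => [x|].
  by rewrite mxrank.unlock Gaussian_elimination.unlock.
by case: (_ || _); [exact: dbool_const|exact: H].
Qed.

End Definability.

Lemma dmx_comp (T U : cspace) (h : T -> U) m n (A : U -> 'M[CC]_(m, n)) :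
  dmap h -> dmx A -> dmx (fun x => A (h x)).
Proof. by move=> dh dA i j; apply: (dfun_comp dh (dA i j)). Qed.

Lemma dbool_comp (T U : cspace) (h : T -> U) (b : U -> bool) :
  dmap h -> dbool b -> dbool (fun x => b (h x)).
Proof. by move=> dh db; apply: (dfun_comp dh db). Qed.

(** * Spaces of matrices and of families of matrices *)

Section CoordinateSpace.
Variables (E : finType) (X : Type) (get : X -> E -> CC) (mk : (E -> CC) -> X).
Hypotheses (getK : forall x, mk (get x) = x) (mkK : forall f e, get (mk f) e = f e).

Definition fsp_enc x : affine_space #|E| :=
  mkpoint #|E| (fun i => if insub i is Some j then get x (enum_val (A := E) j) else 0).
Definition fsp_dec (z : affine_space #|E|) : X := mk (fun e => (sval z)`_(enum_rank e)).

Lemma fsp_encE x e : (sval (fsp_enc x))`_(enum_rank e) = get x e.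
Proof.
rewrite -[LHS]/(pcoord (fsp_enc x) (enum_rank e)) pcoord_mkpoint //.
by rewrite valK enum_rankK.
Qed.

Lemma fsp_encK : cancel fsp_enc fsp_dec.
Proof.
move=> x; rewrite /fsp_dec -[RHS]getK; congr mk; apply/funext => e.
exact: fsp_encE.
Qed.

Lemma fsp_decK : cancel fsp_dec fsp_enc.
Proof.
move=> z; apply: pcoordP => i lin; rewrite pcoord_mkpoint // insubT mkK.
by rewrite enum_valK.
Qed.

Definition fsp : cspace := CSpace fsp_encK fsp_decK.

Lemma dfun_get e : dfun (T := fsp) (fun x => get x e).
Proof.
apply: (@dfun_ext fsp (fun x => pcoord (enc x) (enum_rank e))).
  by move=> x; rewrite -fsp_encE.
exact: (@DCoord fsp).
Qed.

Lemma dmap_fsp (T : cspace) (h : T -> fsp) :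
  (forall e, dfun (fun x => get (h x) e)) -> dmap h.
Proof.
move=> dh i; apply: (dfun_ext _ (dh (enum_val i))) => x.
by rewrite /= pcoord_mkpoint // valK.
Qed.

End CoordinateSpace.

Section MatrixSpace.
Variables m n : nat.
Definition mat_get (A : 'M[CC]_(m, n)) (e : 'I_m * 'I_n) := A e.1 e.2.
Definition mat_mk (f : 'I_m * 'I_n -> CC) := \matrix_(i, j) f (i, j).
Lemma mat_getK A : mat_mk (mat_get A) = A.
Proof. by apply/matrixP => i j; rewrite mxE. Qed.
Lemma mat_mkK f e : mat_get (mat_mk f) e = f e.
Proof. by case: e => i j; rewrite /mat_get mxE. Qed.
Definition matsp : cspace := fsp mat_getK mat_mkK.

Lemma dmx_id : dmx (T := matsp) id.
Proof. by move=> i j; apply: (dfun_get _ _ (i, j)). Qed.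

Lemma dmap_mat (T : cspace) (A : T -> matsp) : dmx A -> dmap A.
Proof. by move=> dA; apply: dmap_fsp => e; apply: dA. Qed.
End MatrixSpace.

Section FamilySpace.
Variables (K : finType) (m n : K -> nat).
Let E : finType := {k : K & ('I_(m k) * 'I_(n k))%type}.
Definition mxfamily := forall k, 'M[CC]_(m k, n k).
Definition mxfamily_get (A : mxfamily) (e : E) := A (tag e) (tagged e).1 (tagged e).2.
Definition mxfamily_mk (f : E -> CC) : mxfamily := fun k =>
  \matrix_(i, j) f (Tagged (fun k => 'I_(m k) * 'I_(n k))%type (i, j)).
Lemma mxfamily_getK A : mxfamily_mk (mxfamily_get A) = A.
Proof. by apply: functional_extensionality_dep => k; apply/matrixP => i j; rewrite mxE. Qed.
Lemma mxfamily_mkK f e : mxfamily_get (mxfamily_mk f) e = f e.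
Proof. by case: e => k [i j]; rewrite /mxfamily_get mxE. Qed.
Definition famsp : cspace := fsp mxfamily_getK mxfamily_mkK.

Lemma dmx_family k : dmx (T := famsp) (fun A => A k).
Proof. by move=> i j; apply: (dfun_get _ _ (Tagged (fun k => 'I_(m k) * 'I_(n k))%type (i, j))). Qed.

Lemma dmap_family (T : cspace) (A : T -> famsp) :
  (forall k, dmx (fun x => A x k)) -> dmap A.
Proof. by move=> dA; apply: dmap_fsp => e; apply: dA. Qed.
End FamilySpace.

(** * Nilpotent families of matrices *)

Section Words.
Variables (F : fieldType) (N : nat) (K : Type) (X : K -> 'M[F]_N).

Definition word (s : seq K) : 'M[F]_N := foldr (fun a M => X a *m M) 1%:M s.

Lemma word_cat s t : word (s ++ t) = word s *m word t.
Proof. by elim: s => [|a s IH] /=; rewrite ?mul1mx // IH mulmxA. Qed.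

Lemma word_rcons s a : word (rcons s a) = word s *m X a.
Proof. by rewrite -cats1 word_cat /= mulmx1. Qed.

Definition nilpotent_at k := forall s, size s = k -> word s = 0.

Lemma nilpotent_le k l : (k <= l)%N -> nilpotent_at k -> nilpotent_at l.
Proof.
move=> kl nk s sl; rewrite -(cat_take_drop k s) word_cat nk ?mul0mx //.
by rewrite size_takel ?sl.
Qed.

(** For k = 1 this is the nonunital algebra generated by the family; [wspan k] is its k-th power for
    k > 0. *)
Inductive wspan (k : nat) : 'M[F]_N -> Prop :=
  | WSpan0 : wspan k 0
  | WSpanS c s A : (k <= size s)%N -> wspan k A -> wspan k (c *: word s + A).

Lemma wspanD k A B : wspan k A -> wspan k B -> wspan k (A + B).
Proof.
move=> sA sB; elim: sA => {A} [|c s A ks _ IH]; first by rewrite add0r.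
by rewrite -addrA; apply: WSpanS.
Qed.

Lemma wspanZ k a A : wspan k A -> wspan k (a *: A).
Proof.
elim=> {A} [|c s A ks _ IH]; first by rewrite scaler0; apply: WSpan0.
by rewrite scalerDr scalerA; apply: WSpanS.
Qed.

Lemma wspan_word k s : (k <= size s)%N -> wspan k (word s).
Proof. by move=> ks; rewrite -[word s]scale1r -[_ *: _]addr0; apply/WSpanS/WSpan0. Qed.

Lemma wspanM k l A B : wspan k A -> wspan l B -> wspan (k + l) (A *m B).
Proof.
elim=> {A} [|c s A ks _ IH] sB; first by rewrite mul0mx; apply: WSpan0.
rewrite mulmxDl -scalemxAl; apply: wspanD; last exact: IH.
apply: wspanZ; elim: sB {IH} => {B} [|c' t B lt _ IH].
  by rewrite mulmx0; apply: WSpan0.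
rewrite mulmxDr -scalemxAr -word_cat; apply: WSpanS => //.
by rewrite size_cat leq_add.
Qed.

Lemma wspan_nilpotent k A : nilpotent_at k -> wspan k A -> A = 0.
Proof.
move=> nk; elim=> {A} [//|c s A ks _ ->].
by rewrite (nilpotent_le ks nk) // scaler0 addr0.
Qed.

End Words.

Definition mxpow (F : fieldType) N (A : 'M[F]_N) k := iter k (mulmx A) 1%:M.

Lemma mxpowS (F : fieldType) N (A : 'M[F]_N) k : mxpow A k.+1 = A *m mxpow A k.
Proof. by []. Qed.

Lemma wspan_pow (F : fieldType) N K (X : K -> 'M[F]_N) A k :
  wspan X 1 A -> wspan X k (mxpow A k).
Proof.
move=> sA; elim: k => [|k IH]; first exact: (wspan_word X (s := [::])).
by rewrite mxpowS -add1n; apply: wspanM.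
Qed.

(** A matrix of maximal rank with row space inside [P] works: a vector of [P] outside it could be
    adjoined and would raise the rank. *)
Lemma subspace_mx (F : fieldType) N (P : 'rV[F]_N -> Prop) :
  P 0 -> (forall a u v, P u -> P v -> P (a *: u + v)) ->
  exists U : 'M[F]_N, forall v, (v <= U)%MS <-> P v.
Proof.
move=> P0 PD.
pose has_rank r := `[< exists U : 'M[F]_N, \rank U = r /\ forall v : 'rV_N, (v <= U)%MS -> P v >].
have ex : exists r, has_rank r.
  exists 0%N; apply/asboolP; exists 0; rewrite mxrank0; split=> // v.
  by rewrite submx0 => /eqP->.
have bd r : has_rank r -> (r <= N)%N by move=> /asboolP[U [<- _]]; apply: rank_leq_row.
case: (ex_maxnP ex bd) => r /asboolP[U [rU UP]] rmax.
exists U => v; split=> [/UP//|Pv]; apply/negPn/negP => vU.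
suff /rmax : has_rank (\rank (U + v)%MS).
  by rewrite -rU leqNgt (ltn_leqif (mxrank_leqif_sup (addsmxSl _ _))) addsmx_sub submx_refl vU.
apply/asboolP; exists (U + v)%MS; split=> // w /sub_addsmxP[[a b] /= ->].
rewrite addrC [b]mx11_scalar mul_scalar_mx; apply: PD => //.
exact/UP/submxMl.
Qed.

Section Chain.
Variables (F : fieldType) (N : nat) (K : finType) (X : K -> 'M[F]_N).

Definition wordker k : 'M[F]_N := (\bigcap_(s : k.-tuple K) kermx (word X s))%MS.

Lemma wordkerP m k (A : 'M[F]_(m, N)) :
  reflect (forall s, size s = k -> A *m word X s = 0) (A <= wordker k)%MS.
Proof.
apply: (iffP sub_bigcapmxP) => H s.
  by move=> /eqP sk; apply/sub_kermxP; apply: (H (Tuple sk)).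
by move=> _; apply/sub_kermxP; apply: H; rewrite size_tuple.
Qed.

Lemma wordker_step m k (A : 'M[F]_(m, N)) a : (A <= wordker k.+1)%MS ->
  (A *m X a <= wordker k)%MS.
Proof.
move=> /wordkerP H; apply/wordkerP => s sk.
by rewrite -mulmxA; apply: (H (a :: s)); rewrite /= sk.
Qed.

Lemma wordkerS k : (wordker k <= wordker k.+1)%MS.
Proof.
apply/wordkerP => s; elim/last_ind: s => // s a _; rewrite size_rcons => -[sk].
by rewrite word_rcons mulmxA (wordkerP _ _ (submx_refl _)) ?mul0mx.
Qed.

Lemma wordker_full k : (1%:M <= wordker k)%MS <-> nilpotent_at X k.
Proof.
split=> [/wordkerP H s /H|H]; first by rewrite mul1mx.
by apply/wordkerP => s /H ->; rewrite mulmx0.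
Qed.

(* If every element of the nonunital algebra generated by the X a is nilpotent,
   the chain of subspaces [wordker] grows strictly until it is everything. *)
Lemma nil_words : (forall A, wspan X 1 A -> exists n, mxpow A n = 0) -> nilpotent_at X N.
Proof.
move=> nilA; apply/wordker_full.
have grow k : ~~ (1%:M <= wordker k)%MS -> (\rank (wordker k) < \rank (wordker k.+1))%N.
  move=> nfull; set M := wordker k.
  have MX m (A : 'M_(m, N)) a : (A <= M)%MS -> (A *m X a <= M)%MS.
    by move=> AM; apply: wordker_step; apply: submx_trans AM (wordkerS k).
  have Mspan m (A : 'M_(m, N)) B : (A <= M)%MS -> wspan X 1 B -> (A *m B <= M)%MS.
    move=> AM; elim=> {B} [|c s B _ _ IH]; first by rewrite mulmx0 sub0mx.
    rewrite mulmxDr -scalemxAr addmx_sub //; apply: scalemx_sub.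
    elim/last_ind: s => [|s a IHs]; first by rewrite mulmx1.
    by rewrite word_rcons mulmxA; apply: MX.
  have [v0 v0M] : exists v : 'rV_N, ~~ (v <= M)%MS.
    by move: nfull; rewrite -/M => /row_subPn[i Hi]; exists (row i 1%:M).
  have space v : exists U : 'M[F]_N, forall w : 'rV_N, (w <= U)%MS <->
      exists B m, [/\ wspan X 1 B, (m <= M)%MS & w = v *m B + m].
    apply: subspace_mx.
      by exists 0, 0; rewrite sub0mx mulmx0 addr0; split=> //; apply: WSpan0.
    move=> a _ _ [B [m [sB mM ->]]] [B' [m' [sB' mM' ->]]].
    exists (a *: B + B'), (a *: m + m'); split.
    - by apply: wspanD => //; apply: wspanZ.
    - by rewrite addmx_sub // scalemx_sub.
    - by rewrite mulmxDr -scalemxAr scalerDr addrACA.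
  suff [u uM uX] : exists2 u : 'rV_N, ~~ (u <= M)%MS & forall a, (u *m X a <= M)%MS.
    rewrite (ltn_leqif (mxrank_leqif_sup (wordkerS k))).
    apply: contra uM => /(submx_trans _); apply.
    by apply/wordkerP => -[//|a s] [sk]; rewrite /= mulmxA; apply: (wordkerP _ _ (uX a)).
  (* Descent on the rank of vA + M, where A is the nonunital algebra. If u = v X_a is not in M, then
     uA + M lies in vA + M. If it is smaller, u replaces v. If it is equal, it contains u, so u = u
     B + m with B in A and m in M; iterating, u equals u B^n modulo M, and B nilpotent puts u in
     M. *)
  suff H r (v : 'rV_N) U : ~~ (v <= M)%MS -> (forall w : 'rV_N, (w <= U)%MS <->
      exists B m, [/\ wspan X 1 B, (m <= M)%MS & w = v *m B + m]) -> (\rank (U : 'M_N) <= r)%N ->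
      exists2 u : 'rV_N, ~~ (u <= M)%MS & forall a, (u *m X a <= M)%MS.
    by have [U UP] := space v0; apply: (H _ v0 U).
  elim: r v U => [|r IH] v U vM UP rU.
    exists v => // a; have : (v *m X a <= U)%MS.
      apply/UP; exists (X a), 0; rewrite sub0mx addr0; split=> //.
      by rewrite -[X a]mulmx1; apply: (wspan_word X (s := [:: a])).
    by move: rU; rewrite leqn0 mxrank_eq0 => /eqP ->; rewrite submx0 => /eqP ->; rewrite sub0mx.
  have [H|/existsNP[a /negP uM]] := pselect (forall a, (v *m X a <= M)%MS); first by exists v.
  have sa : wspan X 1 (X a).
    by rewrite -[X a]mulmx1; apply: (wspan_word X (s := [:: a])).
  set u := v *m X a in uM; have [U' UP'] := space u.
  have UU' : (U' <= U)%MS.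
    apply/rV_subP => w /UP'[B [m [sB mM ->]]]; apply/UP.
    exists (X a *m B), m; rewrite mulmxA; split=> //.
    by elim: (wspanM sa sB) => [|c s A ls _]; [exact: WSpan0|apply: WSpanS; apply: leq_trans ls].
  have [UU|nUU] := boolP (U <= U')%MS; last first.
    apply: (IH u U') => //; rewrite -ltnS; apply: leq_trans rU.
    by rewrite (ltn_leqif (mxrank_leqif_sup UU')).
  have /UP'[B [m [sB mM E]]] : (u <= U')%MS.
    apply: submx_trans UU; apply/UP; exists (X a), 0.
    by rewrite sub0mx addr0.
  have [n Bn] := nilA B sB; case/negP: uM.
  suff Hn j : (u - u *m mxpow B j <= M)%MS by have := Hn n; rewrite Bn mulmx0 subr0.
  elim: j => [|j IHj]; first by rewrite mulmx1 subrr sub0mx.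
  have -> : u - u *m mxpow B j.+1 = u - u *m mxpow B j + m *m mxpow B j.
    rewrite mxpowS mulmxA -addrA; congr (_ + _); rewrite [in RHS]E mulmxDl.
    by rewrite opprD addrNK.
  rewrite addmx_sub //; elim: j {IHj} => [|j IHj]; first by rewrite mulmx1.
  have comm : mxpow B j.+1 = mxpow B j *m B.
    elim: j {IHj} => [|j IHj]; first by rewrite mxpowS mulmx1 mul1mx.
    by rewrite mxpowS {1}IHj mulmxA.
  by rewrite comm mulmxA; apply: Mspan.
(* Until it is everything, the chain gains at least one dimension per step, so N steps fill the
   space. *)
have H k : (1%:M <= wordker k)%MS \/ (k <= \rank (wordker k))%N.
  elim: k => [|k [IH|IH]]; first by right.
    by left; apply: submx_trans IH (wordkerS k).
  case: (boolP (1%:M <= wordker k)%MS) => [H|/grow H].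
    by left; apply: submx_trans H (wordkerS k).
  by right; apply: leq_ltn_trans IH H.
have [//|rN] := H N; rewrite sub1mx /row_full eqn_leq rN rank_leq_row //.
Qed.

Lemma nilpotent_bound k : nilpotent_at X k -> nilpotent_at X N.
Proof.
move=> nk; apply: nil_words => A sA; exists k.
exact: wspan_nilpotent nk (wspan_pow k sA).
Qed.

End Chain.

(** In the rank factorization A = C R idempotency forces R C = 1, an identity matrix of size the
    rank, and tr (C R) = tr (R C). *)
Lemma mxtrace_idempotent (F : fieldType) n (A : 'M[F]_n) : A *m A = A -> \tr A = (\rank A)%:R.
Proof.
move=> AA; rewrite -{1}(mulmx_base A) mxtrace_mulC.
suff -> : row_base A *m col_base A = 1%:M by rewrite mxtrace1.
have [R CR] := row_fullP (col_base_full A); have [C RC] := row_freeP (row_base_free A).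
move: (col_base A) (row_base A) (mulmx_base A) CR RC => c r E CR RC; move: AA.
rewrite -{1 2 3}E => {E}.
move=> /(congr1 (fun M => R *m M *m C)).
by rewrite !mulmxA CR !mul1mx -!mulmxA RC !mulmx1.
Qed.

Section Trace.
Variable F : numFieldType.

Lemma mxpowE n (A : 'M[F]_n.+1) k : mxpow A k = A ^+ k.
Proof. by elim: k => [|k IH] //; rewrite mxpowS IH exprS. Qed.

(* The idempotent of the Fitting decomposition of A is a polynomial in A without
   constant term; its trace is its rank. *)
Lemma trace_nilpotent n (A : 'M[F]_n) :
  (forall k, \tr (mxpow A k.+1) = 0) -> exists k, mxpow A k = 0.
Proof.
case: n A => [|n] A trA; first by exists 0%N; rewrite flatmx0.
have char0 := monic_neq0 (char_poly_monic A).
have [m [q qr E]] := multiplicity_XsubC (char_poly A) 0.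
rewrite char0 /= subr0 in qr E.
have : coprimep ('X^(m.+1)) q.
  by rewrite coprimep_expl // coprimep_sym -['X]subr0 -polyC0 coprimep_XsubC.
move=> /Bezout_eq1_coprimepP[[u v] /= uv].
have CH : horner_mx A (q * 'X^m) = 0 by rewrite -E Cayley_Hamilton.
(* The exponent is [m.+1] rather than m so that e is divisible by X even when m = 0; otherwise its
   trace at A could involve the identity matrix. *)
pose e := u * 'X^(m.+1).
have ev : e = 1 - v * q by rewrite -uv addrK.
have idem : horner_mx A e * horner_mx A e = horner_mx A e.
  rewrite -rmorphM {2}ev mulrBr mulr1 rmorphB /=.
  rewrite (_ : e * (v * q) = (u * v * 'X) * (q * 'X^m)); last first.
    by rewrite /e exprS; ring.
  by rewrite [horner_mx A (_ * (q * _))]rmorphM /= CH mulr0 subr0.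
have tr0 : \tr (horner_mx A e) = 0.
  have -> : horner_mx A e = horner_mx A (u * 'X^m) * A.
    by rewrite /e exprSr mulrA rmorphM /= horner_mx_X.
  suff H p k : \tr (horner_mx A p * A ^+ k.+1) = 0 by rewrite -[A in _ * A]expr1.
  elim/poly_ind: p k => [|p c IH] k; first by rewrite rmorph0 mul0r mxtrace0.
  rewrite rmorphD rmorphM /= horner_mx_X horner_mx_C mulrDl -mulrA -exprS.
  rewrite mxtraceD IH add0r -[_ * _]/(_ *m _) mul_scalar_mx mxtraceZ -mxpowE trA.
  by rewrite mulr0.
(* Characteristic zero enters here: a rank that vanishes in the field is zero. *)
have E0 : horner_mx A e = 0.
  apply/eqP; rewrite -mxrank_eq0 -(pnatr_eq0 F) -mxtrace_idempotent //.
  exact/eqP.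
exists m; rewrite mxpowE -[A ^+ m]mul1r.
have -> : 1 = horner_mx A e + horner_mx A (v * q) by rewrite -rmorphD uv rmorph1.
rewrite E0 add0r rmorphM /= -mulrA.
have -> : horner_mx A q * A ^+ m = horner_mx A (q * 'X^m).
  by rewrite rmorphM rmorphXn /= horner_mx_X.
by rewrite CH mulr0.
Qed.

Lemma nil_of_traces N (K : finType) (X : K -> 'M[F]_N) :
  (forall s, (0 < size s)%N -> \tr (word X s) = 0) -> nilpotent_at X N.
Proof.
move=> trX; apply: nil_words => A sA; apply: trace_nilpotent => k.
elim: (wspan_pow k.+1 sA) => [|c s B ks _ IH]; first exact: mxtrace0.
by rewrite mxtraceD mxtraceZ trX ?mulr0 ?IH ?addr0 //; apply: leq_trans ks.
Qed.

End Trace.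

(** * The nullcone *)

Section PolynomialFunctions.
Variable n : nat.
Implicit Types f g : affine_space n -> CC.

Definition ispoly f := exists p : {mpoly CC[n]}, forall x, pev p x = f x.

Lemma ispoly_const c : ispoly (fun=> c).
Proof. by exists c%:MP => x; rewrite pevC. Qed.

Lemma ispoly_coord (i : 'I_n) : ispoly (fun x => pcoord x i).
Proof. by exists 'X_i => x; rewrite pevX. Qed.

Lemma ispoly_add f g : ispoly f -> ispoly g -> ispoly (fun x => f x + g x).
Proof. by move=> [p pf] [q qg]; exists (p + q) => x; rewrite pevD pf qg. Qed.

Lemma ispoly_mul f g : ispoly f -> ispoly g -> ispoly (fun x => f x * g x).
Proof. by move=> [p pf] [q qg]; exists (p * q) => x; rewrite pevM pf qg. Qed.

Definition ispoly_sum := function_ring_sum ispoly_const ispoly_add.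
Definition ispoly_prod := function_ring_prod ispoly_const ispoly_mul.

Lemma ispoly_mulmx m k p (A : affine_space n -> 'M[CC]_(m, k))
    (B : affine_space n -> 'M[CC]_(k, p)) :
  (forall i j, ispoly (fun x => A x i j)) -> (forall i j, ispoly (fun x => B x i j)) ->
  forall i j, ispoly (fun x => (A x *m B x) i j).
Proof.
move=> pA pB i j.
rewrite (_ : (fun x => _) = fun x => \sum_l A x i l * B x l j).
  by apply: ispoly_sum => l; apply: ispoly_mul.
by apply/funext => x; rewrite mxE.
Qed.

End PolynomialFunctions.

Section QuiverReps.
Variable Q : quiver.
Implicit Types d e f : dimvec Q.

Definition basis_index d : finType := {i : vertex Q & 'I_(d i)}.

Definition incl d i : 'M[CC]_(#|basis_index d|, d i) :=
  \matrix_(p, c) (enum_val p == Tagged (fun i => 'I_(d i)) c)%:R.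

Lemma inclTincl d i : (incl d i)^T *m incl d i = 1%:M.
Proof.
apply/matrixP => r c; rewrite !mxE (bigD1 (enum_rank (Tagged (fun i => 'I_(d i)) r))) //=.
rewrite !mxE enum_rankK eqxx mul1r big1 ?addr0; last first.
  move=> p pr; rewrite !mxE; case: eqP => [E|_]; last by rewrite mul0r.
  by move: pr; rewrite -E enum_valK eqxx.
by rewrite -tag_eqE /tag_eq /= eqxx tagged_asE.
Qed.

Lemma inclTincl0 d i j : i != j -> (incl d i)^T *m incl d j = 0.
Proof.
move=> ij; apply/matrixP => r c; rewrite !mxE big1 // => p _; rewrite !mxE.
case: eqP => [->|_]; last by rewrite mul0r.
by rewrite mul1r -tag_eqE /tag_eq /= (negPf ij).
Qed.

Lemma sum_incl d : \sum_i incl d i *m (incl d i)^T = 1%:M.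
Proof.
apply/matrixP => p q; rewrite summxE.
under eq_bigr do rewrite mxE.
rewrite (eq_bigr (fun i => \sum_(c : 'I_(d i))
    (enum_val p == Tagged (fun i => 'I_(d i)) c)%:R * (enum_val q == Tagged (fun i => 'I_(d i)) c)%:R)).
  rewrite (sig_big_dep _ (fun _ _ => true) (fun i (c : 'I_(d i)) =>
    (enum_val p == Tagged (fun i => 'I_(d i)) c)%:R * (enum_val q == Tagged (fun i => 'I_(d i)) c)%:R)) /=.
  rewrite (bigD1 (enum_val p)) //= big1 ?addr0; last first.
    by move=> [i c] /= H; rewrite eq_sym (negPf H) mul0r.
  rewrite mxE; case: (enum_val p) (@enum_valK _ p) => i c /= E.
  by rewrite eqxx mul1r -E (can2_eq enum_valK enum_rankK) eq_sym.
by move=> i _; apply: eq_bigr => c _; rewrite !mxE.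
Qed.

(* A representation acts on row vectors: the arrow a maps v to v *m B a. *)
Definition qrep d := mxfamily (fun a : arrow Q => d (src a)) (fun a => d (tgt a)).

(** All arrows become endomorphisms of the sum of the V_i. Words that are not paths vanish because
    different vertices are orthogonal, so nilpotency of the representation becomes nilpotency of a
    family of square matrices. *)
Definition big_mx d (B : qrep d) (a : arrow Q) : 'M[CC]_#|basis_index d| :=
  incl d (src a) *m B a *m (incl d (tgt a))^T.

(** Fixing the length at the total dimension makes this a finite conjunction of equations; by
    [nilrepP] any other bound on the length gives the same condition. *)
Definition nilrep d (B : qrep d) : bool :=
  [forall s : #|basis_index d|.-tuple (arrow Q), word (big_mx B) s == 0].

Lemma nilrepP d (B : qrep d) :
  reflect (exists k, nilpotent_at (big_mx B) k) (nilrep B).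
Proof.
apply: (iffP forallP) => [H|[k nk] s].
  by exists #|basis_index d| => s /eqP ss; apply: (eqP (H (Tuple ss))).
by apply/eqP/(nilpotent_bound nk); rewrite size_tuple.
Qed.

Definition glue d e (h : forall i, 'M[CC]_(d i, e i)) : 'M[CC]_(#|basis_index d|, #|basis_index e|) :=
  \sum_i incl d i *m h i *m (incl e i)^T.

Lemma glue_incl d e (h : forall i, 'M[CC]_(d i, e i)) i : glue h *m incl e i = incl d i *m h i.
Proof.
rewrite mulmx_suml (bigD1 i) //= -mulmxA inclTincl mulmx1 big1 ?addr0 // => j ji.
by rewrite -mulmxA inclTincl0 // mulmx0.
Qed.

Lemma incl_glue d e (h : forall i, 'M[CC]_(d i, e i)) i :
  (incl d i)^T *m glue h = h i *m (incl e i)^T.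
Proof.
rewrite mulmx_sumr (bigD1 i) //= !mulmxA inclTincl mul1mx big1 ?addr0 // => j ji.
by rewrite !mulmxA inclTincl0 1?eq_sym // !mul0mx.
Qed.

Lemma glueM d e f (h : forall i, 'M[CC]_(d i, e i)) (k : forall i, 'M[CC]_(e i, f i)) :
  glue h *m glue k = glue (fun i => h i *m k i).
Proof.
rewrite [in LHS]/glue mulmx_suml; apply: eq_bigr => i _.
by rewrite -mulmxA incl_glue !mulmxA.
Qed.

Lemma glue1 d (h : forall i, 'M[CC]_(d i)) : (forall i, h i = 1%:M) -> glue h = 1%:M.
Proof.
by move=> h1; rewrite -sum_incl; apply: eq_bigr => i _; rewrite h1 mulmx1.
Qed.

Definition intertwines d e (h : forall i, 'M[CC]_(d i, e i)) (B : qrep d) (C : qrep e) :=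
  forall a, B a *m h (tgt a) = h (src a) *m C a.

Lemma intertwines_word d e (h : forall i, 'M[CC]_(d i, e i)) B C s : intertwines h B C ->
  word (big_mx B) s *m glue h = glue h *m word (big_mx C) s.
Proof.
move=> hBC; elim: s => [|a s IH]; first by rewrite mul1mx mulmx1.
have step : big_mx B a *m glue h = glue h *m big_mx C a.
  rewrite /big_mx -!mulmxA incl_glue (mulmxA (glue h)) glue_incl.
  by rewrite (mulmxA (B a)) hBC -!mulmxA.
by rewrite /= -mulmxA IH mulmxA step -mulmxA.
Qed.

Lemma isomorphic_nilrep d (h k : forall i, 'M[CC]_(d i)) (B C : qrep d) :
  (forall i, h i *m k i = 1%:M) -> intertwines h B C -> nilrep C -> nilrep B.
Proof.
move=> hk hBC /nilrepP[n nC]; apply/nilrepP; exists n => s /nC sC.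
rewrite -[word _ _]mulmx1 -(glue1 hk) -glueM mulmxA (intertwines_word _ hBC) sC.
by rewrite mulmx0 mul0mx.
Qed.

Definition rep_of d (x : rep_space d) : qrep d := fun a => (rep_mx x a)^T.

Definition repsp d : cspace := famsp (fun a : arrow Q => d (tgt a)) (fun a => d (src a)).

Lemma rep_mx_enc d (A : repsp d) : rep_mx (enc A) = A.
Proof. exact: (@encK (repsp d)). Qed.

Definition glsp d : cspace := famsp (d : vertex Q -> nat) d.

Lemma gl_mx_enc d (A : glsp d) : gl_mx (enc A) = A.
Proof. exact: (@encK (glsp d)). Qed.

Lemma ispoly_word d s i j : ispoly (fun x : rep_space d => word (big_mx (rep_of x)) s i j).
Proof.
elim: s i j => [|a s IH] i j; first exact: ispoly_const.
apply: ispoly_mulmx => // {i j} i j.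
apply: ispoly_mulmx => [{i j} i j|{i j} i j]; last exact: ispoly_const.
apply: ispoly_mulmx => {i j} i j; first exact: ispoly_const.
have [p pE] := ispoly_coord (enum_rank
  (Tagged (fun a => 'I_(d (tgt a)) * 'I_(d (src a)))%type (j, i) : rep_entry d)).
by exists p => x; rewrite pE !mxE.
Qed.

Lemma orbit_trace d (x y : rep_space d) s : gl_orbit x y ->
  \tr (word (big_mx (rep_of y)) s) = \tr (word (big_mx (rep_of x)) s).
Proof.
move=> [[g gU] /= E].
(* Passing to row vectors transposes g_j V g_i^-1, so the change of basis is by transposed
   inverses. *)
pose h i := (invmx (gl_mx g i))^T; pose k i := (gl_mx g i)^T.
have hk i : h i *m k i = 1%:M by rewrite -trmx_mul mulmxV ?trmx1 //; apply: gU.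
have kh i : k i *m h i = 1%:M by rewrite -trmx_mul mulVmx ?trmx1 //; apply: gU.
have hyx : intertwines h (rep_of y) (rep_of x).
  move=> a; rewrite /rep_of E !trmx_mul -/(h _) -/(k _) -!mulmxA.
  by congr (_ *m _); rewrite kh mulmx1.
rewrite -[word _ s in LHS]mulmx1 -(glue1 hk) -glueM mulmxA (intertwines_word s hyx).
by rewrite mxtrace_mulC mulmxA glueM (glue1 kh) mul1mx.
Qed.

(** If the trace of a nonempty word were nonzero at x, the open set where it differs from this value
    would contain 0 and miss the orbit. *)
Lemma nullcone_nilrep d (x : rep_space d) : nullcone_set x -> nilrep (rep_of x).
Proof.
move=> [z z0 zx]; apply/nilrepP; exists #|basis_index d|; apply: nil_of_traces => s s0.
have [p pE] : ispoly (fun x : rep_space d => \tr (word (big_mx (rep_of x)) s)).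
  by apply: ispoly_sum => i; apply: ispoly_word.
apply/eqP/negPn/negP => trx.
have [] := zx [set y | pev (p - (\tr (word (big_mx (rep_of x)) s))%:MP) y != 0].
- by apply/affine_opnP => y py; exists (p - (\tr (word (big_mx (rep_of x)) s))%:MP).
- rewrite /= pevD pevN pevC pE.
  rewrite (_ : \tr _ = 0) ?sub0r ?oppr_eq0 //; case: s s0 {p pE trx} => // a s _ /=.
  by rewrite /big_mx /rep_of z0 trmx0 mulmx0 !mul0mx mxtrace0.
- move=> y [/= py xy]; move: py; rewrite pevD pevN pevC pE (orbit_trace s xy) subrr.
  by rewrite eqxx.
Qed.

End QuiverReps.

(** The factor X excludes t = 0 together with the roots of [r], and there are more integers in the
    list than roots. *)
Lemma poly_nonroot (F : numFieldType) (r : {poly F}) : r != 0 -> exists2 t, t != 0 & r.[t] != 0.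
Proof.
move=> r0; have rX0 : r * 'X != 0 by rewrite mulf_neq0 // polyX_eq0.
pose s := [seq (i%:R : F) | i <- iota 0 (size (r * 'X))].
have us : uniq s.
  rewrite map_inj_uniq ?iota_uniq // => i j /eqP.
  by rewrite eqr_nat => /eqP.
have : ~~ all (root (r * 'X)) s.
  apply/negP => alls; have := max_poly_roots rX0 alls us.
  by rewrite size_map size_iota ltnn.
move=> /allPn[t _]; rewrite /root hornerM hornerX mulf_eq0 negb_or => /andP[rt t0].
by exists t.
Qed.

(** * Contracting a nilpotent representation to zero *)

Section Degeneration.
Variables (Q : quiver) (d : dimvec Q) (B : qrep d).
Local Notation N := #|basis_index d|.

Definition layer (k : nat) (i : vertex Q) : 'M[CC]_(d i) :=
  (\bigcap_(s : k.-tuple (arrow Q)) kermx ((incl d i)^T *m word (big_mx B) s))%MS.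

Lemma layerP m k i (A : 'M[CC]_(m, d i)) :
  reflect (forall s, size s = k -> A *m (incl d i)^T *m word (big_mx B) s = 0)
    (A <= layer k i)%MS.
Proof.
apply: (iffP sub_bigcapmxP) => H s.
  by move=> /eqP sk; rewrite -mulmxA; apply/sub_kermxP; apply: (H (Tuple sk)).
by move=> _; apply/sub_kermxP; rewrite mulmxA; apply: H; rewrite size_tuple.
Qed.

Lemma layer_le k l i : (k <= l)%N -> (layer k i <= layer l i)%MS.
Proof.
move=> kl; apply/layerP => s sl; rewrite -(cat_take_drop k s) word_cat mulmxA.
have /layerP -> := submx_refl (layer k i); first by rewrite mul0mx.
by rewrite size_takel ?sl.
Qed.

Lemma layer0 i : layer 0 i = 0.
Proof.
have /layerP/(_ [::] erefl) := submx_refl (layer 0 i).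
rewrite mulmx1 => /(congr1 (mulmx^~ (incl d i))).
by rewrite -mulmxA inclTincl mulmx1 mul0mx.
Qed.

Lemma layer_arrow m k a (A : 'M[CC]_(m, d (src a))) : (A <= layer k.+1 (src a))%MS ->
  (A *m B a <= layer k (tgt a))%MS.
Proof.
move=> /layerP H; apply/layerP => s sk.
have := H (a :: s); rewrite /= sk => /(_ erefl) <-.
by rewrite /big_mx !mulmxA -(mulmxA A (incl d (src a))^T) inclTincl mulmx1.
Qed.

(** Projectors chosen separately for nested subspaces need not commute. Here the projector to a
    layer is the product of the projections to all the larger layers in turn, so that it factors
    through each of theirs; this yields [lproj_min] and orthogonal graded pieces. *)
Fixpoint descent i j : 'M[CC]_(d i) :=
  if j is j'.+1 then
    descent i j' *m (pinvmx (layer (N - j) i) *m layer (N - j) i)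
  else 1%:M.

Lemma descent_fix m i j (A : 'M[CC]_(m, d i)) : (A <= layer (N - j) i)%MS ->
  A *m descent i j = A.
Proof.
elim: j => [|j IH] AL; first by rewrite mulmx1.
rewrite /= mulmxA IH; last by apply: submx_trans AL _; apply: layer_le; rewrite leq_sub2l.
by rewrite mulmxA mulmxKpV.
Qed.

Lemma descent_add i j m : exists R, descent i (j + m) = descent i j *m R.
Proof.
elim: m => [|m [R E]]; first by exists 1%:M; rewrite addn0 mulmx1.
by rewrite addnS /= E -mulmxA; eexists.
Qed.

Definition lproj k i := descent i (N - k).

Hypothesis nilB : nilrep B.

Lemma layer_top i : (1%:M <= layer N i)%MS.
Proof.
apply/layerP => s /eqP ss.
have /forallP/(_ (Tuple ss))/eqP /= -> := nilB.
by rewrite mulmx0.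
Qed.

Lemma lproj_sub k i : (k <= N)%N -> (lproj k i <= layer k i)%MS.
Proof.
move=> kN; rewrite /lproj; have := leq_subr k N; move E : (N - k)%N => [|j] _.
  have -> : k = N by apply/eqP; rewrite eqn_leq kN -subn_eq0 E.
  exact: layer_top.
by rewrite /= -E subKn // mulmxA submxMl.
Qed.

Lemma lproj_fix m k i (A : 'M[CC]_(m, d i)) : (k <= N)%N -> (A <= layer k i)%MS ->
  A *m lproj k i = A.
Proof. by move=> kN AL; apply: descent_fix; rewrite subKn. Qed.

Lemma lproj_min k l i : (k <= N)%N -> (l <= N)%N ->
  lproj k i *m lproj l i = lproj (minn k l) i.
Proof.
move=> kN lN; have [kl|lk] := leqP k l.
  by rewrite lproj_fix //; apply: submx_trans (lproj_sub i kN) (layer_le i kl).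
have [R E] := descent_add i (N - k) (k - l).
have -> : lproj l i = lproj k i *m R by rewrite /lproj -E addnBA ?subnK // ltnW.
by rewrite mulmxA lproj_fix //; apply: lproj_sub.
Qed.

Lemma lproj0 i : lproj 0 i = 0.
Proof. by apply/eqP; rewrite -submx0 -(layer0 i) lproj_sub. Qed.

Lemma lprojN i : lproj N i = 1%:M.
Proof. by rewrite /lproj subnn. Qed.

Definition graded k i := lproj k.+1 i - lproj k i.

Lemma gradedM (k l : 'I_N) i : graded k i *m graded l i = if k == l then graded k i else 0.
Proof.
have kN := ltn_ord k; have lN := ltn_ord l; have kN' := ltnW kN; have lN' := ltnW lN.
rewrite /graded mulmxBl !mulmxBr !lproj_min //.
case: (ltngtP k l) => [kl|lk|/val_inj <-].
- have /negPf -> : k != l by rewrite neq_ltn kl.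
  have /minn_idPl -> : (k.+1 <= l.+1)%N by rewrite ltnS ltnW.
  have /minn_idPl -> : (k <= l.+1)%N by rewrite ltnW // ltnS ltnW.
  by rewrite (minn_idPl kl) !subrr.
- have /negPf -> : k != l by rewrite neq_ltn lk orbT.
  have /minn_idPr -> : (l.+1 <= k.+1)%N by rewrite ltnS ltnW.
  have /minn_idPr -> : (l <= k.+1)%N by rewrite ltnW // ltnS ltnW.
  by rewrite (minn_idPr lk) subrr.
- rewrite eqxx !minnn (minn_idPr (leqnSn k)) (minn_idPl (leqnSn k)).
  by rewrite subrr subr0.
Qed.

Lemma sum_graded i : \sum_(k < N) graded k i = 1%:M.
Proof.
transitivity (lproj N i - lproj 0 i); last by rewrite lprojN lproj0 subr0.
by rewrite -(telescope_sumr (fun k => lproj k i)) // big_mkord.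
Qed.

(** An arrow sends layer k+1 into layer k, on which the l-th graded projector is zero for l >= k. *)
Lemma graded_arrow (k l : 'I_N) a : (k <= l)%N ->
  graded k (src a) *m B a *m graded l (tgt a) = 0.
Proof.
move=> kl; have kN := ltn_ord k; have lN := ltn_ord l.
have sub : (graded k (src a) *m B a <= layer k (tgt a))%MS.
  apply: layer_arrow; rewrite addmx_sub ?lproj_sub // eqmx_opp.
  by apply: submx_trans (lproj_sub _ (ltnW kN)) (layer_le _ (leqnSn k)).
rewrite mulmxBr !lproj_fix ?subrr //; try exact: ltnW.
  by apply: submx_trans sub (layer_le _ kl).
by apply: submx_trans sub (layer_le _ (leqW kl)).
Qed.

Definition scaling t i : 'M[CC]_(d i) := \sum_(k < N) t ^+ k *: graded k i.

Lemma scalingM t u i : t * u = 1 -> scaling t i *m scaling u i = 1%:M.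
Proof.
move=> tu; rewrite mulmx_suml -sum_graded; apply: eq_bigr => k _.
rewrite mulmx_sumr (bigD1 k) //= big1 ?addr0; last first.
  by move=> l lk; rewrite -scalemxAl -scalemxAr gradedM eq_sym (negPf lk) !scaler0.
by rewrite -scalemxAl -scalemxAr gradedM eqxx scalerA -exprMn tu expr1n scale1r.
Qed.

(* The conjugate of B by [scaling t], in a form that makes sense at t = 0. *)
Definition degeneration t : qrep d := fun a =>
  \sum_(k < N) \sum_(l < N) t ^+ (k - l) *: (graded k (src a) *m B a *m graded l (tgt a)).

Lemma degeneration_scaling t u a : t * u = 1 ->
  degeneration t a = scaling t (src a) *m B a *m scaling u (tgt a).
Proof.
move=> tu; rewrite !mulmx_suml; apply: eq_bigr => k _.
rewrite mulmx_sumr; apply: eq_bigr => l _.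
rewrite -!scalemxAl -scalemxAr scalerA.
(* The truncated exponent k - l does no harm: the components with k <= l are zero. *)
have [kl|lk] := leqP k l; first by rewrite graded_arrow // !scaler0.
congr (_ *: _); rewrite -[in RHS](subnK (ltnW lk)) exprD -mulrA -exprMn tu expr1n.
by rewrite mulr1.
Qed.

Lemma degeneration0 a : degeneration 0 a = 0.
Proof.
rewrite /degeneration big1 // => k _; rewrite big1 // => l _.
have [kl|lk] := leqP k l; first by rewrite graded_arrow // scaler0.
by rewrite expr0n subn_eq0 leqNgt lk /= scale0r.
Qed.

End Degeneration.

Section Nullcone.
Variables (Q : quiver).
Implicit Types d : dimvec Q.

(** The limit t -> 0 is taken in the Zariski topology: a polynomial that is nonzero at [y 0]
    restricts to a nonzero polynomial in t, hence is nonzero at some t != 0, where [y t] lies in the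
    orbit of x. *)
Lemma nilrep_nullcone d (x : rep_space d) : nilrep (rep_of x) -> nullcone_set x.
Proof.
move=> nx; pose y t : repsp d := fun a => (degeneration (rep_of x) t a)^T.
exists (enc (y 0)).
  by move=> a; rewrite rep_mx_enc /y degeneration0 // trmx0.
move=> U /affine_opnP oU U0; have [p [p0 pU]] := oU _ U0.
pose polynomial (f : CC -> CC) := exists r : {poly CC}, forall t, r.[t] = f t.
have polyC c : polynomial (fun=> c) by exists c%:P => t; rewrite hornerC.
have polyD f g : polynomial f -> polynomial g -> polynomial (fun t => f t + g t).
  by move=> [r rf] [s sg]; exists (r + s) => t; rewrite hornerD rf sg.
have polyM f g : polynomial f -> polynomial g -> polynomial (fun t => f t * g t).
  by move=> [r rf] [s sg]; exists (r * s) => t; rewrite hornerM rf sg.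
have [r rE] : polynomial (fun t => pev p (enc (y t))).
  apply: (@function_ring_meval _ polynomial polyC polyD polyM _ p) => i.
  rewrite (_ : (fun _ => _) = fun t => mxfamily_get (y t) (enum_val i)); last first.
    apply/funext => t; rewrite -(fsp_encE (@mxfamily_get _ _ _) (y t) (enum_val i)).
    by rewrite enum_valK.
  case: (enum_val i) => a [j k]; rewrite /mxfamily_get /y /=.
  rewrite (_ : (fun _ => _) = fun t => \sum_(l < #|basis_index d|) \sum_(m < #|basis_index d|)
      t ^+ (l - m) * (graded (rep_of x) l (src a) *m rep_of x a *m graded (rep_of x) m (tgt a)) k j).
    apply: (function_ring_sum polyC polyD) => l; apply: (function_ring_sum polyC polyD) => m.
    by apply: polyM => //; exists 'X^(l - m) => t; rewrite hornerXn.
  apply/funext => t; rewrite mxE summxE; apply: eq_bigr => l _; rewrite summxE.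
  by apply: eq_bigr => m _; rewrite mxE.
have r0 : r != 0.
  apply/eqP => r0; case/eqP: p0.
  by rewrite -[LHS]/(pev p (enc (y 0))) -rE r0 horner0.
have [t t0 rt] := poly_nonroot r0.
exists (enc (y t)); split; first by apply: pU; rewrite -[evalp _ _]/(pev p _) -rE.
have tV : t * t^-1 = 1 by rewrite mulfV.
have Vt : t^-1 * t = 1 by rewrite mulVf.
pose g : glsp d := fun i => (scaling (rep_of x) t^-1 i)^T.
pose h : glsp d := fun i => (scaling (rep_of x) t i)^T.
have gh i : g i *m h i = 1%:M by rewrite -trmx_mul scalingM // trmx1.
have gU i : gl_mx (enc g) i \in unitmx.
  by rewrite gl_mx_enc; case/mulmx1_unit: (gh i).
exists (exist _ (enc g) gU) => a /=.
rewrite rep_mx_enc gl_mx_enc /y (degeneration_scaling nx a tV) !trmx_mul trmxK.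
rewrite mulmxA; congr (_ *m _).
by rewrite -[LHS]mul1mx -(mulVmx (gU (src a))) -mulmxA gl_mx_enc gh mulmx1.
Qed.

Lemma nullconeE d : @nullcone_set Q d = [set x | nilrep (rep_of x)].
Proof.
by apply/seteqP; split=> x; [exact: nullcone_nilrep|exact: nilrep_nullcone].
Qed.

(** The equations are all polynomials vanishing on the nilpotent representations; the entries of
    long words are among them and already cut out the set. *)
Lemma nullcone_closed d : zclosed (@nullcone_set Q d).
Proof.
pose P : set {mpoly CC[#|rep_entry d|]} := [set p | forall x, nilrep (rep_of x) -> pev p x = 0].
rewrite nullconeE (_ : [set x | _] = zeros P); first exact: zeros_closed.
apply/seteqP; split=> x; first by move=> nx p; apply.
move=> zx; apply/forallP => s; apply/eqP/matrixP => i j; rewrite [RHS]mxE.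
have [p pE] := ispoly_word (d := d) s i j.
rewrite -pE; apply: zx => y /forallP/(_ s)/eqP E.
by rewrite pE E mxE.
Qed.

Lemma nullcone_variety d : is_variety (@nullcone Q d).
Proof. exact: closed_is_variety (@nullcone_closed d). Qed.

End Nullcone.

(** * Measures of sets of matrices *)

Section MuMatrices.

Lemma mu_matsp m n : mu [set: matsp m n] = ell ^+ (m * n).
Proof. by rewrite muT /= card_prod !card_ord. Qed.

Lemma mu_ext (T : cspace) (S S' : set T) : (forall x, S x <-> S' x) -> mu S = mu S'.
Proof. by move=> E; congr mu; apply/seteqP; split=> x /E. Qed.

Lemma mu_compl (T : cspace) (S : set T) : ddef S -> mu (~` S) = mu [set: T] - mu S.
Proof.
move=> dS; apply/eqP; rewrite eq_sym subr_eq addrC -muU //.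
- by rewrite setUv.
- exact: ddefC.
- exact: setICr.
Qed.

Lemma dmap_const (T U : cspace) (u : U) : dmap (fun _ : T => u).
Proof. by move=> i; apply: DConst. Qed.

Lemma mu_point (T : cspace) (S : set T) x0 : ddef S -> (forall x, S x <-> x = x0) -> mu S = 1.
Proof.
move=> dS SE; have -> : 1 = mu [set: aff 0] by rewrite muT.
apply: (@mu_bijection T (aff 0) _ _ (fun=> mkpoint 0 (fun=> 0)) (fun=> x0)) => //.
- exact: dmap_const.
- exact: dmap_const.
- exact: ddefT.
- split=> // [_ _|x|y _]; first exact/SE.
    by move=> /SE.
  exact: pcoordP.
Qed.

Lemma mu_strata (T : cspace) (D : finType) (c : T -> D) (S : set T) :
  (forall v, dbool (fun x => c x == v)) -> ddef S ->
  mu S = \sum_v mu (S `&` [set x | c x == v]).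
Proof.
move=> dc dS.
suff H (r : seq D) : uniq r ->
    ddef (S `&` [set x | c x \in r]) /\
    mu (S `&` [set x | c x \in r]) = \sum_(v <- r) mu (S `&` [set x | c x == v]).
  have [_] := H (index_enum D) (index_enum_uniq D) => <-.
  by apply: mu_ext => x; split=> [Sx|[]//]; split=> //=; rewrite mem_index_enum.
elim: r => [_|v r IH /= /andP[vr ur]].
  rewrite big_nil (_ : S `&` _ = set0); first by split; [exact: ddef0|exact: mu0].
  by apply/seteqP; split=> x // [].
have [dr mr] := IH ur; have dv : ddef (S `&` [set x | c x == v]).
  by apply: ddefI => //; apply: ddef_bool.
have -> : S `&` [set x | c x \in v :: r] =
    (S `&` [set x | c x == v]) `|` (S `&` [set x | c x \in r]).
  by rewrite -setIUr; congr setI; apply/seteqP; split=> x /=; rewrite inE => /orP.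
split; first exact: ddefU.
rewrite big_cons -mr muU //; apply/seteqP; split=> // x [[_ /= /eqP ->] [_ /= vr']].
by rewrite vr' in vr.
Qed.

Lemma row_free_col_mx (F : fieldType) m n (v : 'rV[F]_n) (A : 'M[F]_(m, n)) :
  row_free (col_mx v A) = row_free A && ~~ (v <= A)%MS.
Proof.
rewrite /row_free -addsmxE.
have := mxrank_sum_cap v A; have [vA|vA] := boolP (v <= A)%MS.
  rewrite (addsmx_idPr vA) => _; rewrite andbF; apply/negbTE.
  by rewrite neq_ltn ltnS rank_leq_row.
have -> : \rank (v :&: A)%MS = 0%N.
  apply/eqP; rewrite -leqn0 -ltnS; apply: leq_trans (rank_leq_row v).
  rewrite (ltn_leqif (mxrank_leqif_sup (capmxSl _ _))) sub_capmx submx_refl /=.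
  exact: vA.
rewrite addn0 => ->.
have -> : \rank v = 1%N.
  by rewrite rank_rV; case: eqP vA => // ->; rewrite sub0mx.
by rewrite andbT -add1n eqn_add2l.
Qed.

Lemma dmx_fst (T : cspace) m n : dmx (T := prodsp (matsp m n) T) (fun x => x.1).
Proof. exact: (dmx_comp (@dmap_fst _ _) (@dmx_id m n)). Qed.

Lemma dmx_snd (T : cspace) m n : dmx (T := prodsp T (matsp m n)) (fun x => x.2).
Proof. exact: (dmx_comp (@dmap_snd _ _) (@dmx_id m n)). Qed.

Lemma dbool_row_free (T : cspace) m n (A : T -> 'M[CC]_(m, n)) :
  dmx A -> dbool (fun x => row_free (A x)).
Proof. exact: dbool_rank. Qed.

Lemma mu_copid n k : (k <= n)%N ->
  mu [set w : matsp 1 n | w *m copid_mx k != 0] = ell ^+ n - ell ^+ k.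
Proof.
move=> kn.
have d0 : dbool (T := matsp 1 n) (fun w => w *m copid_mx k == 0).
  by apply: dbool_mx_eq; [apply: dmx_mul; [apply: dmx_id|]|]; apply: dmx_const.
have -> : mu [set w : matsp 1 n | w *m copid_mx k != 0] =
    mu (~` [set w : matsp 1 n | w *m copid_mx k == 0]).
  by apply: mu_ext => w /=; split=> /negP.
rewrite mu_compl; last exact: ddef_bool.
rewrite mu_matsp mul1n; congr (_ - _).
rewrite -[in RHS](mul1n k) -mu_matsp.
apply: (@mu_bijection _ _ _ _ (fun w : matsp 1 n => w *m (pid_mx k : 'M_(n, k)) : matsp 1 k)
    (fun u : matsp 1 k => u *m (pid_mx k : 'M_(k, n)) : matsp 1 n)).
- by apply: dmap_mat; apply: dmx_mul; [apply: dmx_id|apply: dmx_const].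
- by apply: dmap_mat; apply: dmx_mul; [apply: dmx_id|apply: dmx_const].
- exact: ddef_bool.
- exact: ddefT.
- split=> // [u _ /=|w /eqP|u _].
  + by rewrite -mulmxA mul_pid_mx_copid // mulmx0.
  + rewrite mulmxBr mulmx1 => /eqP; rewrite subr_eq0 => /eqP E.
    by rewrite -mulmxA mul_pid_mx !minnn -E.
  + by rewrite -mulmxA mul_pid_mx minnn (minn_idPr kn) pid_mx_1 mulmx1.
Qed.

(** A row is added on top of m independent ones. Multiplied by the inverse of [row_ebase] of the old
    rows, it has to leave the span of the first m coordinates, a condition that no longer depends on
    those rows: the fibration becomes a product. *)
Lemma mu_row_free m n :
  mu [set A : matsp m n | row_free A] = \prod_(k < m) (ell ^+ n - ell ^+ k).
Proof.
elim: m => [|m IH].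
  rewrite big_ord0; apply: (@mu_point (matsp 0 n) _ (0 : 'M_(0, n))).
    by apply: ddef_bool; apply: dbool_row_free; apply: dmx_id.
  move=> A; rewrite [A]flatmx0; split=> // _ /=.
  by rewrite /row_free mxrank0.
rewrite big_ord_recr /=; have [mn|nm] := leqP m n; last first.
  (* For n < m the product contains the zero factor k = n, and no matrix of this size is row
     free. *)
  rewrite (bigD1 (Ordinal nm)) //= subrr mul0r mul0r.
  rewrite -[RHS](@mu0 (matsp m.+1 n)); apply: mu_ext => A; split=> //= fA.
  by have := rank_leq_col A; rewrite (eqP fA) => /ltnW /(leq_trans nm); rewrite ltnn.
rewrite -IH -mu_copid // -mu_prod; last first.
- apply: ddef_bool; apply/dbool_neg/dbool_mx_eq; last exact: dmx_const.
  by apply: dmx_mul; [apply: dmx_id|apply: dmx_const].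
- by apply: ddef_bool; apply: dbool_row_free; apply: dmx_id.
pose f (A : matsp m.+1 n) : prodsp (matsp m n) (matsp 1 n) :=
  (dsubmx (A : 'M_(1 + m, n)),
   usubmx (A : 'M_(1 + m, n)) *m invmx (row_ebase (dsubmx (A : 'M_(1 + m, n))))).
pose g (x : prodsp (matsp m n) (matsp 1 n)) : matsp m.+1 n :=
  col_mx (x.2 *m row_ebase x.1) x.1.
have du : dmx (T := matsp m.+1 n) (fun A => usubmx (A : 'M_(1 + m, n))).
  apply: (dmx_entries (s := @lshift 1 m) (t := id) (@dmx_id m.+1 n)) => A i j.
  by rewrite mxE.
have dd : dmx (T := matsp m.+1 n) (fun A => dsubmx (A : 'M_(1 + m, n))).
  apply: (dmx_entries (s := @rshift 1 m) (t := id) (@dmx_id m.+1 n)) => A i j.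
  by rewrite mxE.
apply: (@mu_bijection _ _ _ _ f g).
- apply: dmap_pair; apply: dmap_mat => //.
  by apply: dmx_mul => //; apply/dmx_invmx/dmx_row_ebase.
- apply: dmap_mat.
  have d1 := @dmx_fst (matsp 1 n) m n; have d2 := @dmx_snd (matsp m n) 1 n.
  have dU := dmx_mul d2 (dmx_row_ebase d1).
  move=> i j; case: (splitP (i : 'I_(1 + m))) => k ik.
    apply: (dfun_ext _ (dU k j)) => x; rewrite /g.
    have -> : i = lshift m k by apply: val_inj.
    exact/esym/col_mxEu.
  apply: (dfun_ext _ (d1 k j)) => x; rewrite /g.
  have -> : i = rshift 1 k by apply: val_inj.
  exact/esym/col_mxEd.
- by apply: ddef_bool; apply: dbool_row_free; apply: dmx_id.
- apply: ddef_prod.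
    by apply: ddef_bool; apply: dbool_row_free; apply: dmx_id.
  apply: ddef_bool; apply/dbool_neg/dbool_mx_eq; last exact: dmx_const.
  by apply: dmx_mul; [apply: dmx_id|apply: dmx_const].
split.
- move=> A /=; rewrite -{1}[A](@vsubmxK _ 1 m) row_free_col_mx => /andP[fA].
  rewrite submxE /cokermx (eqP fA) mulmxA; by split.
- move=> [A w] [/= fA]; rewrite row_free_col_mx fA /= submxE /cokermx (eqP fA).
  by rewrite mulmxA mulmxK // row_ebase_unit.
- move=> A _; rewrite /g /= mulmxKV ?row_ebase_unit //.
  exact: (@vsubmxK _ 1 m).
- move=> [A w] _; rewrite /f /g /= col_mxKu col_mxKd mulmxK //.
  exact: row_ebase_unit.
Qed.

End MuMatrices.

Section BlockMatrices.
Variable F : fieldType.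

(** Indices are compared as naturals, so that f + e = n enters the identities as a hypothesis and no
    cast between matrix types appears. *)
Definition lastmx f e n : 'M[F]_(e, n) := \matrix_(r, c) (c == (f + r)%N :> nat)%:R.

Lemma lastmxE f e : lastmx f e (f + e) = row_mx 0 1%:M.
Proof.
apply/matrixP => r c; rewrite !mxE; case: splitP => k ck; rewrite !mxE ck.
  by rewrite ltn_eqF // ltn_addr.
by rewrite eqn_add2l eq_sym.
Qed.

Lemma firstmxE f e : pid_mx f = row_mx 1%:M 0 :> 'M[F]_(f, f + e).
Proof. by rewrite -pid_mx_row. Qed.

Section Identities.
Variables (f e n : nat).
Hypothesis fen : (f + e)%N = n.

Lemma lastmxK : lastmx f e n *m (lastmx f e n)^T = 1%:M.
Proof.
by case: _ / fen; rewrite lastmxE tr_row_mx mul_row_col trmx1 trmx0 mulmx0 mulmx1 add0r.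
Qed.

Lemma first_lastmx : (pid_mx f : 'M[F]_(f, n)) *m (lastmx f e n)^T = 0.
Proof.
by case: _ / fen; rewrite lastmxE firstmxE tr_row_mx mul_row_col trmx1 trmx0 mulmx0 mul0mx addr0.
Qed.

Lemma last_firstmx : lastmx f e n *m (pid_mx f : 'M[F]_(f, n))^T = 0.
Proof. by apply: trmx_inj; rewrite trmx_mul trmxK trmx0 first_lastmx. Qed.

Lemma firstmxK : (pid_mx f : 'M[F]_(f, n)) *m (pid_mx f)^T = 1%:M.
Proof.
by case: _ / fen; rewrite firstmxE tr_row_mx mul_row_col trmx1 trmx0 mulmx0 mulmx1 addr0.
Qed.

Lemma first_last_sum :
  (pid_mx f : 'M[F]_(f, n))^T *m pid_mx f + (lastmx f e n)^T *m lastmx f e n = 1%:M.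
Proof.
case: _ / fen; rewrite lastmxE firstmxE !tr_row_mx !mul_col_row !trmx1 !trmx0.
by rewrite !mulmx0 !mul0mx !mulmx1 add_block_mx !addr0 !add0r -scalar_mx_block.
Qed.

Lemma lastmx_free : row_free (lastmx f e n).
Proof. by apply/row_freeP; exists (lastmx f e n)^T; exact: lastmxK. Qed.

End Identities.

End BlockMatrices.

(** The first r columns are zero and the other n - r form an arbitrary row free matrix. *)
Lemma mu_row_free_pid m n r p : (r <= n)%N -> (r <= p)%N ->
  mu [set A : matsp m n | (A *m (pid_mx r : 'M_(n, p)) == 0) && row_free A] =
  \prod_(k < m) (ell ^+ (n - r) - ell ^+ k).
Proof.
move=> rn rp; rewrite -mu_row_free.
have E : (r + (n - r) = n)%N by rewrite subnKC.
have zeroP (A : 'M[CC]_(m, n)) :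
    A *m (pid_mx r : 'M_(n, p)) = 0 <-> A *m (pid_mx r : 'M_(r, n))^T = 0.
  rewrite tr_pid_mx; split=> H.
    have -> : (pid_mx r : 'M_(n, r)) = (pid_mx r : 'M_(n, p)) *m (pid_mx r : 'M[CC]_(p, r)).
      by rewrite mul_pid_mx minnn (minn_idPr rp).
    by rewrite mulmxA H mul0mx.
  have -> : (pid_mx r : 'M_(n, p)) = (pid_mx r : 'M_(n, r)) *m (pid_mx r : 'M[CC]_(r, p)).
    by rewrite mul_pid_mx !minnn.
  by rewrite mulmxA H mul0mx.
apply: (@mu_bijection _ _ _ _ (fun A : matsp m n => A *m (lastmx CC r (n - r) n)^T : matsp m (n - r))
   (fun A : matsp m (n - r) => A *m lastmx CC r (n - r) n : matsp m n)).
- by apply: dmap_mat; apply: dmx_mul; [apply: dmx_id|apply: dmx_const].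
- by apply: dmap_mat; apply: dmx_mul; [apply: dmx_id|apply: dmx_const].
- apply: ddef_bool; apply: dbool_and; last by apply: dbool_row_free; apply: dmx_id.
  apply: dbool_mx_eq; last exact: dmx_const.
  by apply: dmx_mul; [apply: dmx_id|apply: dmx_const].
- by apply: ddef_bool; apply: dbool_row_free; apply: dmx_id.
have K (A : 'M[CC]_(m, n)) : A *m (pid_mx r : 'M_(n, p)) = 0 ->
    A *m (lastmx CC r (n - r) n)^T *m lastmx CC r (n - r) n = A.
  move=> /zeroP A0; rewrite -[RHS]mulmx1 -(first_last_sum CC E) mulmxDr mulmxA A0.
  by rewrite mul0mx add0r mulmxA.
split.
- move=> A /= /andP[/eqP A0 fA]; rewrite /row_free eqn_leq rank_leq_row /=.
  by rewrite -{1}(eqP fA) -{1}(K A A0) mxrankM_maxl.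
- move=> A /= fA; apply/andP; split; last first.
    by rewrite /row_free mxrankMfree // lastmx_free.
  by apply/eqP/zeroP; rewrite -mulmxA last_firstmx // mulmx0.
- by move=> A /= /andP[/eqP A0 _]; exact: K.
- by move=> A _; rewrite /= -mulmxA lastmxK // mulmx1.
Qed.

Section Families.
Variables (K : finType) (m n : K -> nat) (P : forall k, 'M[CC]_(m k, n k) -> bool).
Hypothesis dP : forall k, dbool (T := matsp (m k) (n k)) (@P k).

Local Notation partial s := [set A : famsp m n |
  [forall k, if k \in s then P (A k) else A k == 0]].

Lemma dbool_family (T : cspace) (A : T -> mxfamily m n) k :
  (forall k, dmx (fun x => A x k)) -> dbool (fun x => P (A x k)).
Proof.
by move=> dA; apply: (@dbool_comp T (matsp (m k) (n k)) (fun x => A x k) (@P k)) => //;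
  apply: dmap_mat.
Qed.

Lemma ddef_partial (s : seq K) : ddef (partial s).
Proof.
apply: ddef_bool; apply: dbool_forall => k; case: (k \in s).
  exact: (@dbool_family (famsp m n) (fun A => A) k (@dmx_family K m n)).
by apply: dbool_mx_eq; [apply: dmx_family|apply: dmx_const].
Qed.

(** Blocks outside [s] are set to zero, so the partial products all lie in one space and the
    induction splits off one block at a time. *)
Lemma mu_partial (s : seq K) : uniq s ->
  mu (partial s) = \prod_(k <- s) mu [set A : matsp (m k) (n k) | P A].
Proof.
elim: s => [_|a s IH /= /andP[as_ us]].
  rewrite big_nil; apply: (@mu_point (famsp m n) _ (fun k => 0)); first exact: (ddef_partial [::]).
  move=> A; split=> [/forallP H|-> /=]; last by apply/forallP => k; rewrite eqxx.
  by apply: functional_extensionality_dep => k; apply/eqP; apply: (H k).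
rewrite big_cons -IH // -mu_prod; last 2 first.
- by apply: ddef_bool; apply: dP.
- exact: ddef_partial.
pose z (A : famsp m n) (k : K) : 'M[CC]_(m k, n k) := if k == a then 0 else A k.
pose f (A : famsp m n) : prodsp (matsp (m a) (n a)) (famsp m n) := (A a, z A).
pose g (x : prodsp (matsp (m a) (n a)) (famsp m n)) : famsp m n := dfwith x.2 x.1.
apply: (@mu_bijection _ _ _ _ f g).
- apply: dmap_pair; first by apply: dmap_mat; apply: dmx_family.
  apply: dmap_family => k; rewrite /z; case: eqP => _; first exact: dmx_const.
  exact: dmx_family.
- apply: dmap_family => k; rewrite /g; have [<-|ak] := eqVneq a k.
    by apply: (dmx_ext _ (@dmx_fst (famsp m n) (m a) (n a))) => x; rewrite dfwith_in.
  have dk := dmx_comp (@dmap_snd (matsp (m a) (n a)) (famsp m n)) (@dmx_family K m n k).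
  by apply: (dmx_ext _ dk) => x; rewrite dfwith_out.
- exact: ddef_partial.
- by apply: ddef_prod; [apply: ddef_bool; apply: dP|apply: ddef_partial].
split.
- move=> A /= /forallP H; split=> /=.
    by have := H a; rewrite inE eqxx.
  apply/forallP => k; have := H k; rewrite inE /z; case: eqP => [->|_] //=.
  by rewrite (negPf as_) eqxx.
- move=> [M A] /= [PM /forallP H]; apply/forallP => k; rewrite inE /g.
  have [<-|ak] := eqVneq a k; first by rewrite dfwith_in.
  by rewrite dfwith_out //; apply: H.
- move=> A /forallP H; apply: functional_extensionality_dep => k; rewrite /g /f /=.
  have [<-|ak] := eqVneq a k; first by rewrite dfwith_in.
  by rewrite dfwith_out // /z eq_sym (negPf ak).
- move=> [M A] /= [PM /forallP H]; rewrite /f /g dfwith_in; congr (_, _).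
  apply: functional_extensionality_dep => k; rewrite /z.
  have [->|ka] := eqVneq k a; last by rewrite dfwith_out // eq_sym.
  by have := H a; rewrite (negPf as_) => /eqP.
Qed.

Lemma mu_family : mu [set A : famsp m n | [forall k, P (A k)]] =
  \prod_k mu [set A : matsp (m k) (n k) | P A].
Proof.
rewrite -(mu_partial (index_enum_uniq K)); apply: mu_ext => A /=.
by split=> /forallP H; apply/forallP => k; have := H k; rewrite mem_index_enum.
Qed.

End Families.

Lemma mu_famsp (K : finType) (m n : K -> nat) :
  mu [set: famsp m n] = ell ^+ (\sum_k m k * n k).
Proof.
rewrite muT /= card_tagged sumnE big_map big_enum /=; congr (_ ^+ _).
by apply: eq_bigr => k _; rewrite card_prod !card_ord.
Qed.

(** * Nilpotent representations with socle frames *)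

Section Socle.
Variable Q : quiver.
Implicit Types d e f : dimvec Q.

Definition qsp d : cspace := famsp (fun a : arrow Q => d (src a)) (fun a => d (tgt a)).

Definition frames f d : cspace := famsp (f : vertex Q -> nat) d.

Definition arrow_basis d : finType := (arrow Q * 'I_#|basis_index d|)%type.

Definition arrows_mx d (B : qrep d) :
    'M[CC]_(#|basis_index d|, #|arrow_basis d|) :=
  \matrix_(p, q) big_mx B (enum_val q).1 p (enum_val q).2.

(* Its kernel is the common kernel, at the vertex i, of all arrows. *)
Definition socle_mx d (B : qrep d) i := (incl d i)^T *m arrows_mx B.

Lemma socle_mxP d (B : qrep d) i m (phi : 'M[CC]_(m, d i)) :
  phi *m socle_mx B i = 0 <-> forall a, phi *m (incl d i)^T *m big_mx B a = 0.
Proof.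
rewrite /socle_mx mulmxA; split=> [H a|H]; apply/matrixP => r c.
  have /matrixP/(_ r (enum_rank ((a, c) : arrow_basis d))) E := H.
  rewrite [LHS]mxE [RHS]mxE in E; rewrite [LHS]mxE [RHS]mxE; apply: etrans E.
  by apply: eq_bigr => p _; rewrite [arrows_mx B p _]mxE enum_rankK.
have /matrixP/(_ r (enum_val c).2) E := H (enum_val c).1.
rewrite [LHS]mxE [RHS]mxE in E; rewrite [LHS]mxE [RHS]mxE; apply: etrans E.
by apply: eq_bigr => p _; rewrite [arrows_mx B p _]mxE.
Qed.

Lemma frame_socleP f d (B : qrep d) (phi : mxfamily f d) :
  (forall i, phi i *m socle_mx B i = 0) <-> (forall a, phi (src a) *m B a = 0).
Proof.
split=> [H a|H i].
  have /socle_mxP/(_ a)/(congr1 (mulmx^~ (incl d (tgt a)))) := H (src a).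
  rewrite mul0mx /big_mx !mulmxA -(mulmxA (phi _)) inclTincl mulmx1.
  by rewrite -mulmxA inclTincl mulmx1.
apply/socle_mxP => a; rewrite /big_mx !mulmxA -(mulmxA (phi i)).
have [E|ne] := eqVneq i (src a); last by rewrite inclTincl0 // mulmx0 !mul0mx.
by subst i; rewrite inclTincl mulmx1 H mul0mx.
Qed.

(** Let k be least such that all words of length k vanish. If k > 0, the images of the words of
    length k - 1 lie in the socle; were it zero at every vertex, these words would vanish too. So k
    = 0, the identity is zero and the total dimension is 0. *)
Lemma socle_nonzero d (B : qrep d) :
  nilrep B -> (forall i, row_free (socle_mx B i)) -> d = 0.
Proof.
move=> nB freeB.
have ex : exists k, `[< nilpotent_at (big_mx B) k >].
  by have /nilrepP[k nk] := nB; exists k; apply/asboolP.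
case: (ex_minnP ex) => k /asboolP nk kmin.
suff E : (1%:M : 'M[CC]_#|basis_index d|) = 0.
  apply/ffunP => i; rewrite ffunE; apply/eqP; rewrite -leqn0 leqNgt; apply/negP => di.
  pose p := enum_rank (Tagged (fun i => 'I_(d i)) (Ordinal di)).
  have /matrixP/(_ p p)/eqP := E.
  by rewrite !mxE eqxx oner_eq0.
case: k nk kmin => [nk _|k nk kmin]; first exact: (nk [::]).
have /existsNP[s /not_implyP[sk /eqP sn0]] : ~ nilpotent_at (big_mx B) k.
  by move=> /asboolP/kmin; rewrite ltnn.
case/eqP: sn0; rewrite -[LHS]mulmx1 -sum_incl mulmx_sumr big1 // => i _.
suff W : word (big_mx B) s *m incl d i = 0 by rewrite mulmxA W mul0mx.
apply: (row_free_inj (freeB i)); rewrite mul0mx; apply/socle_mxP => a.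
have [E|ne] := eqVneq i (src a); last first.
  by rewrite /big_mx -!mulmxA (mulmxA (incl d i)^T) inclTincl0 // mul0mx !mulmx0.
subst i; rewrite -(nk (rcons s a)) ?size_rcons ?sk // word_rcons /big_mx -!mulmxA.
by rewrite (mulmxA (incl d (src a))^T) inclTincl mul1mx.
Qed.

Section Definable.
Variables (T : cspace) (d : dimvec Q) (B : T -> qrep d).
Hypothesis dB : forall a, dmx (fun x => B x a).

Lemma dmx_big a : dmx (fun x => big_mx (B x) a).
Proof.
by apply: dmx_mul; [apply: dmx_mul => //; apply: dmx_const|apply: dmx_const].
Qed.

Lemma dbool_nilrep : dbool (fun x => nilrep (B x)).
Proof.
apply: dbool_forall => s; apply: dbool_mx_eq; last exact: dmx_const.
elim: {s}(tval s) => [|a s IH]; first exact: dmx_const.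
by apply: dmx_mul => //; apply: dmx_big.
Qed.

Lemma dmx_socle i : dmx (fun x => socle_mx (B x) i).
Proof.
apply: dmx_mul; first exact: dmx_const.
move=> p q; apply: (dfun_ext _ (dmx_big (enum_val q).1 p (enum_val q).2)) => x.
by rewrite [RHS]mxE.
Qed.

End Definable.

Definition nil_class d : K0 := mu [set B : qsp d | nilrep B].

(** Strata are indexed by the rank of [socle_mx], so the socle has dimension d i - r i at i. *)
Definition nil_stratum d (r : vertex Q -> nat) : K0 :=
  mu [set B : qsp d | nilrep B && [forall i, \rank (socle_mx B i) == r i]].

Definition framed f d : set (prodsp (qsp d) (frames f d)) :=
  [set x | [&& nilrep x.1, [forall i, row_free (x.2 i)]
             & [forall i, x.2 i *m socle_mx x.1 i == 0]]].

Lemma dmx_qsp d a : dmx (T := qsp d) (fun B => B a).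
Proof. exact: dmx_family. Qed.

Lemma dmx_framed1 f d a : dmx (T := prodsp (qsp d) (frames f d)) (fun x => x.1 a).
Proof. exact: (dmx_comp (@dmap_fst _ _) (@dmx_qsp d a)). Qed.

Lemma dmx_framed2 f d i : dmx (T := prodsp (qsp d) (frames f d)) (fun x => x.2 i).
Proof. exact: (dmx_comp (@dmap_snd _ _) (@dmx_family _ _ _ i)). Qed.

Lemma ddef_framed f d : ddef (@framed f d).
Proof.
apply: ddef_bool; apply: dbool_and; first exact: dbool_nilrep (@dmx_framed1 f d).
apply: dbool_and; apply: dbool_forall => i.
  by apply: dbool_row_free; apply: dmx_framed2.
apply: dbool_mx_eq; last exact: dmx_const.
by apply: dmx_mul; [apply: dmx_framed2|apply: dmx_socle; apply: dmx_framed1].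
Qed.

Lemma ddef_stratum d (r : vertex Q -> nat) :
  ddef [set B : qsp d | nilrep B && [forall i, \rank (socle_mx B i) == r i]].
Proof.
apply: ddef_bool; apply: dbool_and; first exact: dbool_nilrep (@dmx_qsp d).
by apply: dbool_forall => i; apply: dbool_rank; apply: dmx_socle; apply: dmx_qsp.
Qed.

(** On the stratum [socle_mx] is [col_ebase] times [pid_mx] times [row_ebase]. Multiplying the
    frames by [col_ebase] carries the varying kernel to the fixed kernel of [pid_mx], and the set
    becomes a product. *)
Lemma framed_stratum f d (r : vertex Q -> nat) :
  mu (@framed f d `&` [set x | [forall i, \rank (socle_mx x.1 i) == r i]]) =
  nil_stratum d r * \prod_i \prod_(k < f i) (ell ^+ (d i - r i) - ell ^+ k).
Proof.
pose p := #|arrow_basis d|.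
(* A rank exceeding the size of the matrix makes the stratum empty, and both sides are zero. *)
have [/forallP rle|nle] := boolP [forall i, (r i <= d i)%N && (r i <= p)%N]; last first.
  have [i ri] : exists i, ~~ ((r i <= d i)%N && (r i <= p)%N) by apply/existsP; rewrite -negb_forall.
  rewrite negb_and in ri; rewrite /nil_stratum.
  have no (B : qrep d) : [forall i, \rank (socle_mx B i) == r i] -> False.
    move=> /forallP/(_ i)/eqP E.
    by case/orP: ri => /negP; apply; rewrite -E ?rank_leq_row ?rank_leq_col.
  rewrite [X in X * _](_ : _ = 0) ?mul0r; last first.
    by rewrite -[RHS](@mu0 (qsp d)); apply: mu_ext => B; split=> //= /andP[_ /no].
  by rewrite -[RHS](@mu0 (prodsp (qsp d) (frames f d))); apply: mu_ext => B; split=> // -[_ /no].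
pose P i (A : 'M[CC]_(f i, d i)) := (A *m (pid_mx (r i) : 'M_(d i, p)) == 0) && row_free A.
have dP i : dbool (T := matsp (f i) (d i)) (@P i).
  apply: dbool_and; last by apply: dbool_row_free; apply: dmx_id.
  apply: dbool_mx_eq; last exact: dmx_const.
  by apply: dmx_mul; [apply: dmx_id|apply: dmx_const].
have -> : \prod_i \prod_(k < f i) (ell ^+ (d i - r i) - ell ^+ k) =
    mu [set A : frames f d | [forall i, @P i (A i)]].
  rewrite (mu_family dP); apply: eq_bigr => i _; rewrite mu_row_free_pid //.
    by have /andP[] := rle i.
  by have /andP[] := rle i.
have dPf : ddef [set A : frames f d | [forall i, @P i (A i)]].
  apply: ddef_bool; apply: dbool_forall => i.
  exact: (@dbool_family _ _ _ _ dP (frames f d) (fun A => A) i (@dmx_family _ _ _)).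
rewrite -mu_prod //; last exact: ddef_stratum.
have d1 := @dmx_framed1 f d; have d2 := @dmx_framed2 f d.
pose F (x : prodsp (qsp d) (frames f d)) : prodsp (qsp d) (frames f d) :=
  (x.1, fun i => x.2 i *m col_ebase (socle_mx x.1 i)).
pose G (x : prodsp (qsp d) (frames f d)) : prodsp (qsp d) (frames f d) :=
  (x.1, fun i => x.2 i *m invmx (col_ebase (socle_mx x.1 i))).
have U (B : qrep d) i : col_ebase (socle_mx B i) \in unitmx by apply: col_ebase_unit.
have kerP (B : qrep d) i m (phi : 'M_(m, d i)) : \rank (socle_mx B i) = r i ->
    (phi *m socle_mx B i == 0) =
    (phi *m col_ebase (socle_mx B i) *m (pid_mx (r i) : 'M_(d i, p)) == 0).
  move=> rB; rewrite -{1}(mulmx_ebase (socle_mx B i)) rB !mulmxA.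
  apply/eqP/eqP => [|->]; last by rewrite mul0mx.
  by move=> /(congr1 (mulmx^~ (invmx (row_ebase (socle_mx B i))))); rewrite mulmxK ?row_ebase_unit // mul0mx.
have freeM (B : qrep d) i (phi : 'M_(f i, d i)) M : M \in unitmx -> row_free (phi *m M) = row_free phi.
  by move=> uM; rewrite /row_free mxrankMfree // row_free_unit.
apply: (@mu_bijection _ _ _ _ F G).
- apply: dmap_pair; first by apply: dmap_family.
  by apply: dmap_family => i; apply: dmx_mul => //; apply/dmx_col_ebase/dmx_socle.
- apply: dmap_pair; first by apply: dmap_family.
  by apply: dmap_family => i; apply: dmx_mul => //; apply/dmx_invmx/dmx_col_ebase/dmx_socle.
- apply: ddefI; first exact: ddef_framed.
  by apply: ddef_bool; apply: dbool_forall => i; apply: dbool_rank; apply: dmx_socle.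
- by apply: ddef_prod => //; apply: ddef_stratum.
split.
- move=> [B phi] /= [/and3P[/= nB /forallP fphi /forallP kphi] rB].
  split=> /=; first by rewrite nB.
  apply/forallP => i; rewrite /P -kerP ?(eqP (forallP rB i)) // kphi /=.
  by rewrite freeM.
- move=> [B psi] /= [/andP[/= nB rB] /forallP Ppsi]; split=> //=; apply/and3P; split=> //=.
    by apply/forallP => i; have /andP[_] := Ppsi i; rewrite freeM // unitmx_inv.
  apply/forallP => i; rewrite kerP ?(eqP (forallP rB i)) // mulmxKV //.
  by have /andP[] := Ppsi i.
- move=> [B phi] _; rewrite /F /G /=; congr (_, _).
  by apply: functional_extensionality_dep => i; rewrite mulmxK.
- move=> [B phi] _; rewrite /F /G /=; congr (_, _).
  by apply: functional_extensionality_dep => i; rewrite mulmxKV.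
Qed.

Lemma framed_socle f d : mu (@framed f d) =
  \sum_(r : {ffun vertex Q -> 'I_(\sum_i d i).+1})
    nil_stratum d (fun i => r i : nat) *
    \prod_i \prod_(k < f i) (ell ^+ (d i - r i) - ell ^+ k).
Proof.
(* The bound by the total dimension is common to all vertices, so the ranks form a function with a
   fixed finite codomain. *)
pose c (x : prodsp (qsp d) (frames f d)) : {ffun vertex Q -> 'I_(\sum_i d i).+1} :=
  [ffun i => inord (\rank (socle_mx x.1 i))].
have cE x r : (c x == r) = [forall i, \rank (socle_mx x.1 i) == r i].
  have rk i : (\rank (socle_mx x.1 i) < (\sum_i d i).+1)%N.
    rewrite ltnS (leq_trans (rank_leq_row _)) //.
    by rewrite (bigD1 i) //= leq_addr.
  apply/eqP/forallP => [<- i|H]; first by rewrite ffunE inordK.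
  by apply/ffunP => i; apply: val_inj; rewrite ffunE /= inordK // (eqP (H i)).
rewrite (@mu_strata _ _ c); last 2 first.
- move=> r; apply: (dbool_ext (fun x => esym (cE x r))).
  by apply: dbool_forall => i; apply: dbool_rank; apply: dmx_socle; apply: dmx_framed1.
- exact: ddef_framed.
apply: eq_bigr => r _; rewrite -(framed_stratum f d (fun i => r i : nat)); apply: mu_ext => x.
by rewrite /= cE.
Qed.

End Socle.

(** * Moving the frames to the first coordinates *)

Section Frames.
Variable Q : quiver.
Implicit Types d e f : dimvec Q.

Local Notation first f d i := (pid_mx (f i) : 'M[CC]_(f i, d i)).

Definition killing f d : set (qsp d) :=
  [set C | nilrep C && [forall a, first f d (src a) *m (C a : 'M[CC]_(d (src a), d (tgt a))) == 0]].

Lemma ddef_killing f d : ddef (@killing f d).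
Proof.
apply: ddef_bool; apply: dbool_and; first exact: dbool_nilrep (@dmx_qsp _ d).
apply: dbool_forall => a; apply: dbool_mx_eq; last exact: dmx_const.
by apply: dmx_mul; [apply: dmx_const|apply: dmx_qsp].
Qed.

Definition frame_count f d : K0 := \prod_i \prod_(k < f i) (ell ^+ d i - ell ^+ k).

Lemma mu_frames f d : mu [set A : frames f d | [forall i, row_free (A i)]] = frame_count f d.
Proof.
rewrite (mu_family (P := fun i (A : 'M[CC]_(f i, d i)) => row_free A)).
  by apply: eq_bigr => i _; rewrite mu_row_free.
by move=> i; apply: dbool_row_free; apply: dmx_id.
Qed.

(** A frame is [col_ebase] times [pid_mx] times [row_ebase]. The last factor is a piecewise rational
    change of basis carrying the span of the frame to that of the first coordinates; the first one
    is invertible and does not affect what is killed. *)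
Lemma framed_frames f d : mu (@framed Q f d) = frame_count f d * mu (@killing f d).
Proof.
have dF : ddef [set A : frames f d | [forall i, row_free (A i)]].
  by apply: ddef_bool; apply: dbool_forall => i; apply: dbool_row_free; apply: dmx_family.
rewrite -mu_frames -mu_prod //; last exact: ddef_killing.
pose u (phi : frames f d) i : 'M[CC]_(d i) := row_ebase (phi i).
have uU phi i : u phi i \in unitmx by apply: row_ebase_unit.
pose F (x : prodsp (qsp d) (frames f d)) : prodsp (frames f d) (qsp d) :=
  (x.2, fun a => u x.2 (src a) *m x.1 a *m invmx (u x.2 (tgt a))).
pose G (x : prodsp (frames f d) (qsp d)) : prodsp (qsp d) (frames f d) :=
  (fun a => invmx (u x.1 (src a)) *m x.2 a *m u x.1 (tgt a), x.1).
have d1 := @dmx_framed1 Q f d; have d2 := @dmx_framed2 Q f d.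
have e1 i : dmx (T := prodsp (frames f d) (qsp d)) (fun x => x.1 i).
  exact: (dmx_comp (@dmap_fst _ _) (@dmx_family _ _ _ i)).
have e2 a : dmx (T := prodsp (frames f d) (qsp d)) (fun x => x.2 a).
  exact: (dmx_comp (@dmap_snd _ _) (@dmx_qsp _ d a)).
have killE (phi : frames f d) i m (M : 'M[CC]_(d i, m)) : row_free (phi i) ->
    (phi i *m M = 0) <-> (first f d i *m (u phi i *m M) = 0).
  move=> /eqP rk; rewrite -{1}(mulmx_ebase (phi i)) rk -!mulmxA; split=> [|->].
    move=> /(congr1 (mulmx (invmx (col_ebase (phi i))))).
    by rewrite mulKmx ?col_ebase_unit // mulmx0.
  by rewrite mulmx0.
apply: (@mu_bijection _ _ _ _ F G).
- apply: dmap_pair; first by apply: dmap_family.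
  apply: dmap_family => a; apply: dmx_mul; last by apply/dmx_invmx/dmx_row_ebase.
  by apply: dmx_mul => //; apply: dmx_row_ebase.
- apply: dmap_pair; last by apply: dmap_family.
  apply: dmap_family => a; apply: dmx_mul; last by apply: dmx_row_ebase.
  by apply: dmx_mul => //; apply/dmx_invmx/dmx_row_ebase.
- exact: ddef_framed.
- by apply: ddef_prod => //; apply: ddef_killing.
split.
- move=> [B phi] /and3P[/= nB fphi kphi]; split=> //; apply/andP; split=> /=.
    apply: (isomorphic_nilrep (h := u phi) (k := fun i => invmx (u phi i))) nB.
      by move=> i; rewrite mulmxV.
    by move=> a; rewrite /= mulmxKV.
  have /frame_socleP kB : forall i, phi i *m socle_mx B i = 0.
    by move=> i; apply/eqP; exact: (forallP kphi).
  apply/forallP => a; apply/eqP; rewrite -(mulmxA (u phi _)); apply/killE.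
    exact: (forallP fphi).
  by rewrite mulmxA kB mul0mx.
- move=> [phi C] [/= fphi /andP[nC /forallP kC]]; apply/and3P; split; [|exact: fphi|].
    apply: (isomorphic_nilrep (h := fun i => invmx (u phi i)) (k := u phi)) nC.
      by move=> i; rewrite mulVmx.
    by move=> a; rewrite /= mulmxK.
  apply/forallP => i; apply/eqP; move: i; apply/frame_socleP => a.
  apply/killE; first exact: (forallP fphi).
  by rewrite /G /= -!mulmxA mulKVmx // mulmxA (eqP (kC a)) mul0mx.
- move=> [B phi] _; rewrite /F /G /=; congr (_, _).
  apply: functional_extensionality_dep => a.
  by rewrite -!mulmxA mulKmx // mulVmx // mulmx1.
- move=> [phi C] _; rewrite /F /G /=; congr (_, _).
  apply: functional_extensionality_dep => a.
  by rewrite -!mulmxA mulKVmx // mulmxV // mulmx1.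
Qed.

Section Quotient.
Variables f e d : dimvec Q.
Hypothesis fed : forall i, (f i + e i)%N = d i.

Let E i : 'M[CC]_(e i, d i) := lastmx CC (f i) (e i) (d i).
Let D i : 'M[CC]_(f i, d i) := first f d i.

(** W is the quotient of C by the span of the first coordinates. A word that vanishes on the
    quotient has its image in that span, which one more arrow kills. *)
Lemma quotient_nilrep (C : qrep d) (W : qrep e) :
  (forall a, D (src a) *m C a = 0) -> (forall a, W a = E (src a) *m C a *m (E (tgt a))^T) ->
  nilrep C = nilrep W.
Proof.
move=> DC WE; pose h i := (E i)^T.
have Eh i : E i *m h i = 1%:M by apply: lastmxK.
have hEC a : h (src a) *m E (src a) *m C a = C a.
  rewrite -[RHS]mul1mx -(first_last_sum CC (fed (src a))) mulmxDl.
  by rewrite -(mulmxA (D (src a))^T) DC mulmx0 add0r.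
have hCW : intertwines h C W.
  by move=> a; rewrite WE !mulmxA hEC.
apply/nilrepP/nilrepP => -[k nk]; last first.
  exists k.+1 => s; elim/last_ind: s => // s a _; rewrite size_rcons => -[sk].
  have -> : word (big_mx C) (rcons s a) =
      word (big_mx C) s *m glue h *m glue E *m big_mx C a.
    rewrite word_rcons -!mulmxA; congr (_ *m _).
    rewrite (mulmxA (glue h)) glueM /big_mx !mulmxA glue_incl.
    by rewrite -[in RHS](mulmxA (incl d (src a))) hEC.
  by rewrite (intertwines_word s hCW) nk // mulmx0 !mul0mx.
exists k => s sk; rewrite -[LHS]mul1mx -(glue1 Eh) -glueM -mulmxA.
by rewrite -(intertwines_word s hCW) nk // mul0mx mulmx0.
Qed.

(** With the coordinates cut into the first f and the last e, the matrix of an arrow has zero upper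
    rows and lower rows (H, W): H is arbitrary, and C is nilpotent exactly when W is. *)
Lemma mu_killing : mu (@killing f d) =
  nil_class e * ell ^+ (\sum_a e (src a) * f (tgt a)).
Proof.
rewrite -(mu_famsp (fun a : arrow Q => e (src a)) (fun a => f (tgt a))).
have dN : ddef [set B : qsp e | nilrep B].
  by apply: ddef_bool; apply: dbool_nilrep; apply: dmx_qsp.
rewrite -mu_prod //; last exact: ddefT.
pose U := famsp (fun a : arrow Q => e (src a)) (fun a => f (tgt a)).
pose F (C : qsp d) : prodsp (qsp e) U :=
  (fun a => E (src a) *m C a *m (E (tgt a))^T, fun a => E (src a) *m C a *m (D (tgt a))^T).
pose G (x : prodsp (qsp e) U) : qsp d :=
  fun a => (E (src a))^T *m (x.2 a *m D (tgt a) + x.1 a *m E (tgt a)).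
have e1 a : dmx (T := prodsp (qsp e) U) (fun x => x.1 a).
  exact: (dmx_comp (@dmap_fst _ _) (@dmx_qsp _ e a)).
have e2 a : dmx (T := prodsp (qsp e) U) (fun x => x.2 a).
  exact: (dmx_comp (@dmap_snd _ _) (@dmx_family _ _ _ a)).
have EE i : E i *m (E i)^T = 1%:M by apply: lastmxK.
have ED i : E i *m (D i)^T = 0 by apply: last_firstmx.
have DE i : D i *m (E i)^T = 0 by apply: first_lastmx.
have DD i : D i *m (D i)^T = 1%:M by apply: firstmxK.
have sum1 i : (D i)^T *m D i + (E i)^T *m E i = 1%:M by apply: first_last_sum.
have FG x : F (G x) = x.
  case: x => W H; rewrite /F /G /=; congr (_, _); apply: functional_extensionality_dep => a.
    by rewrite mulmxA EE mul1mx mulmxDl -!mulmxA DE EE mulmx0 add0r mulmx1.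
  by rewrite mulmxA EE mul1mx mulmxDl -!mulmxA DD ED mulmx0 addr0 mulmx1.
have DG x a : D (src a) *m G x a = 0 by rewrite mulmxA DE mul0mx.
apply: (@mu_bijection _ _ _ _ F G).
- apply: dmap_pair; apply: dmap_family => a; apply: dmx_mul; try exact: dmx_const.
    by apply: dmx_mul; [apply: dmx_const|apply: dmx_qsp].
  by apply: dmx_mul; [apply: dmx_const|apply: dmx_qsp].
- apply: dmap_family => a; apply: dmx_mul; first exact: dmx_const.
  by apply: dmx_add; apply: dmx_mul => //; apply: dmx_const.
- exact: ddef_killing.
- by apply: ddef_prod => //; apply: ddefT.
split.
- move=> C /andP[nC /forallP kC]; split=> //=; rewrite -(quotient_nilrep (C := C)) //.
  by move=> a; apply/eqP; apply: kC.
- move=> x [/= nW _]; apply/andP; split; last by apply/forallP => a; apply/eqP; apply: DG.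
  rewrite (quotient_nilrep (W := x.1)) // => a.
  by have := congr1 (fun y => y.1 a) (FG x).
- move=> C /andP[nC /forallP kC]; apply: functional_extensionality_dep => a.
  rewrite /F /G /= -!mulmxA -!mulmxDr sum1 mulmx1 mulmxA.
  rewrite -[RHS]mul1mx -(sum1 (src a)) mulmxDl -(mulmxA (D _)^T).
  by rewrite (eqP (kC a)) mulmx0 add0r.
- by move=> x _; apply: FG.
Qed.

End Quotient.

(** * Classes of the nullcone and of the base change group *)

Lemma closed_basic n (Z : set (affine_space n)) : zclosed Z -> basic Z.
Proof.
move=> [S ZS]; rewrite (_ : Z = zeros S); first exact: basic_zeros.
apply/seteqP; split=> x.
  move=> Zx p Sp; apply/eqP/negPn/negP => px.
  have : (~` Z) x by rewrite ZS; exists p.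
  exact.
move=> zx; apply: contrapT; rewrite -[~ Z x]/((~` Z) x) ZS => -[p Sp].
by rewrite -[evalp p _]/(pev p x) zx // eqxx.
Qed.

Lemma nullcone_class d : K0_class (@nullcone Q d) = nil_class d.
Proof.
have dN : ddef (T := repsp d) [set A | nilrep (fun a => (A a)^T)].
  apply: ddef_bool; apply: dbool_nilrep => a i j.
  by apply: (dfun_ext _ (@dmx_family _ _ _ a j i)) => A; rewrite mxE.
transitivity (mu [set A : repsp d | nilrep (fun a => (A a)^T)]).
  have E : @nullcone_set Q d = @dec (repsp d) @^-1` [set A | nilrep (fun a => (A a)^T)].
    exact: nullconeE.
  rewrite /mu -E mes_basic //; last exact: closed_basic (@nullcone_closed Q d).
  by rewrite E.
apply: (@mu_bijection _ _ _ _ (fun (A : repsp d) => (fun a => (A a)^T) : qsp d)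
   (fun (B : qsp d) => (fun a => (B a)^T) : repsp d)).
- apply: dmap_family => a i j.
  by apply: (dfun_ext _ (@dmx_family _ _ _ a j i)) => A; rewrite mxE.
- apply: dmap_family => a i j.
  by apply: (dfun_ext _ (@dmx_family _ _ _ a j i)) => A; rewrite mxE.
- exact: dN.
- by apply: ddef_bool; apply: dbool_nilrep; apply: dmx_qsp.
- have trK (B : qrep d) : (fun a => (B a)^T^T) = B.
    by apply: functional_extensionality_dep => a; rewrite trmxK.
  split=> [A nA|B nB|A _|B _]; [exact: nA| | |exact: trK].
    by rewrite /= trK.
  by apply: functional_extensionality_dep => a; rewrite trmxK.
Qed.

Lemma gl_basic d : basic [set g : affine_space #|gl_entry d| | forall i, gl_mx g i \in unitmx].
Proof.
have [p pE] : ispoly (fun g : affine_space #|gl_entry d| => \prod_i \det (gl_mx g i)).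
  apply: ispoly_prod => i; apply: ispoly_sum => s; apply: ispoly_mul; first exact: ispoly_const.
  apply: ispoly_prod => r.
  have [q qE] := ispoly_coord (enum_rank
    (Tagged (fun i => 'I_(d i) * 'I_(d i))%type (r, s r) : gl_entry d)).
  by exists q => g; rewrite qE mxE.
rewrite (_ : [set g | _] = ~` pzero p); first exact: basic_nonzero.
apply/seteqP; split=> g; rewrite /pzero /= pE => /= H.
  apply/eqP; rewrite prodf_seq_neq0; apply/allP => i _ /=.
  by have := H i; rewrite unitmxE unitfE.
move=> i; rewrite unitmxE unitfE; apply/eqP => d0; apply: H.
by rewrite (bigD1 i) //= d0 mul0r.
Qed.

Lemma gl_variety d : is_variety (gl_group d).
Proof. exact: basic_is_variety (gl_basic d). Qed.

Lemma gl_class d : K0_class (gl_group d) = frame_count d d.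
Proof.
rewrite -mu_frames.
have E : [set g : affine_space #|gl_entry d| | forall i, gl_mx g i \in unitmx] =
    @dec (glsp d) @^-1` [set A | [forall i, row_free (A i)]].
  apply/seteqP; split=> g /= H; first by apply/forallP => i; rewrite row_free_unit; apply: H.
  by move=> i; rewrite -row_free_unit; apply: (forallP H).
have dE : ddef [set A : frames d d | [forall i, row_free (A i)]].
  by apply: ddef_bool; apply: dbool_forall => i; apply: dbool_row_free; apply: dmx_family.
rewrite /mu -[_ @^-1` _]E mes_basic //; last exact: gl_basic.
by rewrite E.
Qed.

End Frames.

(** * The recursion *)

Definition loc (x : K0) : MM := pclass (@loc_rel K0 K0_denominators) (Gen (inl x)).

Lemma motiveE X : motive X = loc (K0_class X). Proof. by []. Qed.

Lemma locD x y : loc (x + y) = loc x + loc y.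
Proof.
rewrite -[RHS]/(padd (loc x) (loc y)) pclass_add; apply/pclass_eqP/Rrel.
exact: loc_add.
Qed.

Lemma locM x y : loc (x * y) = loc x * loc y.
Proof.
rewrite -[RHS]/(pmul (loc x) (loc y)) pclass_mul; apply/pclass_eqP/Rrel.
exact: loc_mul.
Qed.

Lemma loc1 : loc 1 = 1.
Proof. by apply/pclass_eqP/Rrel; exact: loc_one. Qed.

Lemma loc0 : loc 0 = 0.
Proof. by apply: (addrI (loc 0)); rewrite -locD !addr0. Qed.

Lemma locB x y : loc (x - y) = loc x - loc y.
Proof. by apply/eqP; rewrite eq_sym subr_eq -locD subrK. Qed.

Lemma locX x n : loc (x ^+ n) = loc x ^+ n.
Proof. by elim: n => [|n IH]; rewrite ?loc1 // !exprS locM IH. Qed.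

Lemma loc_sum I (r : seq I) (P : pred I) (F : I -> K0) :
  loc (\sum_(i <- r | P i) F i) = \sum_(i <- r | P i) loc (F i).
Proof. exact: (big_morph loc locD loc0). Qed.

Lemma loc_prod I (r : seq I) (P : pred I) (F : I -> K0) :
  loc (\prod_(i <- r | P i) F i) = \prod_(i <- r | P i) loc (F i).
Proof. exact: (big_morph loc locM loc1). Qed.

Lemma invP x : invertible x -> x * inv x = 1.
Proof. by move=> [y xy]; rewrite /inv; case: xgetP => [z _ /= //|/(_ y)/=]. Qed.

Lemma inv_unique x y : x * y = 1 -> inv x = y.
Proof.
move=> xy; have xi : x * inv x = 1 by apply: invP; exists y.
by rewrite -[inv x]mulr1 -xy mulrA [inv x * x]mulrC xi mul1r.
Qed.

Lemma invertibleM x y : invertible x -> invertible y -> invertible (x * y).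
Proof. by move=> [x' xx'] [y' yy']; exists (x' * y'); rewrite mulrACA xx' yy' mulr1. Qed.

Lemma invertible1 : invertible 1. Proof. by exists 1; rewrite mulr1. Qed.

Lemma invertibleX x n : invertible x -> invertible (x ^+ n).
Proof.
move=> ix; elim: n => [|n IH]; first exact: invertible1.
by rewrite exprS; apply: invertibleM.
Qed.

Lemma invertible_prod I (r : seq I) (P : pred I) (F : I -> MM) :
  (forall i, P i -> invertible (F i)) -> invertible (\prod_(i <- r | P i) F i).
Proof.
move=> iF; elim/big_ind: _ => //; [exact: invertible1|exact: invertibleM].
Qed.

Lemma inv_prod (I : finType) (F : I -> MM) : (forall i, invertible (F i)) ->
  inv (\prod_i F i) = \prod_i inv (F i).
Proof.
move=> iF; apply: inv_unique; rewrite -big_split big1 //= => i _; exact: invP.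
Qed.

Lemma invertible_cancel x y z : invertible x -> x * y = x * z -> y = z.
Proof.
move=> [x' xx'] E; rewrite -[y]mul1r -[z]mul1r -xx' [x * x']mulrC -!mulrA.
by rewrite E.
Qed.

Lemma invertible_denominator s : K0_denominators s -> invertible (loc s).
Proof.
move=> Ds; exists (pclass _ (Gen (inr (exist _ s Ds)))).
rewrite -[LHS]/(pmul (loc s) _) pclass_mul; apply/pclass_eqP/Rrel.
exact: (loc_inv (exist _ s Ds)).
Qed.

Lemma invertible_LL : invertible LL.
Proof. by apply: invertible_denominator; left. Qed.

Lemma invertible_1subLL i : (0 < i)%N -> invertible (1 - LL ^+ i).
Proof.
move=> i0; rewrite -loc1 -locX -locB; apply: invertible_denominator.
by right; exists i.
Qed.

Lemma invertible_qfact n : invertible (qfact LL n).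
Proof.
rewrite /qfact big_nat_cond; apply: invertible_prod => k /andP[/andP[k0 _] _].
exact: invertible_1subLL.
Qed.

Lemma invertibleN x : invertible x -> invertible (- x).
Proof. by move=> [y xy]; exists (- y); rewrite mulrNN. Qed.

(** * Classes of frames and the q-binomial theorem *)

Definition gauss_count m n : MM := \prod_(k < m) (LL ^+ n - LL ^+ k).

Lemma invertible_gauss_count n : invertible (gauss_count n n).
Proof.
apply: invertible_prod => k _.
have -> : LL ^+ n = LL ^+ (n - k) * LL ^+ k by rewrite -exprD subnK // ltnW.
rewrite -[X in _ - X]mul1r -mulrBl.
apply: invertibleM; last exact: invertibleX invertible_LL.
by rewrite -opprB; apply/invertibleN/invertible_1subLL; rewrite subn_gt0.
Qed.

(** Completing an injective f-tuple to a basis: the choices modulo its span form GL_e, and the lifts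
    contribute L^(f e). *)
Lemma gauss_count_split f e :
  gauss_count (f + e) (f + e) = gauss_count f (f + e) * LL ^+ (f * e) * gauss_count e e.
Proof.
rewrite /gauss_count big_split_ord /= -mulrA; congr (_ * _).
rewrite exprM -[e in X in _ = X * _]card_ord -prodr_const -big_split /=.
by apply: eq_bigr => k _; rewrite mulrBr -!exprD.
Qed.

(** Clears an exponent that is a difference of naturals, the shape of minus the Euler form. *)
Lemma zpow_sub x a b : invertible x -> zpow x (b%:Z - a%:Z) * x ^+ a = x ^+ b.
Proof.
move=> ix; have [ab|/ltnW ba] := leqP a b.
  by rewrite subzn //= -exprD subnK.
rewrite -opprB subzn //; case E: (a - b)%N => [|k].
  by rewrite oppr0 mul1r; congr (_ ^+ _); apply/eqP; rewrite eqn_leq ba -subn_eq0 E.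
have aE : a = (k.+1 + b)%N by rewrite -E subnK.
rewrite -NegzE /= {1}aE exprD mulrA -exprMn [inv x * x]mulrC invP //.
by rewrite expr1n mul1r.
Qed.

(** A finite q-binomial identity in a free variable x. In the induction step the common product is
    multiplied by (1 - L^(n+1)) + (x - 1) = x - L^(n+1). *)
Lemma gauss_sum x n :
  (\sum_(j < n.+1) inv (qfact LL j) * \prod_(k < j) (x - LL ^+ k)) * qfact LL n =
  \prod_(1 <= k < n.+1) (x - LL ^+ k).
Proof.
elim: n => [|n IH].
  rewrite big_ord1 big_ord0 /qfact !big_geq // !mulr1.
  by apply: inv_unique; rewrite mulr1.
have qS : qfact LL n.+1 = qfact LL n * (1 - LL ^+ n.+1) by rewrite /qfact big_nat_recr.
have P1 : \prod_(k < n.+1) (x - LL ^+ k) = (x - 1) * \prod_(1 <= k < n.+1) (x - LL ^+ k).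
  by rewrite -(big_mkord xpredT (fun k => x - LL ^+ k)) big_ltn // expr0.
rewrite big_ord_recr /= P1 mulrDl mulrAC [X in _ + X * _]mulrC invP; last exact: invertible_qfact.
rewrite qS mulrA IH mul1r [RHS]big_nat_recr //=.
rewrite [(x - 1) * _]mulrC -mulrDr; congr (_ * _).
by rewrite addrC addrA subrK.
Qed.

(** At x = L^s the right side of [gauss_sum] contains the zero factor k = s. The terms j > s vanish
    as well, so the sum may run up to any n >= s; below, n is d i and s the socle dimension at i. *)
Lemma gauss_sum0 n s : (0 < s <= n)%N ->
  \sum_(j < n.+1) inv (qfact LL j) * gauss_count j s = 0.
Proof.
move=> /andP[s0 sn]; apply: (invertible_cancel (invertible_qfact n)).
rewrite mulr0 mulrC gauss_sum (bigD1_seq s) ?iota_uniq //=.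
  by rewrite subrr mul0r.
by rewrite mem_index_iota s0 ltnS.
Qed.

Section Recursion.
Variable Q : quiver.
Implicit Types d e f : dimvec Q.

(** Distributivity of product over sum. It is available for functions with one codomain, hence the
    passage from the dependent type [below d] to functions with the common bound M. *)
Lemma sum_below d (F : forall i : vertex Q, nat -> MM) :
  \sum_(e : below d) \prod_i F i (e i) = \prod_i \sum_(j < (d i).+1) F i j.
Proof.
pose M := (\sum_i d i).+1.
have dM i : (d i < M)%N by rewrite ltnS (bigD1 i) //= leq_addr.
have -> : \prod_i \sum_(j < (d i).+1) F i j = \prod_i \sum_(j < M | (j < (d i).+1)%N) F i j.
  by apply: eq_bigr => i _; rewrite (big_ord_widen _ (F i) (dM i)).
rewrite (bigA_distr_big_dep (fun i (j : 'I_M) => j < (d i).+1)%N (fun i j => F i j)).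
pose h (g : {ffun vertex Q -> 'I_M}) : below d := [ffun i => inord (g i)].
pose h' (e : below d) : {ffun vertex Q -> 'I_M} := [ffun i => inord (e i)].
have eM (e : below d) i : (e i < M)%N by apply: leq_trans (dM i); rewrite ltnS -ltnS ltn_ord.
rewrite (reindex_onto h h') /=; last first.
  by move=> e _; apply/ffunP => i; apply: val_inj; rewrite !ffunE /= inordK ?inordK.
apply: eq_big => [g|g /eqP E].
  apply/eqP/familyP => [<- i|H].
    by rewrite ffunE unfold_in inordK ?ltn_ord.
  apply/ffunP => i; apply: val_inj; have := H i; rewrite unfold_in => gi.
  by rewrite !ffunE /= (inordK gi) inordK.
apply: eq_bigr => i _; congr (F i _).
by have := congr1 (fun k : {ffun vertex Q -> 'I_M} => val (k i)) E; rewrite /= ffunE inordK.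
Qed.

Lemma gl_motive d : motive (gl_group d) = \prod_i gauss_count (d i) (d i).
Proof.
rewrite motiveE gl_class loc_prod; apply: eq_bigr => i _; rewrite loc_prod.
by apply: eq_bigr => k _; rewrite locB !locX.
Qed.

Lemma gl_invertible d : invertible (motive (gl_group d)).
Proof. by rewrite gl_motive; apply: invertible_prod => i _; exact: invertible_gauss_count. Qed.

Lemma loc_frame_count f d : loc (frame_count f d) = \prod_i gauss_count (f i) (d i).
Proof.
rewrite loc_prod; apply: eq_bigr => i _; rewrite loc_prod.
by apply: eq_bigr => k _; rewrite locB !locX.
Qed.

Lemma framed_motive f e d : (forall i, (f i + e i)%N = d i) ->
  loc (mu (@framed Q f d)) = \prod_i gauss_count (f i) (d i) *
    (motive (nullcone e) * LL ^+ (\sum_a e (src a) * f (tgt a))).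
Proof.
move=> fed; rewrite framed_frames (mu_killing fed) !locM loc_frame_count.
by rewrite motiveE nullcone_class locX.
Qed.

(** Each stratum contributes zero: if the socle is trivial at every vertex the stratum is empty,
    since d != 0; otherwise the sum over e factors over the vertices, and the factor at a vertex
    where the socle is nonzero vanishes by [gauss_sum0]. *)
Lemma framed_motive_sum d : d <> 0 ->
  \sum_(e : below d) inv (qfactd LL (subdim d (dim_of e))) *
    loc (mu (@framed Q (subdim d (dim_of e)) d)) = 0.
Proof.
move=> d0; under eq_bigr do rewrite framed_socle loc_sum mulr_sumr.
rewrite exchange_big big1 //= => r _.
have [full|nfull] := boolP [forall i, (d i <= r i)%N].
  rewrite (_ : nil_stratum d _ = 0); first by rewrite big1 // => e _; rewrite mul0r loc0 mulr0.
  rewrite -[RHS](@mu0 (qsp d)); apply: mu_ext => B; split=> // /andP[nB /forallP rB].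
  case: d0; apply: (socle_nonzero nB) => i.
  by rewrite /row_free eqn_leq rank_leq_row (eqP (rB i)) (forallP full i).
have [i ri] : exists i, ~~ (d i <= r i)%N by apply/existsP; rewrite -negb_forall.
pose g i j := inv (qfact LL (d i - j)) * gauss_count (d i - j) (d i - r i).
transitivity (\sum_(e : below d) loc (nil_stratum d (fun i => r i : nat)) * \prod_i g i (e i)).
  apply: eq_bigr => e _; rewrite locM loc_prod mulrCA; congr (_ * _).
  rewrite inv_prod => [|j]; last exact: invertible_qfact.
  rewrite -big_split; apply: eq_bigr => j _ /=; rewrite /g !ffunE; congr (_ * _).
  by rewrite loc_prod; apply: eq_bigr => k _; rewrite locB !locX.
suff g0 : \sum_(j < (d i).+1) g i j = 0.
  by rewrite -mulr_sumr sum_below [X in _ * X](bigD1 i) //= g0 mul0r mulr0.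
rewrite -[RHS](@gauss_sum0 (d i) (d i - r i)); last by rewrite subn_gt0 ltnNge ri leq_subr.
rewrite (reindex_inj rev_ord_inj); apply: eq_bigr => j _.
by rewrite /g /= subSS subKn // -ltnS.
Qed.

Definition recursion_term (x : dimvec Q -> MM) d e : MM :=
  zpow LL (- euler e (subdim d e)) * inv (qfactd LL (subdim d e)) *
    (x e * inv (motive (gl_group e))).

(** The two halves of the Euler form have different origins: the arrow part is the free block of
    [mu_killing], and the vertex part is the factor L^(sum_i e_i f_i) by which the class of G_d
    differs from that of the frames times that of G_e. *)
Lemma recursion_term_framed d e : (forall i, (e i <= d i)%N) ->
  recursion_term (fun e => motive (nullcone e)) d e * motive (gl_group d) =
  inv (qfactd LL (subdim d e)) * loc (mu (@framed Q (subdim d e) d)).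
Proof.
move=> ed; set f := subdim d e.
have fed i : (f i + e i)%N = d i by rewrite ffunE subnK.
rewrite (framed_motive fed) /recursion_term -/f.
have -> : motive (gl_group d) = \prod_i gauss_count (f i) (d i) *
    LL ^+ (\sum_i e i * f i) * motive (gl_group e).
  rewrite !gl_motive -prodrXr -!big_split; apply: eq_bigr => i _ /=.
  by rewrite -{1 2}(fed i) gauss_count_split fed mulnC.
have eulerE : - euler e f =
    (\sum_a e (src a) * f (tgt a))%N%:Z - (\sum_i e i * f i)%N%:Z.
  by rewrite /euler opprB !(big_morph Posz PoszD (erefl 0%:Z)).
have <- : zpow LL (- euler e f) * LL ^+ (\sum_i e i * f i)%N =
    LL ^+ (\sum_a e (src a) * f (tgt a))%N.
  by rewrite eulerE; apply: zpow_sub invertible_LL.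
have alg (z q nu Gi p l G : MM) : G * Gi = 1 ->
    z * q * (nu * Gi) * (p * l * G) = q * (p * (nu * (z * l))).
  move=> GiG; transitivity (q * (p * (nu * (z * l))) * (G * Gi)); first ring.
  by rewrite GiG mulr1.
exact/alg/invP/gl_invertible.
Qed.

Lemma recursion_term_top x d : recursion_term x d d = x d * inv (motive (gl_group d)).
Proof.
have E : subdim d d = 0 by apply/ffunP => i; rewrite !ffunE subnn.
rewrite /recursion_term E.
have -> : euler d 0 = 0.
  by rewrite /euler !big1 ?subr0 // => i _; rewrite ffunE muln0.
have -> : qfactd LL (0 : dimvec Q) = 1.
  by rewrite /qfactd big1 // => i _; rewrite ffunE /qfact big_geq.
by rewrite oppr0 /= (inv_unique (mulr1 1)) !mul1r.
Qed.

(** The left side of the recursion is the term e = d, where the power of L and (L)_0 are 1. *)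
Lemma nullcone_recursionE x d :
  nullcone_recursion x d <-> \sum_(e : below d) recursion_term x d (dim_of e) = 0.
Proof.
pose top : below d := [ffun i => ord_max].
have topE : dim_of top = d by apply/ffunP => i; rewrite !ffunE.
have dimE (e : below d) : (dim_of e != d) = (e != top).
  congr (~~ _); apply/eqP/eqP => [E|->//]; apply/ffunP => i; apply: val_inj.
  by have /ffunP/(_ i) := E; rewrite !ffunE.
have -> : \sum_(e : below d) recursion_term x d (dim_of e) =
    x d * inv (motive (gl_group d)) +
    \sum_(e : below d | dim_of e != d) recursion_term x d (dim_of e).
  by rewrite (bigD1 top) //= topE recursion_term_top (eq_bigl _ _ dimE).
rewrite /nullcone_recursion -/(recursion_term _ _ _).
by split=> [->|/eqP]; [rewrite addNr|rewrite addr_eq0 => /eqP].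
Qed.

Lemma dim_of_le d (e : below d) i : (dim_of e i <= d i)%N.
Proof. by rewrite ffunE -ltnS. Qed.

Lemma nullcone_satisfies_recursion d : d <> 0 ->
  nullcone_recursion (fun e => motive (nullcone e)) d.
Proof.
move=> d0; apply/nullcone_recursionE; apply: (invertible_cancel (gl_invertible d)).
rewrite mulr0 mulrC mulr_suml -[RHS](framed_motive_sum d0).
by apply: eq_bigr => e _; apply: recursion_term_framed; apply: dim_of_le.
Qed.

(** Induction on the total dimension: the right side involves only e < d, and the class of G_d is
    invertible. *)
Lemma nullcone_recursion_unique (x y : dimvec Q -> MM) : x 0 = y 0 ->
  (forall d, d <> 0 -> nullcone_recursion x d) ->
  (forall d, d <> 0 -> nullcone_recursion y d) -> forall d, x d = y d.
Proof.
move=> xy0 rx ry d; have [n] := ubnP (\sum_i d i)%N.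
elim: n d => // n IH d dn; have [->//|/eqP d0] := eqVneq d 0.
apply: (invertible_cancel (x := inv (motive (gl_group d)))).
  by exists (motive (gl_group d)); rewrite mulrC; apply: invP; apply: gl_invertible.
rewrite ![inv _ * _]mulrC (rx d d0) (ry d d0); congr (- _).
apply: eq_bigr => e ed; congr (_ * (_ * _)); apply: IH.
rewrite ltnS in dn; apply: leq_trans dn.
have [i ei] : exists i, dim_of e i != d i.
  by apply/existsP; rewrite -negb_forall; apply: contra ed => /forallP H;
    apply/eqP/ffunP => i; apply/eqP.
rewrite (bigD1 i) //= [leqRHS](bigD1 i) //= -addSn leq_add //.
  by rewrite ltn_neqAle ei dim_of_le.
by apply: leq_sum => j _; apply: dim_of_le.
Qed.

Lemma nullcone0 : motive (nullcone (0 : dimvec Q)) = 1.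
Proof.
rewrite motiveE nullcone_class -loc1; congr loc.
have no i : 'I_((0%R : dimvec Q) i) -> False by case=> m; rewrite ffunE.
have B0 (B C : qrep (0 : dimvec Q)) : B = C.
  by apply: functional_extensionality_dep => a; apply/matrixP => i; case: (no _ i).
apply: (@mu_point (qsp 0) _ (fun=> 0)).
  by apply: ddef_bool; apply: dbool_nilrep; apply: dmx_qsp.
move=> B; split=> [_|_]; first exact: B0.
apply/nilrepP; exists 0%N => s _; apply/matrixP => p.
by case: (no _ (tagged (enum_val p))).
Qed.

End Recursion.

(** The first conjunct certifies that the classes of the nullcones and groups, and the inverses of
    the latter, are genuine and not the default values of [K0_class] and [inv]. *)
Theorem theorem2p2 (Q : quiver) :
  (forall d : dimvec Q,
     [/\ zclosed (@nullcone_set Q d), is_variety (nullcone d),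
         is_variety (gl_group d) & invertible (motive (gl_group d))]) /\
  [/\ motive (nullcone (0 : dimvec Q)) = 1,
      forall d : dimvec Q, d <> 0 ->
        nullcone_recursion (fun e : dimvec Q => motive (nullcone e)) d
    & forall x : dimvec Q -> MM, x 0 = 1 ->
        (forall d : dimvec Q, d <> 0 -> nullcone_recursion x d) ->
        forall d : dimvec Q, d <> 0 -> x d = motive (nullcone d)].
Proof.
split=> [d|].
  split; [exact: nullcone_closed|exact: nullcone_variety|exact: gl_variety|].
  exact: gl_invertible.
split; [exact: nullcone0|exact: nullcone_satisfies_recursion|].
move=> x x0 rx d _; apply: (nullcone_recursion_unique (y := fun d => motive (nullcone d))) => //.
  by rewrite x0 nullcone0.
exact: nullcone_satisfies_recursion.
Qed.
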